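(* Let $\sigma,y,\beta$ be positive real numbers such that $\varepsilon:=\frac{\beta}{\sigma^2y}\in(0,1)$, and let $f\in\mathcal{F}_+^3$. Then the upper bound $\mathsf{E}f\big(\Gamma_{(1-\varepsilon)\sigma^2}+y\tilde\Pi_{\varepsilon\sigma^2/y^2}\big)$ on $\mathsf{E}f(S)$ is exact; that is, $$\sup\mathsf{E}f(X_1+\dots+X_n)=\mathsf{E}f\big(\Gamma_{(1-\varepsilon)\sigma^2}+y\tilde\Pi_{\varepsilon\sigma^2/y^2}\big),$$ where the supremum is taken over all natural $n$ and all independent random variables $X_1,\dots,X_n$ such that $$\sum_i\mathsf{E}X_i^2\le\sigma^2,\quad\sum_i\mathsf{E}(X_i)_+^3\le\beta,\quad\mathsf{E}X_i\le0\ \text{ and }\ X_i\le y\text{ a.s. for all }i.$$ Moreover, this equality remains true if the first three inequalities in this condition are replaced by the corresponding equalities, i.e. if the supremum is taken over all natural $n$ and all independent $X_1,\dots,X_n$ such that $\sum_i\mathsf{E}X_i^2=\sigma^2$, $\sum_i\mathsf{E}(X_i)_+^3=\beta$, and, for all $i$, $\mathsf{E}X_i=0$ and $X_i\le y$ a.s.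
   Context: Notation: $x_+:=\max(0,x)$ and $x_+^\alpha:=(x_+)^\alpha$. For $a>0$ and $\theta>0$, $\Gamma_{a^2}$ and $\Pi_\theta$ denote independent random variables with $\Gamma_{a^2}\sim N(0,a^2)$ (normal) and $\Pi_\theta\sim\mathrm{Pois}(\theta)$ (Poisson), and $\tilde\Pi_\theta:=\Pi_\theta-\theta$. $\mathcal{F}_+^3$ is the class of all twice continuously differentiable functions $f\colon\mathbb{R}\to\mathbb{R}$ such that $f$ and $f''$ are nondecreasing and convex; equivalently, such that $f,f',f'',f'''$ are all nondecreasing, where $f'''$ denotes the right derivative of the convex function $f''$. For convex $f$ and a random variable $X$ with finite mean, $\mathsf{E}f(X)$ exists in $(-\infty,\infty]$. *)

(* Defs.v *)
From mathcomp Require Import all_boot all_order all_algebra.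
From mathcomp Require Import all_classical all_reals all_analysis.

Set Implicit Arguments.
Unset Strict Implicit.
Unset Printing Implicit Defensive.

Import Order.TTheory GRing.Theory Num.Theory.
Import numFieldNormedType.Exports.

Local Open Scope classical_set_scope.
Local Open Scope ring_scope.

Definition F3plus (R : realType) (f : R -> R) : Prop :=
  [/\ forall x : R, derivable f x 1,
      forall x : R, derivable f^`()%classic x 1 &
      continuous f^`(2)%classic] /\
  [/\ nondecreasing_fun f, convex_function [set: R^o] f,
      nondecreasing_fun f^`(2)%classic &
      convex_function [set: R^o] f^`(2)%classic].

(* Product rule over the whole finite family; subfamilies are covered by
   taking [B i = setT]. *)
Definition mutually_independent d d' (T : measurableType d)
    (T' : measurableType d') (R : realType) (P : probability T R) (n : nat)
    (X : 'I_n -> {RV P >-> T'}) : Prop :=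
  forall B : 'I_n -> set T', (forall i, measurable (B i)) ->
    P (\bigcap_(i in [set: 'I_n]) (X i @^-1` B i)) =
    (\prod_(i < n) P (X i @^-1` B i))%E.

Definition independent_pair d d1 d2 (T : measurableType d)
    (T1 : measurableType d1) (T2 : measurableType d2) (R : realType)
    (P : probability T R) (X : {RV P >-> T1}) (Y : {RV P >-> T2}) : Prop :=
  forall (A : set T1) (B : set T2), measurable A -> measurable B ->
    P (X @^-1` A `&` Y @^-1` B) = (P (X @^-1` A) * P (Y @^-1` B))%E.

(* [normal_prob] takes the standard deviation, [v] is the variance.  Laws are
   compared on measurable sets only: the values of a measure elsewhere are
   irrelevant. *)
Definition normal_rv d (T : measurableType d) (R : realType)
    (P : probability T R) (v : R) (X : {RV P >-> R}) : Prop :=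
  forall A, measurable A -> distribution P X A = normal_prob 0 (Num.sqrt v) A.

(* The [nat] argument of [poisson_prob] (here [0%N]) is a dummy. *)
Definition poisson_rv d (T : measurableType d) (R : realType)
    (P : probability T R) (theta : R) (X : {RV P >-> nat}) : Prop :=
  forall A, measurable A -> distribution P X A = poisson_prob theta 0%N A.

Definition moment_bounds d (T : measurableType d) (R : realType)
    (P : probability T R) (sigma y beta : R) (n : nat)
    (X : 'I_n -> {RV P >-> R}) : Prop :=
  [/\ (\sum_(i < n) 'E_P[fun w => (X i w ^+ 2)%R] <= (sigma ^+ 2)%:E)%E,
      (\sum_(i < n) 'E_P[fun w => (Num.max 0 (X i w) ^+ 3)%R] <= beta%:E)%E,
      (forall i, 'E_P[X i] <= 0)%E &
      forall i, \forall w \ae P, X i w <= y].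

Definition moment_equalities d (T : measurableType d) (R : realType)
    (P : probability T R) (sigma y beta : R) (n : nat)
    (X : 'I_n -> {RV P >-> R}) : Prop :=
  [/\ (\sum_(i < n) 'E_P[fun w => (X i w ^+ 2)%R] = (sigma ^+ 2)%:E)%E,
      (\sum_(i < n) 'E_P[fun w => (Num.max 0 (X i w) ^+ 3)%R] = beta%:E)%E,
      (forall i, 'E_P[X i] = 0)%E &
      forall i, \forall w \ae P, X i w <= y].

(* Main.v *)
Require Import Defs.
From HB Require Import structures.
From mathcomp Require Import all_boot all_order all_algebra.
From mathcomp Require Import all_classical all_reals all_analysis.
From mathcomp Require Import measurable_realfun.
From mathcomp Require Import ring lra.

Import Order.TTheory GRing.Theory Num.Theory.
Import numFieldNormedType.Exports.

Local Open Scope classical_set_scope.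
Local Open Scope ring_scope.

(** Write S for X_1 + ... + X_n, and let Y be the Gauss-Poisson variable of
    the right-hand side.  Its law belongs to a two-parameter convolution
    semigroup: a centred normal law of variance v followed by y times a
    centred Poisson law of parameter theta ([levy y v theta], with
    [levyD]).  Here v = sigma^2 - beta/y and theta = beta/y^3, so that the
    total variance is sigma^2 and the third cumulant is beta.

    For f in the class, expand f(x + z) = f(x) + f'(x) z + z^2 k(x, z), where
    k(x, z) is the average of f''(x + uz) with weight 1 - u over 0 < u < 1.
    Since f'' is nonnegative, nondecreasing and convex, so is k in each of its
    two variables.  Two facts follow.

    - If Z <= y, E Z <= 0, E Z^2 <= s and E Z_+^3 <= b, then the convex
      function k(x, .) lies below its chord on [0, y] and below k(x, 0) on
      the negative half-line; hence
      E f(x + Z) <= f(x) + (s - b/y) k(x, 0) + (b/y) k(x, y)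
      ([avg_bounded_above]).
    - If Z is the normal law of variance v, then z^2 P(Z in dz) / v has mean
      0; if Z is y times the centred Poisson law, the law z^2 P(Z in dz),
      once normalised, has mean y.  Jensen's inequality for k(x, .) and then
      for k(., y) gives
      f(x) + v k(x, 0) + theta y^2 k(x, y) <= levy y v theta f x
      ([levy_ge]).

    With v = s - b/y and theta = b/y^3 the two right and left sides agree, so
    one summand is dominated by one step of the semigroup; replacing the
    summands one at a time ([levy_upper]) gives E f(S) <= E f(Y).  Slack in the
    moment constraints is first distributed over the summands
    ([spread_moments]).

    Conversely, [levy_ge] is sharp to first order: when k is Lipschitz, the
    error is o(1/n) for a step of size 1/n ([levy_le]).  A law on the points
    s, y, -s, 0 with small s has the prescribed moments divided by n and
    nearly attains the chord bound ([approximating_law]); for n independent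
    copies of it the errors add up to an arbitrarily small total
    ([levy_lower], [near_optimal_sum]).

    All of this is done for functions whose k is Lipschitz, that is, of cubic
    growth at plus infinity, so that every integral is finite.  A general f is
    replaced by the function which beyond a point K continues with a linear
    second derivative ([truncation]).  It agrees with f below K, which is all
    that E f(S) sees when K = n y, and it stays below f; letting K tend to
    infinity recovers E f(Y) by Fatou's lemma ([integral_le_of_approx]). *)

(** * Integration of real functions against a probability *)

Definition mkmfun {d d' : measure_display} {T : measurableType d}
    {T' : measurableType d'} (f : T -> T') (mf : measurable_fun [set: T] f) :
    {mfun T >-> T'} :=
  HB.pack f (isMeasurableFun.Build _ _ _ _ f mf).

Section integrable_functions.
Context {d : measure_display} {T : measurableType d} {R : realType}.
Variable P : probability T R.

Definition integrableR (f : T -> R) : Prop :=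
  P.-integrable [set: T] (EFin \o f).

Lemma integrableR_cst (c : R) : integrableR (fun=> c).
Proof. exact: finite_measure_integrable_cst. Qed.

Lemma integrableRD (f g : T -> R) :
  integrableR f -> integrableR g -> integrableR (fun x => f x + g x).
Proof. by move=> fi gi; apply: (integrableD measurableT fi gi). Qed.

Lemma integrableRZ (c : R) (f : T -> R) :
  integrableR f -> integrableR (fun x => c * f x).
Proof. by move=> fi; apply: (integrableZl measurableT c fi). Qed.

Lemma integrableRB (f g : T -> R) :
  integrableR f -> integrableR g -> integrableR (fun x => f x - g x).
Proof. by move=> fi gi; apply: (integrableB measurableT fi gi). Qed.

Lemma integrableR_norm (f : T -> R) :
  integrableR f -> integrableR (fun x => `|f x|).
Proof. by move=> fi; apply: (integrable_norm fi). Qed.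

Lemma integrableR_measurable (f : T -> R) :
  integrableR f -> measurable_fun [set: T] f.
Proof. by move=> /integrableP[/measurable_EFinP]. Qed.

Lemma le_integrableR {f : T -> R} (g : T -> R) : measurable_fun [set: T] f ->
  (forall x, `|f x| <= g x) -> integrableR g -> integrableR f.
Proof.
move=> mf fg gi; apply: (le_integrable measurableT _ _ gi).
  exact/measurable_EFinP.
move=> x _ /=; rewrite lee_fin; apply: (le_trans (fg x)); exact: ler_norm.
Qed.

Lemma RintD (f g : T -> R) : integrableR f -> integrableR g ->
  \int[P]_x (f x + g x) = \int[P]_x f x + \int[P]_x g x.
Proof. by move=> fi gi; rewrite RintegralD. Qed.

Lemma RintB (f g : T -> R) : integrableR f -> integrableR g ->
  \int[P]_x (f x - g x) = \int[P]_x f x - \int[P]_x g x.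
Proof. by move=> fi gi; rewrite RintegralB. Qed.

Lemma RintZ (c : R) (f : T -> R) : integrableR f ->
  \int[P]_x (c * f x) = c * \int[P]_x f x.
Proof. by move=> fi; rewrite RintegralZl. Qed.

Lemma Rint_cst (c : R) : \int[P]_x c = c.
Proof.
by rewrite Rintegral_cst//; have /= -> := probability_setT P; rewrite mulr1.
Qed.

Lemma le_Rint (f g : T -> R) : integrableR f -> integrableR g ->
  (forall x, f x <= g x) -> \int[P]_x f x <= \int[P]_x g x.
Proof. by move=> fi gi fg; apply: le_Rintegral. Qed.

Lemma Rint_ge0 (f : T -> R) : (forall x, 0 <= f x) -> 0 <= \int[P]_x f x.
Proof. by move=> f0; apply: Rintegral_ge0. Qed.

Lemma EFin_Rint (f : T -> R) : integrableR f ->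
  ((\int[P]_x f x)%R)%:E = (\int[P]_x (f x)%:E)%E.
Proof. by move=> fi; rewrite fineK// integrable_fin_num. Qed.

End integrable_functions.

(** * Functions with a monotone convex second-order remainder *)

Section cubic_class.
Context {R : realType}.
Implicit Types (g h : R -> R) (k : R -> R -> R) (mu : probability R R).

(** Convexity with coefficients in the real line itself, rather than in the
    subtype of the unit interval, so that arithmetic tactics apply. *)
Definition convexR h : Prop := forall t a b, 0 <= t <= 1 ->
  h (t * a + (1 - t) * b) <= t * h a + (1 - t) * h b.

(** All slopes lie between 0 and M: monotone and M-Lipschitz at once. *)
Definition slope_le (M : R) h : Prop :=
  forall a b, a <= b -> h a <= h b <= h a + M * (b - a).

(** The quotient [k x z] plays the role of the weighted average of g'' between
    x and x + z.  Recording its monotonicity, Lipschitz bound and convexity,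
    instead of properties of g'', makes the class stable under [avg] without
    differentiation under the integral sign. *)
Record taylor2 (M : R) g (g1 : R -> R) k : Prop := Taylor2 {
  t2_M : 0 <= M ;
  t2E : forall x z, g (x + z) = g x + g1 x * z + z ^+ 2 * k x z ;
  t2_g1 : forall x, 0 <= g1 x ;
  t2_k : forall x z, 0 <= k x z ;
  t2_slopel : forall z, slope_le M (k^~ z) ;
  t2_sloper : forall x, slope_le M (k x) ;
  t2_cvxl : forall z, convexR (k^~ z) ;
  t2_cvxr : forall x, convexR (k x) }.

Lemma slope_le_norm M h a b : 0 <= M -> slope_le M h ->
  `|h a - h b| <= M * `|a - b|.
Proof.
move=> M0 hM; wlog ab : a b / a <= b.
  by move=> W; have [/W//|/ltW/W] := leP a b; rewrite distrC (distrC b).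
have /andP[h1 h2] := hM _ _ ab.
by rewrite distrC ger0_norm ?subr_ge0// distrC ger0_norm ?subr_ge0//; lra.
Qed.

Lemma slope_le_measurable M h : slope_le M h -> measurable_fun [set: R] h.
Proof.
move=> hM; apply: nondecreasing_measurable => // a b ab.
by have /andP[] := hM _ _ ab.
Qed.

Lemma measurable_shift (x : R) (h : R -> R) : measurable_fun [set: R] h ->
  measurable_fun [set: R] (fun z => h (x + z)).
Proof.
by move=> mh; apply: (measurableT_comp mh); exact: measurable_funD.
Qed.

(** The convolution operator of mu: E g(x + Z) for Z of law mu.  Adding an
    independent summand to the argument amounts to composing such operators. *)
Definition avg mu g : R -> R := fun x => \int[mu]_z g (x + z).

(** The moments that make every g of the class integrable after a shift: the
    growth of g is quadratic on the left and cubic on the right. *)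
Definition admissible mu : Prop :=
  integrableR mu (fun z : R => z ^+ 2) /\
  integrableR mu (fun z : R => Num.max 0 z ^+ 3).

Lemma admissible_integrable mu : admissible mu -> integrableR mu id.
Proof.
move=> [m2 _]; apply: (le_integrableR mu (fun z => 1 + z ^+ 2)).
- exact: measurable_id.
- by move=> z; have [z0|z0] := leP 0 z;
    [rewrite ger0_norm//|rewrite ltr0_norm//]; nra.
- by apply: integrableRD => //; exact: integrableR_cst.
Qed.

Section theory.
Context {M : R} {g g1 : R -> R} {k : R -> R -> R}.
Hypothesis gk : taylor2 M g g1 k.

Lemma t2_nondecreasing : {homo g : x y / x <= y}.
Proof.
move=> x y xy; have := t2E _ _ _ _ gk x (y - x); rewrite addrC subrK => ->.
have := t2_g1 _ _ _ _ gk x; have := t2_k _ _ _ _ gk x (y - x) => k0 g0.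
have : 0 <= y - x by lra.
move=> h; rewrite -addrA lerDl; apply: addr_ge0; apply: mulr_ge0 => //.
exact: sqr_ge0.
Qed.

Lemma t2_g1_le x : g1 x <= g (x + 1) - g x.
Proof.
have := t2E _ _ _ _ gk x 1; rewrite expr1n mul1r mulr1 => ->.
have := t2_k _ _ _ _ gk x 1; lra.
Qed.

(** The expansions at x and at y, added together, express
    (g1 y - g1 x) (y - x) as a sum of two nonnegative remainders. *)
Lemma t2_g1_nondecreasing : {homo g1 : x y / x <= y}.
Proof.
move=> x y; rewrite le_eqVlt => /predU1P[->//|xy].
have := t2E _ _ _ _ gk x (y - x); rewrite addrC subrK => E1.
have := t2E _ _ _ _ gk y (x - y); rewrite addrC subrK => E2.
have k1 := t2_k _ _ _ _ gk x (y - x); have k2 := t2_k _ _ _ _ gk y (x - y).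
have h : 0 < y - x by lra.
suff : 0 <= (g1 y - g1 x) * (y - x) by rewrite pmulr_lge0// subr_ge0.
have -> : (g1 y - g1 x) * (y - x) =
  (y - x) ^+ 2 * k x (y - x) + (x - y) ^+ 2 * k y (x - y).
  by apply/eqP; rewrite -subr_eq0; apply/eqP; lra.
by apply: addr_ge0; apply: mulr_ge0 => //; exact: sqr_ge0.
Qed.

Lemma t2_measurable : measurable_fun [set: R] g.
Proof.
by apply: nondecreasing_measurable => //;
  exact: t2_nondecreasing.
Qed.

Lemma t2_g1_measurable : measurable_fun [set: R] g1.
Proof.
by apply: nondecreasing_measurable => //;
  exact: t2_g1_nondecreasing.
Qed.

Lemma t2_growth x z : `|g (x + z)| <=
  (`|g x| + g1 x) + ((g1 x + k x 0) * z ^+ 2 + M * Num.max 0 z ^+ 3).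
Proof.
have := t2E _ _ _ _ gk x z => ->.
have g0 := t2_g1 _ _ _ _ gk x; have k0 := t2_k _ _ _ _ gk x z.
have z2 : 0 <= z ^+ 2 := sqr_ge0 z.
have hz : `|z| <= 1 + z ^+ 2.
  by have [zz|zz] := leP 0 z; [rewrite ger0_norm//|rewrite ltr0_norm//]; nra.
have h1 : `|g1 x * z| <= g1 x * (1 + z ^+ 2).
  by rewrite normrM (ger0_norm g0) ler_wpM2l.
have h2 : z ^+ 2 * k x z <= k x 0 * z ^+ 2 + M * Num.max 0 z ^+ 3.
  have hs := t2_sloper _ _ _ _ gk x; have M0 := t2_M _ _ _ _ gk.
  have [zz|zz] := leP 0 z.
    have /andP[_] := hs 0 z zz; rewrite subr0 => hk.
    have := ler_wpM2l z2 hk; lra.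
  have /andP[hk _] := hs z 0 (ltW zz).
  by have := ler_wpM2l z2 hk; rewrite expr0n/=; lra.
apply: (le_trans (ler_normD _ _)); rewrite (ger0_norm (mulr_ge0 z2 k0)).
have := ler_normD (g x) (g1 x * z); lra.
Qed.

Lemma t2_lower x z : g x + g1 x * z <= g (x + z).
Proof.
rewrite (t2E _ _ _ _ gk) lerDl; apply: mulr_ge0; first exact: sqr_ge0.
exact: t2_k gk _ _.
Qed.

Variable mu : probability R R.
Hypothesis amu : admissible mu.

Lemma t2_integrable x : integrableR mu (fun z => g (x + z)).
Proof.
apply: (le_integrableR mu _ _ (t2_growth x)).
  by apply: measurable_shift; exact: t2_measurable.
apply: integrableRD; first exact: integrableR_cst.
by apply: integrableRD; apply: integrableRZ; case: amu.
Qed.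

Lemma t2_g1_integrable x : integrableR mu (fun z => g1 (x + z)).
Proof.
apply: (le_integrableR mu (fun z => g (x + 1 + z) - g (x + z))).
- by apply: measurable_shift; exact: t2_g1_measurable.
- move=> z; rewrite ger0_norm ?(t2_g1 _ _ _ _ gk)//.
  by rewrite addrAC; exact: t2_g1_le.
- by apply: integrableRB; exact: t2_integrable.
Qed.

Lemma t2_k_integrable x w : integrableR mu (fun z => k (x + z) w).
Proof.
apply: (le_integrableR mu (fun z => k x w + M * `|z|)).
- apply: (measurable_shift x (k^~ w)).
  exact: slope_le_measurable (t2_slopel _ _ _ _ gk w).
- move=> z; rewrite ger0_norm ?(t2_k _ _ _ _ gk)//.
  have := slope_le_norm _ _ (x + z) x (t2_M _ _ _ _ gk) (t2_slopel _ _ _ _ gk w).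
  rewrite addrAC subrr add0r => /= h.
  have := ler_norm (k (x + z) w - k x w); lra.
- apply: integrableRD; first exact: integrableR_cst.
  by apply/integrableRZ/integrableR_norm/admissible_integrable.
Qed.

(** Every condition of the class is a linear inequality between values of g,
    g1 and k at points shifted by the same amount, hence survives integration
    over the shift. *)
Lemma t2_avg : taylor2 M (avg mu g) (avg mu g1) (fun x z => avg mu (k^~ z) x).
Proof.
have M0 := t2_M _ _ _ _ gk.
have slope (F : R -> R -> R) a b : a <= b ->
    (forall z, integrableR mu (F z)) ->
    (forall z, F a z <= F b z <= F a z + M * (b - a)) ->
    \int[mu]_z F a z <= \int[mu]_z F b z <= \int[mu]_z F a z + M * (b - a).
  move=> ab Fi h; rewrite le_Rint//=; last by move=> z; have /andP[] := h z.
  rewrite -[in leRHS](Rint_cst mu (M * (b - a))) -RintD//; last first.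
    exact: integrableR_cst.
  apply: le_Rint => //.
    by apply: integrableRD => //; exact: integrableR_cst.
  by move=> z; have /andP[] := h z.
have cvx (F : R -> R -> R) t a b c : 
    (forall z, integrableR mu (F z)) ->
    (forall z, F c z <= t * F a z + (1 - t) * F b z) ->
    \int[mu]_z F c z <= t * \int[mu]_z F a z + (1 - t) * \int[mu]_z F b z.
  move=> Fi h; rewrite -!RintZ// -RintD//; try exact: integrableRZ.
  by apply: le_Rint => //; apply: integrableRD; exact: integrableRZ.
split => //.
- move=> x z; have i0 := t2_integrable x; have i1 := t2_g1_integrable x.
  have i2 := t2_k_integrable x z.
  have i1' := integrableRZ mu z _ i1; have i2' := integrableRZ mu (z ^+ 2) _ i2.
  transitivity (\int[mu]_w (g (x + w) + z * g1 (x + w) +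
                            z ^+ 2 * k (x + w) z)).
    apply: eq_Rintegral => w _.
    by rewrite (_ : x + z + w = x + w + z) ?(t2E _ _ _ _ gk) 1?[z * _]mulrC//; ring.
  rewrite (RintD _ _ _ (integrableRD _ _ _ i0 i1') i2').
  by rewrite (RintD _ _ _ i0 i1') !RintZ// [z * _]mulrC.
- by move=> x; apply: Rint_ge0 => z; exact: t2_g1 gk _.
- by move=> x z; apply: Rint_ge0 => w; exact: t2_k gk _ _.
- move=> z a b ab; apply: (slope (fun x w => k (x + w) z)) => //.
    by move=> x; exact: t2_k_integrable.
  move=> w; have := t2_slopel _ _ _ _ gk z (a + w) (b + w).
  by rewrite lerD2r => /(_ ab)/=; rewrite (_ : b + w - _ = b - a)//; lra.
- move=> x a b ab; apply: (slope (fun z w => k (x + w) z)) => //.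
    by move=> z; exact: t2_k_integrable.
  by move=> w; exact: t2_sloper gk _ _ _ ab.
- move=> z t a b t01; apply: (cvx (fun x w => k (x + w) z)).
    by move=> x; exact: t2_k_integrable.
  move=> w; have := t2_cvxl _ _ _ _ gk z t (a + w) (b + w) t01.
  by rewrite (_ : t * _ + _ = t * a + (1 - t) * b + w)//; ring.
- move=> x t a b t01; apply: (cvx (fun z w => k (x + w) z)).
    by move=> z; exact: t2_k_integrable.
  by move=> w; exact: t2_cvxr gk _ _ _ _ t01.
Qed.

End theory.

End cubic_class.

(** * One summand against its first three moments *)

Section convex_slopes.
Context {R : realType}.
Implicit Types (h : R -> R).

(** The supremum of the slopes of the chords ending at a is a subgradient at
    a, because chord slopes increase; monotonicity makes it nonnegative. *)
Lemma convex_subgradient h a : convexR h -> {homo h : x y / x <= y} ->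
  exists2 m, 0 <= m & forall z, h a + m * (z - a) <= h z.
Proof.
move=> ch hM.
have slopes w z : w < a -> a < z ->
    (h a - h w) / (a - w) <= (h z - h a) / (z - a).
  move=> wa az; rewrite ler_pdivrMr ?subr_gt0// mulrAC.
  rewrite ler_pdivlMr ?subr_gt0//; have wz : 0 < z - w by lra.
  have := ch ((z - a) / (z - w)) w z.
  have -> : (z - a) / (z - w) * w + (1 - (z - a) / (z - w)) * z = a.
    by field; lra.
  have -> : 0 <= (z - a) / (z - w) <= 1.
    rewrite divr_ge0 ?(ltW wz)//=; last by lra.
    by rewrite ler_pdivrMr// mul1r; lra.
  move=> /(_ isT); rewrite -(ler_pM2r wz).
  have -> : ((z - a) / (z - w) * h w + (1 - (z - a) / (z - w)) * h z) * (z - w)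
     = (z - a) * h w + (a - w) * h z by field; lra.
  by lra.
pose S := [set (h a - h z) / (a - z) | z in [set z | z < a]].
have SM z : a < z -> ubound S ((h z - h a) / (z - a)).
  by move=> az _ [w /= wa <-]; exact: slopes.
have S0 : S ((h a - h (a - 1)) / (a - (a - 1))) by exists (a - 1) => //=; lra.
have hS : has_sup S.
  split; [by eexists; exact: S0|exists ((h (a + 1) - h a) / (a + 1 - a))].
  by apply: SM; lra.
exists (sup S).
  apply: le_trans (ub_le_sup _ S0); last by case: hS.
  rewrite (_ : a - (a - 1) = 1); last by ring.
  have aa : a - 1 <= a by lra.
  by have := hM _ _ aa; lra.
move=> z; have [za|az|->] := ltgtP z a; last by lra.
  have : (h a - h z) / (a - z) <= sup S.
    by apply: ub_le_sup; [case: hS|exists z].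
  by rewrite ler_pdivrMr ?subr_gt0//; lra.
have : sup S <= (h z - h a) / (z - a).
  by apply: ge_sup; [eexists; exact: S0|exact: SM].
by rewrite ler_pdivlMr ?subr_gt0//; lra.
Qed.

Lemma slope_le_homo M h : slope_le M h -> {homo h : x y / x <= y}.
Proof. by move=> hM x y /hM/andP[]. Qed.

End convex_slopes.

Section one_step.
Context {R : realType} {M : R} {g g1 : R -> R} {k : R -> R -> R}.
Hypothesis gk : taylor2 M g g1 k.
Variable mu : probability R R.
Hypothesis amu : admissible mu.

Lemma t2_remainder_integrable x : integrableR mu (fun z => z ^+ 2 * k x z).
Proof.
have -> : (fun z => z ^+ 2 * k x z) = (fun z => (g (x + z) - g x) - g1 x * z).
  by apply/funext => z; rewrite (t2E _ _ _ _ gk); ring.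
apply: integrableRB; last first.
  by apply: integrableRZ; exact: admissible_integrable.
by apply: integrableRB; [exact: (t2_integrable gk _ amu)|exact: integrableR_cst].
Qed.

Lemma avg_expansion x : avg mu g x =
  g x + g1 x * (\int[mu]_z z) + \int[mu]_z (z ^+ 2 * k x z).
Proof.
have i1 := integrableRZ mu (g1 x) _ (admissible_integrable mu amu).
have i0 := integrableR_cst mu (g x).
transitivity (\int[mu]_z (g x + g1 x * z + z ^+ 2 * k x z)).
  by apply: eq_Rintegral => z _; rewrite (t2E _ _ _ _ gk).
rewrite (RintD _ _ _ (integrableRD _ _ _ i0 i1) (t2_remainder_integrable x)).
rewrite (RintD _ _ _ i0 i1) Rint_cst RintZ//.
exact: admissible_integrable.
Qed.

(** On 0 <= z <= y the convex function k x lies below its chord, whose excess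
    over k x 0 is linear in z; multiplied by z^2 this gives the term in the
    third moment of the positive part.  For z <= 0, monotonicity bounds k x z
    by k x 0. *)
Lemma avg_bounded_above y s2 b x : 0 < y ->
  (\forall z \ae mu, z <= y) -> \int[mu]_z z <= 0 ->
  \int[mu]_z z ^+ 2 <= s2 -> \int[mu]_z Num.max 0 z ^+ 3 <= b ->
  avg mu g x <= g x + s2 * k x 0 + (b / y) * (k x y - k x 0).
Proof.
move=> y0 zy m1 m2 m3; have [i2 i3] := amu.
have k0 := t2_k _ _ _ _ gk x 0; have ky := t2_k _ _ _ _ gk x y.
have k0y : k x 0 <= k x y.
  by have /andP[] := t2_sloper _ _ _ _ gk x 0 y (ltW y0).
have j2 := integrableRZ mu (k x 0) _ i2.
have j3 := integrableRZ mu ((k x y - k x 0) / y) _ i3.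
have chord z : z <= y ->
    z ^+ 2 * k x z <=
    k x 0 * z ^+ 2 + (k x y - k x 0) / y * Num.max 0 z ^+ 3.
  move=> zley; have [z0|z0] := leP 0 z.
    have := t2_cvxr _ _ _ _ gk x (z / y) y 0.
    have -> : 0 <= z / y <= 1.
      by rewrite divr_ge0 ?(ltW y0)//= ler_pdivrMr// mul1r.
    rewrite mulr0 addr0 divfK ?gt_eqF// => /(_ isT).
    move=> /(ler_wpM2l (sqr_ge0 z)) h; apply: (le_trans h).
    by rewrite le_eqVlt; apply/orP; left; apply/eqP; field; rewrite gt_eqF.
  rewrite expr0n/= mulr0 addr0 mulrC ler_wpM2r ?sqr_ge0//.
  by have /andP[] := t2_sloper _ _ _ _ gk x z 0 (ltW z0).
have main : \int[mu]_z (z ^+ 2 * k x z) <=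
    \int[mu]_z (k x 0 * z ^+ 2 + (k x y - k x 0) / y * Num.max 0 z ^+ 3).
  have jr := t2_remainder_integrable x.
  rewrite -lee_fin !EFin_Rint//; last exact: integrableRD.
  apply: ae_ge0_le_integral => //.
  - by move=> z _; rewrite lee_fin mulr_ge0 ?sqr_ge0// (t2_k _ _ _ _ gk).
  - by case/integrableP: jr.
  - move=> z _; rewrite lee_fin; apply: addr_ge0; apply: mulr_ge0.
    + exact: k0.
    + exact: sqr_ge0.
    + by rewrite divr_ge0 ?subr_ge0// ltW.
    + by rewrite exprn_ge0// le_max lexx.
  - by case/integrableP: (integrableRD _ _ _ j2 j3).
  - apply: filterS zy => z zy _; rewrite lee_fin; exact: chord.
rewrite avg_expansion -addrA -addrA lerD2l.
have g10 := t2_g1 _ _ _ _ gk x.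
have h1 : g1 x * (\int[mu]_z z) <= 0 by rewrite mulr_ge0_le0.
rewrite -[leRHS]add0r lerD//; apply: (le_trans main).
rewrite (RintD _ _ _ j2 j3) !RintZ// lerD//.
  by rewrite mulrC ler_wpM2r.
rewrite (_ : b / y * _ = (k x y - k x 0) / y * b); last by ring.
by rewrite ler_wpM2l// divr_ge0 ?subr_ge0// ltW.
Qed.

(** The moment conditions say that z^2 mu(dz), which has mass v, has mean a
    once normalised; the inequality is Jensen's for k x under it.  The normal
    law satisfies them with a = 0, the Poisson law of jump y with a = y. *)
Lemma avg_ge_tangent a v x : \int[mu]_z z = 0 -> \int[mu]_z z ^+ 2 = v ->
  integrableR mu (fun z => z ^+ 2 * (z - a)) ->
  \int[mu]_z (z ^+ 2 * (z - a)) = 0 ->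
  g x + v * k x a <= avg mu g x.
Proof.
move=> m1 m2 i3 m3; have [i2 _] := amu.
have [m _ hm] :=
  convex_subgradient _ a (t2_cvxr _ _ _ _ gk x)
    (slope_le_homo _ _ (t2_sloper _ _ _ _ gk x)).
rewrite avg_expansion m1 mulr0 addr0 lerD2l.
have -> : v * k x a =
    \int[mu]_z (k x a * z ^+ 2 + m * (z ^+ 2 * (z - a))).
  rewrite RintD; [|exact: integrableRZ|exact: integrableRZ].
  by rewrite !RintZ// m2 m3 mulr0 addr0 mulrC.
apply: le_Rint; [by apply: integrableRD; exact: integrableRZ| |].
  exact: t2_remainder_integrable.
move=> z; have := ler_wpM2l (sqr_ge0 z) (hm z); lra.
Qed.

(** The converse of the tangent inequality, with an error measured by how far
    the normalised law z^2 mu(dz) spreads around a. *)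
Lemma avg_le_lipschitz a v x e : \int[mu]_z z = 0 -> \int[mu]_z z ^+ 2 = v ->
  integrableR mu (fun z => z ^+ 2 * `|z - a|) ->
  \int[mu]_z (z ^+ 2 * `|z - a|) <= e ->
  avg mu g x <= g x + v * k x a + M * e.
Proof.
move=> m1 m2 i3 m3; have [i2 _] := amu; have M0 := t2_M _ _ _ _ gk.
rewrite avg_expansion m1 mulr0 addr0 -addrA lerD2l.
apply: (@le_trans _ _ (\int[mu]_z (k x a * z ^+ 2 + M * (z ^+ 2 * `|z - a|)))).
  apply: le_Rint; [exact: t2_remainder_integrable| |].
    by apply: integrableRD; exact: integrableRZ.
  move=> z; have := slope_le_norm _ _ z a M0 (t2_sloper _ _ _ _ gk x) => hz.
  have {}hz : k x z <= k x a + M * `|z - a|.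
    by have := ler_norm (k x z - k x a); lra.
  by have := ler_wpM2l (sqr_ge0 z) hz; lra.
rewrite RintD; [|exact: integrableRZ|exact: integrableRZ].
by rewrite !RintZ// m2 mulrC lerD2l ler_wpM2l.
Qed.

End one_step.

Section jensen.
Context {R : realType} (M : R) (h : R -> R) (mu : probability R R).
Hypotheses (M0 : 0 <= M) (ch : convexR h) (hM : slope_le M h).
Hypotheses (i1 : integrableR mu id) (m1 : \int[mu]_z z = 0).

Lemma slope_le_integrable x : integrableR mu (fun z => h (x + z)).
Proof.
apply: (le_integrableR mu (fun z => `|h x| + M * `|z|)).
- by apply: measurable_shift; exact: slope_le_measurable hM.
- move=> z; have := slope_le_norm _ _ (x + z) x M0 hM.
  rewrite addrAC subrr add0r => hz.
  have := ler_normD (h (x + z) - h x) (h x); rewrite subrK; lra.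
- apply: integrableRD; first exact: integrableR_cst.
  by apply: integrableRZ; exact: integrableR_norm.
Qed.

Lemma avg_ge_jensen x : h x <= avg mu h x.
Proof.
have [m _ hm] := convex_subgradient _ x ch (slope_le_homo _ _ hM).
have ic := integrableR_cst mu (h x); have im := integrableRZ mu m _ i1.
have -> : h x = \int[mu]_z (h x + m * z).
  by rewrite (RintD _ _ _ ic im) Rint_cst RintZ// m1 mulr0 addr0.
apply: le_Rint; [exact: integrableRD|exact: slope_le_integrable|].
by move=> z; have := hm (x + z); rewrite addrAC subrr add0r.
Qed.

Lemma avg_le_norm x e : \int[mu]_z `|z| <= e -> avg mu h x <= h x + M * e.
Proof.
move=> he; have ic := integrableR_cst mu (h x).
have im := integrableRZ mu M _ (integrableR_norm mu _ i1).
apply: (@le_trans _ _ (\int[mu]_z (h x + M * `|z|))).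
  apply: le_Rint; [exact: slope_le_integrable|exact: integrableRD|].
  move=> z; have := slope_le_norm _ _ (x + z) x M0 hM.
  rewrite addrAC subrr add0r => hz.
  by have := ler_norm (h (x + z) - h x); lra.
rewrite (RintD _ _ _ ic im) Rint_cst RintZ; last exact: integrableR_norm.
by rewrite lerD2l ler_wpM2l.
Qed.

End jensen.

(** * Taylor's formula with integral remainder *)

Section taylor_integral.
Context {R : realType}.
Notation leb := (@lebesgue_measure R).

Lemma continuous_integrable01 (phi : R -> R) : continuous phi ->
  leb.-integrable `[0, 1]%classic (EFin \o phi).
Proof.
move=> cphi; apply: continuous_compact_integrable.
  exact: segment_compact.
exact: continuous_subspaceT.
Qed.

Lemma slope_le_continuous (M : R) (h : R -> R) : 0 <= M -> slope_le M h ->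
  continuous h.
Proof.
move=> M0 hM x; apply/cvgrPdist_lt => e e0.
have M1 : 0 < M + 1 by lra.
near=> z.
apply: (@le_lt_trans _ _ (M * `|x - z|)); first exact: slope_le_norm.
apply: (@le_lt_trans _ _ ((M + 1) * `|x - z|)).
  by rewrite ler_wpM2r//; lra.
rewrite -ltr_pdivlMl// mulrC.
near: z; apply: (@cvgr_dist_lt _ _ _ _ _ id); first exact: cvg_id.
by rewrite divr_gt0.
Unshelve. all: end_near. Qed.

(** The integral-form remainder of order two, divided by z^2; unlike that
    quotient it has a meaningful value at z = 0. *)
Definition taylor_kernel (h : R -> R) (x z : R) : R :=
  \int[leb]_(u in `[0, 1]) ((1 - u) * h (x + u * z)).

Lemma continuous_taylor_weight (h : R -> R) x z : continuous h ->
  continuous (fun u : R => (1 - u) * h (x + u * z)).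
Proof.
move=> ch u; apply: cvgM.
  by apply: cvgB; [exact: cvg_cst|exact: cvg_id].
apply: continuous_comp; last exact: ch.
apply: cvgD; first exact: cvg_cst.
by apply: cvgM; [exact: cvg_id|exact: cvg_cst].
Qed.

(** The fundamental theorem of calculus, for the function F of u below, whose
    derivative is z^2 (1 - u) h (x + u z): integration by parts is built into
    the choice of F. *)
Lemma taylor_kernelE (g g1 h : R -> R) : continuous h ->
  (forall x : R, is_derive x 1 g (g1 x)) -> (forall x : R, is_derive x 1 g1 (h x)) ->
  forall x z, g (x + z) = g x + g1 x * z + z ^+ 2 * taylor_kernel h x z.
Proof.
move=> ch dg dg1 x z.
pose F : R -> R := fun u : R => (1 - u) * (z * g1 (x + u * z)) + g (x + u * z).
pose f := fun u : R => z ^+ 2 * ((1 - u) * h (x + u * z)).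
have dF (u : R) : is_derive u 1 F (f u).
  have dl : is_derive u 1 (fun u : R => x + u * z) z.
    apply/is_derive1_caratheodory; exists (fun=> z); split => //.
    - by move=> w; ring.
    - exact: cvg_cst.
  have dm : is_derive u 1 (fun u : R => 1 - u) (-1).
    apply/is_derive1_caratheodory; exists (fun=> -1); split => //.
    - by move=> w; ring.
    - exact: cvg_cst.
  have d1 := @is_derive1_comp _ g (fun u : R => x + u * z) _ _ _ (dg (x + u * z)) dl.
  have d2 := @is_derive1_comp _ g1 (fun u : R => x + u * z) _ _ _ (dg1 (x + u * z)) dl.
  have d3 := is_deriveM (is_derive_cst z u 1) d2.
  have d4 := is_deriveD (is_deriveM dm d3) d1.
  apply: is_derive_eq.
  rewrite scaler0 addr0 -[cst z u]/z -[(_ * _ : R -> R) u]/(z * g1 (x + u * z)).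
  by rewrite /f /GRing.scale/=; ring.
have cf : continuous f.
  move=> u; apply: cvgM; first exact: cvg_cst.
  exact: continuous_taylor_weight.
have cF : continuous F.
  by move=> u; exact/differentiable_continuous/derivable1_diffP.
have wf : {within `[0, 1], continuous f} by exact: continuous_subspaceT.
have lrF : derivable_oo_LRcontinuous F 0 1.
  split; first by move=> u _.
  - by apply: cvg_at_right_filter; exact: cF.
  - by apply: cvg_at_left_filter; exact: cF.
have F'f : {in `]0, 1[, F^`()%classic =1 f}.
  by move=> u _; rewrite derive1E; case: (dF u).
have := continuous_FTC2 ltr01 wf lrF F'f.
rewrite -EFinB => /(congr1 fine).
rewrite -[fine (integral _ _ _)]/(\int[leb]_(u in `[0,1]) f u) [fine _]/=.
rewrite RintegralZl//; last first.
  by apply: continuous_integrable01; exact: continuous_taylor_weight.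
rewrite /taylor_kernel => ->; rewrite /F subrr subr0 !mul0r !mul1r !addr0.
by ring.
Qed.

Section kernel_order.
Variables (h : R -> R) (M : R).
Hypotheses (M0 : 0 <= M) (h0 : forall x, 0 <= h x) (ch : convexR h)
  (hM : slope_le M h).

Let wi x z :
  leb.-integrable `[0, 1]%classic
    (EFin \o (fun u : R => (1 - u) * h (x + u * z))).
Proof.
apply: continuous_integrable01; apply: continuous_taylor_weight.
exact: slope_le_continuous M0 hM.
Qed.

Let leb01 : leb `[0, 1]%classic = 1%E.
Proof. by rewrite lebesgue_measure_itv/= lte_fin ltr01 oppr0 adde0. Qed.

Lemma taylor_kernel_ge0 x z : 0 <= taylor_kernel h x z.
Proof.
apply: Rintegral_ge0 => u /=; rewrite in_itv/= => /andP[u0 u1].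
by rewrite mulr_ge0// subr_ge0.
Qed.

(** D bounds the displacement of the argument of h for every u, which covers a
    change in either variable of the kernel. *)
Let slope (x z x' z' D : R) : 0 <= D ->
  (forall u, 0 <= u <= 1 -> 0 <= (x' + u * z') - (x + u * z) <= D) ->
  taylor_kernel h x z <= taylor_kernel h x' z' <= taylor_kernel h x z + M * D.
Proof.
move=> D0 hD; have MD0 : 0 <= M * D by rewrite mulr_ge0.
have hh u : 0 <= u <= 1 ->
    h (x + u * z) <= h (x' + u * z') <= h (x + u * z) + M * D.
  move=> /hD/andP[]; rewrite subr_ge0 => h1 h2.
  have /andP[-> /= h3] := hM _ _ h1; apply: (le_trans h3).
  by rewrite lerD2l ler_wpM2l.
apply/andP; split.
  apply: le_Rintegral => // u /=; rewrite in_itv/= => u01.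
  rewrite ler_wpM2l//; first by case/andP: u01; lra.
  by case/andP: (hh _ u01).
have -> : M * D = \int[leb]_(u in `[0, 1]) (M * D).
  by rewrite Rintegral_cst//; have /= -> := leb01; rewrite mulr1.
have ci : leb.-integrable `[0, 1]%classic (EFin \o (fun=> M * D)).
  by apply: continuous_integrable01 => u; exact: cvg_cst.
rewrite /taylor_kernel -RintegralD//.
apply: le_Rintegral => //; first exact: (integrableD _ (wi x z) ci).
move=> u /=; rewrite in_itv/= => u01; have /andP[u0 u1] := u01.
have u1' : 0 <= 1 - u by lra.
have /andP[_ /(ler_wpM2l u1')] := hh _ u01; nra.
Qed.

Let convex (x z x' z' x'' z'' t : R) : 0 <= t <= 1 ->
  (forall u, x'' + u * z'' = t * (x + u * z) + (1 - t) * (x' + u * z')) ->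
  taylor_kernel h x'' z'' <=
  t * taylor_kernel h x z + (1 - t) * taylor_kernel h x' z'.
Proof.
move=> t01 E.
have itZ (c x0 z0 : R) : leb.-integrable `[0, 1]%classic
    (EFin \o (fun u : R => c * ((1 - u) * h (x0 + u * z0)))).
  exact: (integrableZl _ c (wi x0 z0)).
rewrite /taylor_kernel -!RintegralZl// -RintegralD//.
apply: le_Rintegral => //; first exact: (integrableD _ (itZ _ _ _) (itZ _ _ _)).
move=> u /=; rewrite in_itv/= => u01; have /andP[u0 u1] := u01.
have u1' : 0 <= 1 - u by lra.
rewrite E; have := ler_wpM2l u1' (ch t (x + u * z) (x' + u * z') t01); lra.
Qed.

(** The argument x + u z is affine in x and in z with slopes 1 and u, both in
    the unit interval, and the weight 1 - u has total mass at most 1: every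
    property of h passes to the kernel in each variable. *)
Lemma taylor2_kernel (g g1 : R -> R) : (forall x, 0 <= g1 x) ->
  (forall x : R, is_derive x 1 g (g1 x)) -> (forall x : R, is_derive x 1 g1 (h x)) ->
  taylor2 M g g1 (taylor_kernel h).
Proof.
move=> g10 dg dg1; split => //.
- by apply: taylor_kernelE => //; exact: slope_le_continuous hM.
- exact: taylor_kernel_ge0.
- move=> z a b ab; apply: slope; first by rewrite subr_ge0.
  by move=> u _; rewrite opprD addrACA subrr addr0 lexx subr_ge0 ab.
- move=> x a b ab; apply: slope; first by rewrite subr_ge0.
  by move=> u /andP[u0 u1]; rewrite opprD addrACA subrr add0r -mulrBr; nra.
- by move=> z t a b t01; apply: convex => // u; ring.
- by move=> x t a b t01; apply: convex => // u; ring.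
Qed.

End kernel_order.

Lemma le_taylor_kernel (h h' : R -> R) : continuous h -> continuous h' ->
  (forall x, h x <= h' x) -> forall x z, taylor_kernel h x z <= taylor_kernel h' x z.
Proof.
move=> ch ch' hh' x z; apply: le_Rintegral => //.
- by apply: continuous_integrable01; exact: continuous_taylor_weight.
- by apply: continuous_integrable01; exact: continuous_taylor_weight.
- by move=> u /=; rewrite in_itv/= => /andP[u0 u1]; rewrite ler_wpM2l// subr_ge0.
Qed.

End taylor_integral.

(** * Truncating f to cubic growth *)

Section truncation.
Context {R : realType}.
Implicit Types (f g h : R -> R).

Lemma convex_functionR f : convex_function [set: R^o] f -> convexR f.
Proof.
move=> cf t a b /andP[t0 t1].
by have := cf (Itv01 t0 t1) a b; rewrite !inE => /(_ I I).
Qed.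

Lemma is_derive_MVT g (g1 : R -> R) a b :
  (forall x : R, is_derive x 1 g (g1 x)) -> a < b ->
  exists2 c, a < c < b & g b - g a = g1 c * (b - a).
Proof.
move=> dg ab.
have cg : {within `[a, b], continuous g}.
  apply: continuous_subspaceT => x.
  exact/differentiable_continuous/derivable1_diffP.
have dg' x : x \in `]a, b[ -> is_derive x 1 g (g1 x) by [].
by have [c] := MVT ab dg' cg; rewrite in_itv; exists c.
Qed.

(** Convexity of f makes f'' nonnegative and monotonicity makes f'
    nonnegative; both are read off the mean value theorem on intervals of
    length 1. *)
Lemma F3plus_derivatives f : F3plus f -> exists (g1 h : R -> R),
  [/\ forall x : R, is_derive x 1 f (g1 x),
      forall x : R, is_derive x 1 g1 (h x) & continuous h] /\
  [/\ forall x, 0 <= g1 x, forall x, 0 <= h x,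
      {homo h : x y / x <= y} & convexR h].
Proof.
move=> [[df df1 ch] [nf /convex_functionR cf nh /convex_functionR cvh]].
exists f^`()%classic, f^`(2)%classic.
have d1 (x : R) : is_derive x 1 f (f^`()%classic x).
  by apply: DeriveDef; [exact: df|rewrite derive1E].
have d2 (x : R) : is_derive x 1 f^`()%classic (f^`(2)%classic x).
  by apply: DeriveDef; [exact: df1|rewrite derive1nS derive1n1 derive1E].
(* If f'' x < 0 then f'' < 0 on the whole half-line left of x, as f'' is
   monotone, so f is strictly concave at x - 2, x - 1, x. *)
have h0 x : 0 <= f^`(2)%classic x.
  rewrite leNgt; apply/negP => hx.
  have x1 : x - 1 < x by lra.
  have x21 : x - 2 < x - 1 by lra.
  have [c1 /andP[h1 h1']] := is_derive_MVT f _ _ _ d1 x1.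
  rewrite (_ : x - (x - 1) = 1) ?mulr1 => [e1|]; last by ring.
  have [c2 /andP[h2 h2']] := is_derive_MVT f _ _ _ d1 x21.
  rewrite (_ : x - 1 - (x - 2) = 1) ?mulr1 => [e2|]; last by ring.
  have c12 : c2 < c1 by lra.
  have [c /andP[h3 h3'] e3] := is_derive_MVT _ _ _ _ d2 c12.
  have hc : f^`(2)%classic c < 0 by apply: le_lt_trans hx; apply: nh; lra.
  have neg : f^`(2)%classic c * (c1 - c2) < 0.
    by rewrite nmulr_rlt0// subr_gt0.
  have half : 0 <= (1 / 2 : R) <= 1.
    by rewrite divr_ge0//= ler_pdivrMr// mul1r ler1n.
  have := cf _ (x - 2) x half.
  rewrite (_ : 1 / 2 * (x - 2) + _ = x - 1); last by field.
  move: e1 e2 e3 neg; clear; lra.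
split; split => // x.
rewrite leNgt; apply/negP => fx.
have x1 : x - 1 < x by lra.
have [c /andP[c1 c2]] := is_derive_MVT f _ _ _ d1 x1.
rewrite (_ : x - (x - 1) = 1) ?mulr1 => [e|]; last by ring.
have [c' _ e'] := is_derive_MVT _ _ _ _ d2 c2.
have pos : 0 <= f^`(2)%classic c' * (x - c) by rewrite mulr_ge0// subr_ge0 ltW.
have := nf _ _ (ltW x1); move: e e' pos fx; clear; lra.
Qed.

Definition glue (K : R) (A B : R -> R) (x : R) : R :=
  if x <= K then A x else B x.

(** At the junction the difference quotients of the two pieces, in
    Caratheodory's form, are glued as well. *)
Lemma is_derive_glue K (A B A1 B1 : R -> R) :
  (forall x : R, is_derive x 1 A (A1 x)) ->
  (forall x : R, is_derive x 1 B (B1 x)) ->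
  A K = B K -> A1 K = B1 K ->
  forall x : R, is_derive x 1 (glue K A B) (glue K A1 B1 x).
Proof.
move=> dA dB AB AB1 x; have [xK|Kx|->] := ltgtP x K.
- rewrite {2}/glue (ltW xK).
  apply: (@near_eq_is_derive _ _ _ A) => //.
    near=> z; rewrite /glue ifT//; near: z.
    exact: lt_le_nbhsl.
- rewrite {2}/glue leNgt Kx /=.
  apply: (@near_eq_is_derive _ _ _ B) => //.
    near=> z; rewrite /glue ifF//; apply/negbTE; rewrite -ltNge; near: z.
    exact: lt_nbhsr.
- rewrite {2}/glue lexx.
  have /is_derive1_caratheodory[a [aE ca aK]] := dA K.
  have /is_derive1_caratheodory[b [bE cb bK]] := dB K.
  apply/is_derive1_caratheodory; exists (glue K a b); split.
  + by move=> z; rewrite /glue lexx; case: ifPn => _; [exact: aE|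
      rewrite AB; exact: bE].
  + move=> U; rewrite {1}/glue lexx => nU.
    have nU' : nbhs (b K) U by rewrite bK -AB1 -aK.
    suff : \forall z \near nbhs K, U (glue K a b z) by [].
    near=> z; rewrite /glue; case: ifP => _; near: z.
      exact: (ca _ nU).
    exact: (cb _ nU').
  + by rewrite /glue lexx.
Unshelve. all: end_near. Qed.

Lemma is_derive_cubic (c0 c1 c2 m K x : R) :
  is_derive x 1 (fun x : R => c0 + c1 * (x - K) + c2 / 2 * (x - K) ^+ 2 +
                              m / 6 * (x - K) ^+ 3)
    (c1 + c2 * (x - K) + m / 2 * (x - K) ^+ 2).
Proof.
apply/is_derive1_caratheodory.
exists (fun z => c1 + c2 / 2 * ((z - K) + (x - K)) +
  m / 6 * ((z - K) ^+ 2 + (z - K) * (x - K) + (x - K) ^+ 2)); split.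
- by move=> z; field.
- have cz : continuous (fun z : R => z - K).
    by move=> z; apply: cvgB; [exact: cvg_id|exact: cvg_cst].
  apply: cvgD.
    apply: cvgD; first exact: cvg_cst.
    apply: cvgM; first exact: cvg_cst.
    by apply: cvgD; [exact: cz|exact: cvg_cst].
  apply: cvgM; first exact: cvg_cst.
  apply: cvgD; last exact: cvg_cst.
  apply: cvgD; last by apply: cvgM; [exact: cz|exact: cvg_cst].
  by rewrite /= expr2; apply: cvgM; exact: cz.
- by field.
Qed.

(** Beyond K, f'' is replaced by a supporting line of itself at K, and f by the
    corresponding Taylor cubic.  The new second derivative stays monotone and
    convex, becomes Lipschitz with the slope of that line, and lies below f'',
    so the new function lies below f. *)
Lemma truncation f K : F3plus f -> exists M g1 k fK,
  [/\ taylor2 M fK g1 k,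
      forall x, x <= K -> fK x = f x & forall x, fK x <= f x].
Proof.
move=> /F3plus_derivatives[g1 [h [[d1 d2 ch] [g10 h0 nh cvh]]]].
have [m m0 hm] := convex_subgradient h K cvh nh.
pose hK := glue K h (fun x => h K + m * (x - K)).
pose gK := glue K g1 (fun x => g1 K + h K * (x - K) + m / 2 * (x - K) ^+ 2).
pose fK := glue K f (fun x => f K + g1 K * (x - K) + h K / 2 * (x - K) ^+ 2
   + m / 6 * (x - K) ^+ 3).
have dK1 (x : R) : is_derive x 1 fK (gK x).
  apply: is_derive_glue => //; try by rewrite subrr; ring.
  by move=> z; exact: is_derive_cubic.
have dK2 (x : R) : is_derive x 1 gK (hK x).
  apply: is_derive_glue => //; try by rewrite subrr; ring.
  move=> z; have := is_derive_cubic (g1 K) (h K) m 0 K z.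
  move=> dz.
  have -> : h K + m * (z - K) = h K + m * (z - K) + 0 / 2 * (z - K) ^+ 2.
    by ring.
  have -> : (fun x => g1 K + h K * (x - K) + m / 2 * (x - K) ^+ 2) =
    (fun x => g1 K + h K * (x - K) + m / 2 * (x - K) ^+ 2 + 0 / 6 * (x - K) ^+ 3).
    by apply/funext => w; ring.
  exact: dz.
have hKl x : x <= K -> hK x = h x by rewrite /hK /glue => ->.
have hKr x : K < x -> hK x = h K + m * (x - K).
  by move=> Kx; rewrite /hK /glue; case: ifPn => //; rewrite leNgt Kx.
have hKle x : hK x <= h x by rewrite /hK /glue; case: ifP => // _; exact: hm.
have hKge x : h K + m * (x - K) <= hK x.
  by rewrite /hK /glue; case: ifP => // _; exact: hm.
have hK0 x : 0 <= hK x.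
  rewrite /hK /glue; have [_|Kx] := leP x K => //=; apply: addr_ge0 => //.
  by apply: mulr_ge0 => //; lra.
have gK0 x : 0 <= gK x.
  rewrite /gK /glue; have [_|Kx] := leP x K => //=; have ? : 0 <= x - K by lra.
  apply: addr_ge0.
    by apply: addr_ge0; [exact: g10|apply: mulr_ge0; first exact: h0].
  by apply: mulr_ge0; [lra|exact: sqr_ge0].
(* The only case of convexity that mixes both pieces: when the
   intermediate point p lies left of K, compare with the chord of h from a to
   K and then with the supporting line. *)
have cvx_left a b t : 0 <= t <= 1 -> a <= K -> K < b ->
    hK (t * a + (1 - t) * b) <= t * hK a + (1 - t) * hK b.
  move=> /andP[t0 t1] aK Kb; set p := t * a + _.
  rewrite (hKr b Kb).
  have [pK|Kp] := leP p K; last first.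
    rewrite (hKr p Kp).
    have := ler_wpM2l t0 (hKge a); rewrite /p; lra.
  rewrite (hKl p pK) (hKl a aK).
  have [aK'|Ka] := ltP a K; last first.
    have aE : a = K by apply/le_anti; rewrite aK Ka.
    have := pK; rewrite /p aE => pK'.
    have [t1'|t1'] := ltP t 1; first by exfalso; nra.
    have -> : t = 1 by apply/le_anti; rewrite t1 t1'.
    by rewrite !subrr !mul0r !mul1r !addr0.
  have Ka : 0 < K - a by lra.
  pose s := (K - p) / (K - a).
  have s01 : 0 <= s <= 1.
    rewrite divr_ge0 ?(ltW Ka) ?subr_ge0//= ler_pdivrMr// mul1r.
    by rewrite /p; nra.
  have := cvh s a K s01.
  have -> : s * a + (1 - s) * K = p by rewrite /s; field; lra.
  move=> h1; apply: (le_trans h1).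
  have st : s <= t by rewrite ler_pdivrMr// /p; nra.
  have hp : s * a + (1 - s) * K = t * a + (1 - t) * b.
    by rewrite -/p /s; field; lra.
  have := hm a; have : 0 <= t - s by lra.
  move=> ts /(ler_wpM2l ts).
  have : m * (s * a + (1 - s) * K) = m * (t * a + (1 - t) * b) by rewrite hp.
  lra.
have cvxK : convexR hK.
  move=> t a b t01; have /andP[t0 t1] := t01.
  have [aK|Ka] := leP a K; have [bK|Kb] := leP b K.
  - have abK : t * a + (1 - t) * b <= K by nra.
    by rewrite !hKl//; exact: cvh.
  - exact: cvx_left.
  - have t01' : 0 <= 1 - t <= 1 by apply/andP; split; lra.
    have := cvx_left b a (1 - t) t01' bK Ka.
    by rewrite subKr [X in hK X]addrC [leRHS]addrC.
  - have abK : K <= t * a + (1 - t) * b by nra.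
    rewrite (hKr a Ka) (hKr b Kb); move: abK; rewrite le_eqVlt => /predU1P[e|/hKr->].
      rewrite -e hKl//; have : m * (t * a + (1 - t) * b) = m * K by rewrite -e.
      by lra.
    by lra.
have slopeK : slope_le m hK.
  move=> a b ab; have [bK|Kb] := leP b K; last first.
    rewrite (hKr b Kb); have [aK|Ka] := leP a K.
      rewrite (hKl a aK); have := nh _ _ aK; have := hm a => *.
      by apply/andP; split; nra.
    by rewrite (hKr a Ka); apply/andP; split; nra.
  rewrite (hKl b bK) (hKl a (le_trans ab bK)) (nh _ _ ab)/=.
  have [aK'|Ka] := ltP a K; last first.
    have -> : b = a by apply/le_anti; rewrite ab (le_trans bK Ka).
    by lra.
  have Ka : 0 < K - a by lra.
  pose s := (K - b) / (K - a).
  have s01 : 0 <= s <= 1.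
    rewrite divr_ge0 ?(ltW Ka) ?subr_ge0//= ler_pdivrMr// mul1r.
    by lra.
  have := cvh s a K s01.
  have -> : s * a + (1 - s) * K = b by rewrite /s; field; lra.
  have /andP[s0 s1] := s01; have s1' : 0 <= 1 - s by lra.
  have := ler_wpM2l s1' (hm a).
  have : (1 - s) * (K - a) = b - a by rewrite /s; field; lra.
  move=> e; have : m * ((1 - s) * (K - a)) = m * (b - a) by rewrite e.
  lra.
have T2 := taylor2_kernel hK m m0 hK0 cvxK slopeK fK gK gK0 dK1 dK2.
exists m, gK, (taylor_kernel hK), fK; split => //.
- by move=> x xK; rewrite /fK /glue xK.
- move=> x; have [xK|Kx] := leP x K; first by rewrite /fK /glue xK.
  have chK : continuous hK by exact: slope_le_continuous m0 slopeK.
  have := t2E _ _ _ _ T2 K (x - K); rewrite addrC subrK => ->.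
  have := taylor_kernelE f g1 h ch d1 d2 K (x - K); rewrite addrC subrK => ->.
  have := le_taylor_kernel _ _ chK ch hKle K (x - K) => /(ler_wpM2l (sqr_ge0 (x - K))).
  by rewrite {1}/fK {1}/gK /glue lexx; lra.
Qed.

End truncation.

(** * Densities, translations and normal laws *)

Section density.
Local Open Scope ereal_scope.
Context {d : measure_display} {T : measurableType d} {R : realType}.
Variables (mu nu : {measure set T -> \bar R}) (p : T -> R).
Hypotheses (p0 : forall x, (0 <= p x)%R) (mp : measurable_fun [set: T] p).
Hypothesis nuE : forall A, measurable A -> nu A = \int[mu]_(x in A) (p x)%:E.

Import HBNNSimple.

Let density_indic (A : set T) : measurable A ->
  \int[nu]_x (\1_A x)%:E = \int[mu]_x ((\1_A x)%:E * (p x)%:E).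
Proof.
move=> mA; rewrite integral_indic// setIT nuE// integral_mkcond.
apply: eq_integral => x _; rewrite patchE indicE.
by case: ifP => xA; rewrite ?mul1e ?mul0e.
Qed.

Let density_nnsfun (h : {nnsfun T >-> R}) :
  \int[nu]_x (h x)%:E = \int[mu]_x ((h x)%:E * (p x)%:E).
Proof.
under [LHS]eq_integral do rewrite fimfunE -fsumEFin//.
rewrite [LHS]ge0_integral_fsum//; last 2 first.
  - by move=> r; exact/measurable_EFinP/measurableT_comp.
  - by move=> n x _; rewrite EFinM nnfun_muleindic_ge0.
under [RHS]eq_integral => x _.
  rewrite fimfunE -fsumEFin// ge0_mule_fsuml; last first.
    by move=> r; rewrite EFinM nnfun_muleindic_ge0.
  over.
rewrite [RHS]ge0_integral_fsum//; last 2 first.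
  - move=> r; apply: emeasurable_funM; last exact/measurable_EFinP.
    exact/measurable_EFinP/measurableT_comp.
  - move=> n x _; rewrite mule_ge0//; last by rewrite lee_fin.
    by rewrite EFinM nnfun_muleindic_ge0.
apply: eq_fsbigr => r _.
have [r0|r0] := ltP r 0%R.
  rewrite preimage_nnfun0//.
  under eq_integral do rewrite indic0 mulr0.
  under [RHS]eq_integral do rewrite indic0 mulr0 mul0e.
  by rewrite !integral0.
under eq_integral do rewrite EFinM.
under [RHS]eq_integral do rewrite EFinM -muleA.
rewrite ge0_integralZl//; last exact/measurable_EFinP.
rewrite density_indic// ge0_integralZl//.
- by apply: emeasurable_funM; exact/measurable_EFinP.
- by move=> x _; rewrite mule_ge0// lee_fin.
Qed.

(** Change of measure, by monotone approximation with simple functions. *)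
Lemma ge0_integral_density (f : T -> \bar R) : measurable_fun [set: T] f ->
  (forall x, 0 <= f x) -> \int[nu]_x f x = \int[mu]_x (f x * (p x)%:E).
Proof.
move=> mf f0; pose f_ := nnsfun_approx measurableT mf.
have f_f x : (f_ n x)%:E @[n --> \oo] --> f x.
  by apply: cvg_nnsfun_approx => // y _; exact: f0.
transitivity (lim (\int[nu]_x (f_ n x)%:E @[n --> \oo])).
  rewrite -monotone_convergence//.
  - by apply: eq_integral => x _; apply/esym/cvg_lim => //; exact: f_f.
  - by move=> n; exact/measurable_EFinP.
  - by move=> n x _; rewrite lee_fin.
  - by move=> x _ a b ab; rewrite lee_fin; exact/lefP/nd_nnsfun_approx.
under eq_fun do rewrite density_nnsfun.
rewrite -monotone_convergence//.
- apply: eq_integral => x _; apply/cvg_lim => //.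
  by apply: cvgeZr => //; exact: f_f.
- move=> n; apply: emeasurable_funM; exact/measurable_EFinP.
- by move=> n x _; rewrite mule_ge0// lee_fin.
- move=> x _ a b ab; apply: lee_wpmul2r; first by rewrite lee_fin.
  by rewrite lee_fin; exact/lefP/nd_nnsfun_approx.
Qed.

End density.

Section translation.
Local Open Scope ereal_scope.
Context {R : realType}.
Notation leb := (@lebesgue_measure R).

Let mshift (c : R) :
  measurable_fun [set: measurableTypeR R]
    (fun x : measurableTypeR R => (c + x)%R : measurableTypeR R).
Proof. exact: measurable_funD. Qed.

Lemma lebesgue_measure_shift (c : R) (A : set R) : measurable A ->
  pushforward leb (mkmfun _ (mshift c)) A = leb A.
Proof.
move=> mA; apply/esym/lebesgue_measure_unique => //= _ [[a b]] _ <-.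
rewrite /pushforward.
have -> : mkmfun _ (mshift c) @^-1` `]a, b]%classic =
    `](a - c)%R, (b - c)%R]%classic.
  by apply/seteqP; split => x /=; rewrite !in_itv/= ltrBlDl lerBrDl.
rewrite /= !lebesgue_measure_itv/= !lte_fin ltrD2r -!EFinB.
by rewrite opprB addrA subrK.
Qed.

Lemma ge0_integral_shift (c : R) (f : R -> \bar R) :
  measurable_fun [set: R] f -> (forall x, 0 <= f x) ->
  \int[leb]_x f x = \int[leb]_x f (c + x)%R.
Proof.
move=> mf f0; transitivity (\int[pushforward leb (mkmfun _ (mshift c))]_x f x).
  by apply: eq_measure_integral => A mA _; exact/esym/lebesgue_measure_shift.
by rewrite ge0_integral_pushforward.
Qed.

Lemma ge0_integral_opp (f : R -> \bar R) :
  measurable_fun [set: R] f -> (forall x, 0 <= f x) ->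
  \int[leb]_x f x = \int[leb]_x f (- x)%R.
Proof.
move=> mf f0; transitivity (\int[pushforward leb (-%R : _ -> measurableTypeR R)]_x f x).
  by apply: eq_measure_integral => A mA _; exact/esym/lebesgue_measureN.
by rewrite ge0_integral_pushforward.
Qed.

End translation.

Section normal_density_facts.
Context {R : realType}.
Notation leb := (@lebesgue_measure R).

(** The density in terms of the variance, the parameter that adds up under
    convolution. *)
Lemma normal_pdf_var (m v x : R) : 0 < v -> normal_pdf m (Num.sqrt v) x =
  (Num.sqrt (v * pi *+ 2))^-1 * expR (- (x - m) ^+ 2 / (v *+ 2)).
Proof.
move=> v0; rewrite normal_pdfE ?gt_eqF ?sqrtr_gt0//.
by rewrite /normal_peak /normal_fun sqr_sqrtr// ltW.
Qed.

Lemma ge0_integral_normal (m s : R) (f : R -> \bar R) :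
  measurable_fun [set: R] f -> (forall x, (0 <= f x)%E) ->
  (\int[normal_prob m s]_x f x = \int[leb]_x (f x * (normal_pdf m s x)%:E))%E.
Proof.
move=> mf f0; apply: ge0_integral_density => //.
- exact: normal_pdf_ge0.
- exact: measurable_normal_pdf.
Qed.

(** The integrand times the density is a multiple of the density of variance
    v / (1 - 2cv).  This exponential moment controls all moments of the normal
    law. *)
Lemma normal_exp_square (v c : R) : 0 < v -> 2 * c * v < 1 ->
  (\int[normal_prob 0 (Num.sqrt v)]_x (expR (c * x ^+ 2))%:E =
   ((Num.sqrt (1 - 2 * c * v))^-1)%:E)%E.
Proof.
move=> v0 cv; rewrite ge0_integral_normal; last 2 first.
- apply/measurable_EFinP; apply: measurableT_comp => //.
  by apply: measurable_funM => //; exact: measurable_funX.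
- by move=> x; rewrite lee_fin expR_ge0.
set w := v / (1 - 2 * c * v).
have cv0 : 0 < 1 - 2 * c * v by lra.
have w0 : 0 < w by rewrite divr_gt0.
transitivity (\int[leb]_x (((Num.sqrt (1 - 2 * c * v))^-1)%:E *
    (normal_pdf 0 (Num.sqrt w) x)%:E))%E.
  apply: eq_integral => x _; rewrite -!EFinM; congr EFin.
  rewrite !normal_pdf_var// mulrCA -expRD.
  rewrite [in RHS]mulrA -invfM -sqrtrM ?(ltW cv0)//.
  congr (_^-1 * expR _).
    by congr (Num.sqrt _); rewrite /w; field; lra.
  by rewrite /w; field; lra.
rewrite ge0_integralZl//; last 2 first.
- by apply/measurable_EFinP; exact: measurable_normal_pdf.
- by move=> x _; rewrite lee_fin normal_pdf_ge0.
by rewrite integral_normal_pdf mule1.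
Qed.

Lemma normal_symmetric (v : R) (f : R -> \bar R) : 0 < v ->
  measurable_fun [set: R] f -> (forall x, (0 <= f x)%E) ->
  (\int[normal_prob 0 (Num.sqrt v)]_x f x =
   \int[normal_prob 0 (Num.sqrt v)]_x f (- x)%R)%E.
Proof.
move=> v0 mf f0.
have mN : measurable_fun [set: R] (fun x : R => - x) by exact: measurable_funN.
have mfN : measurable_fun [set: R] (fun x => f (- x)).
  exact: (measurableT_comp mf mN).
have mp : measurable_fun [set: R] (fun x => (normal_pdf 0 (Num.sqrt v) x)%:E).
  by apply/measurable_EFinP; exact: measurable_normal_pdf.
rewrite !ge0_integral_normal// ge0_integral_opp; last 2 first.
- exact: emeasurable_funM.
- by move=> x; rewrite mule_ge0// lee_fin normal_pdf_ge0.
apply: eq_integral => x _; congr (_ * _%:E)%E.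
by rewrite !normal_pdf_var// !subr0 sqrrN.
Qed.

(** Completing the square: the product of the densities of z and of u - z
    factors into the density of the sum u and the conditional density of z
    given u. *)
Lemma normal_pdf_conv (a b u z : R) : 0 < a -> 0 < b ->
  normal_pdf 0 (Num.sqrt a) z * normal_pdf 0 (Num.sqrt b) (u - z) =
  normal_pdf 0 (Num.sqrt (a + b)) u *
  normal_pdf (u * a / (a + b)) (Num.sqrt (a * b / (a + b))) z.
Proof.
move=> a0 b0; have ab0 : 0 < a + b by lra.
have c0 : 0 < a * b / (a + b) by rewrite divr_gt0// mulr_gt0.
have P0 := pi_gt0 R.
rewrite !normal_pdf_var// mulrACA [RHS]mulrACA -!expRD -!invfM.
have h v : 0 < v -> 0 <= v * (pi : R) *+ 2.
  by move=> v0; rewrite mulrn_wge0// mulr_ge0// ltW.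
rewrite -!sqrtrM ?h//; congr (_^-1 * expR _).
  by congr (Num.sqrt _); field; lra.
by field; lra.
Qed.

Notation RR := (measurableTypeR R).

(** After the substitution u = z + w and an exchange of integrals, the inner
    integral is that of a conditional density, equal to 1. *)
Lemma normal_conv (a b : R) (A : set R) : 0 < a -> 0 < b -> measurable A ->
  (\int[normal_prob 0 (Num.sqrt a)]_z
     normal_prob 0 (Num.sqrt b) [set w : R | A ((z : R) + w)%R] =
   normal_prob 0 (Num.sqrt (a + b)) A)%E.
Proof.
move=> a0 b0 mA.
have mplus : measurable_fun [set: RR * RR] (fun p : RR * RR => (p.1 : R) + (p.2 : R)).
  by apply: measurable_funD; [exact: measurable_fst|exact: measurable_snd].
have mS : measurable [set p : RR * RR | A ((p.1 : R) + (p.2 : R))].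
  by rewrite -[X in measurable X]setTI; exact: mplus.
have mp (v : R) : measurable_fun [set: R] (normal_pdf 0 (Num.sqrt v)).
  exact: measurable_normal_pdf.
have m1A : measurable_fun [set: R] (\1_A : R -> R) by exact: measurable_indic.
pose F (p : RR * RR) : \bar R := (\1_A p.2 * (normal_pdf 0 (Num.sqrt a) p.1 *
  normal_pdf 0 (Num.sqrt b) ((p.2 : R) - (p.1 : R))))%:E.
have mF : measurable_fun [set: RR * RR] F.
  apply/measurable_EFinP; apply: measurable_funM.
    exact: (measurableT_comp m1A measurable_snd).
  apply: measurable_funM; first exact: (measurableT_comp (mp a) measurable_fst).
  apply: (measurableT_comp (mp b)).
  by apply: measurable_funB; [exact: measurable_snd|exact: measurable_fst].
have F0 p : (0 <= F p)%E.
  by rewrite lee_fin !mulr_ge0// ?normal_pdf_ge0// indicE ler0n.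
have secE z : xsection [set p : RR * RR | A ((p.1 : R) + (p.2 : R))] z = [set w : R | A ((z : R) + w)%R].
  by apply/seteqP; split => w; rewrite /xsection/= inE.
transitivity (\int[leb]_z \int[leb]_u F (z, u))%E.
  rewrite ge0_integral_normal; last 2 first.
  - under eq_fun do rewrite -secE.
    exact: measurable_fun_xsection.
  - by move=> x; exact: measure_ge0.
  apply: eq_integral => z _ /=.
  transitivity ((\int[normal_prob 0 (Num.sqrt b)]_w (\1_A ((z : R) + w)%R)%:E) *
      (normal_pdf 0 (Num.sqrt a) z)%:E)%E.
    congr (_ * _)%E.
    have mAz : measurable [set w : R | A ((z : R) + w)%R].
      rewrite -[X in measurable X]setTI.
      by apply: (measurable_shift z id) => //; exact: measurable_id.
    by rewrite -[in LHS](setIT [set w : R | A ((z : R) + w)%R]) -integral_indic.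
  rewrite ge0_integral_normal; last 2 first.
  - apply/measurable_EFinP; exact: measurable_shift.
  - by move=> x; rewrite lee_fin indicE ler0n.
  rewrite (ge0_integral_shift (- z)); last 2 first.
  - apply: emeasurable_funM; apply/measurable_EFinP; last exact: mp.
    exact: measurable_shift.
  - by move=> x; apply: mule_ge0; rewrite lee_fin ?normal_pdf_ge0// indicE ler0n.
  rewrite -ge0_integralZr//.
  - apply: eq_integral => u _; rewrite /F /= -!EFinM; congr EFin.
    by rewrite addrA subrr add0r [- z + u]addrC mulrAC mulrA.
  - apply: emeasurable_funM; apply/measurable_EFinP.
      apply: (measurableT_comp m1A).
      by do 2 apply: measurable_funD => //.
    by apply: (measurableT_comp (mp b)); exact: measurable_funD.
  - by move=> x _; apply: mule_ge0; rewrite lee_fin ?normal_pdf_ge0// indicE ler0n.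
  - by rewrite lee_fin normal_pdf_ge0.
transitivity (\int[leb]_u \int[leb]_z F (z, u))%E.
  exact: (fubini_tonelli F mF F0).
rewrite /= /normal_prob [RHS]integral_mkcond.
apply: eq_integral => u _.
transitivity (\int[leb]_z ((\1_A u * normal_pdf 0 (Num.sqrt (a + b)) u)%:E *
   (normal_pdf (u * a / (a + b)) (Num.sqrt (a * b / (a + b))) z)%:E))%E.
  apply: eq_integral => z _; rewrite /F /= -EFinM; congr EFin.
  by rewrite normal_pdf_conv// mulrA.
rewrite ge0_integralZl//; last 3 first.
- by apply/measurable_EFinP; exact: measurable_normal_pdf.
- by move=> x _; rewrite lee_fin normal_pdf_ge0.
- by rewrite lee_fin mulr_ge0// ?normal_pdf_ge0// indicE ler0n.
rewrite integral_normal_pdf mule1 patchE indicE.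
by case: ifP => _; rewrite ?mul1r ?mul0r.
Qed.

End normal_density_facts.

(** * Laws of random variables and convolution *)

Section cube_pos.
Context {R : realType}.

Lemma cube_pos_ge0 (z : R) : 0 <= Num.max 0 z ^+ 3.
Proof. by rewrite exprn_ge0// le_max lexx. Qed.

Lemma measurable_cube_pos :
  measurable_fun [set: R] (fun z : R => Num.max 0 z ^+ 3).
Proof.
apply: measurable_funX.
apply: nondecreasing_measurable => // a b ab.
by rewrite ge_max !le_max lexx ab orbT.
Qed.

Lemma cube_pos_add (a b : R) : Num.max 0 (a + b) ^+ 3 <=
  4 * Num.max 0 a ^+ 3 + 4 * Num.max 0 b ^+ 3.
Proof.
have p0 : 0 <= Num.max 0 a by rewrite le_max lexx.
have q0 : 0 <= Num.max 0 b by rewrite le_max lexx.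
have pq : Num.max 0 (a + b) <= Num.max 0 a + Num.max 0 b.
  rewrite ge_max addr_ge0//=.
  by apply: lerD; rewrite le_max lexx orbT.
have pq0 : 0 <= Num.max 0 (a + b) by rewrite le_max lexx.
apply: (@le_trans _ _ ((Num.max 0 a + Num.max 0 b) ^+ 3)).
  by rewrite lerXn2r// nnegrE// addr_ge0.
move: p0 q0; set p := Num.max 0 a; set q := Num.max 0 b => p0 q0.
have : 0 <= (p + q) * (p - q) ^+ 2 by rewrite mulr_ge0 ?sqr_ge0// addr_ge0.
by lra.
Qed.

End cube_pos.

Section laws.
Context {d : measure_display} {T : measurableType d} {R : realType}.
Variable P : probability T R.

(** Equality on measurable sets only; it transports integrals between
    probabilities that are not equal as set functions. *)
Definition has_law (X : {mfun T >-> R}) (mu : probability R R) : Prop :=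
  forall A, measurable A -> P (X @^-1` A) = mu A.

Lemma integrableR_law {X : {mfun T >-> R}} {mu : probability R R}
    (f : R -> R) :
  has_law X mu -> integrableR mu f -> integrableR P (fun w => f (X w)).
Proof.
move=> Xmu fi; have mf := integrableR_measurable _ _ fi.
apply/integrableP; split.
  by apply/measurable_EFinP; exact: (measurableT_comp mf).
case/integrableP: fi => _; apply: le_lt_trans.
rewrite (eq_measure_integral (distribution P X)); last first.
  by move=> A mA _; exact/esym/Xmu.
rewrite /distribution ge0_integral_pushforward//.
by apply/measurableT_comp => //; exact/measurable_EFinP.
Qed.

Lemma Rint_law {X : {mfun T >-> R}} {mu : probability R R} (f : R -> R) :
  has_law X mu -> measurable_fun [set: R] f ->
  integrableR P (fun w => f (X w)) ->
  \int[P]_w f (X w) = \int[mu]_z f z.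
Proof.
move=> Xmu mf fi.
rewrite [RHS]/Rintegral (eq_measure_integral (distribution P X)); last first.
  by move=> A mA _; exact/esym/Xmu.
by rewrite /distribution integral_pushforward//; exact/measurable_EFinP.
Qed.

(** X and Y are independent, of laws mu and nu. *)
Definition joint_law (X Y : {mfun T >-> R}) (mu nu : probability R R) : Prop :=
  forall A B, measurable A -> measurable B ->
  P (X @^-1` A `&` Y @^-1` B) = (mu A * nu B)%E.

Lemma joint_law1 {X Y : {mfun T >-> R}} {mu nu : probability R R} :
  joint_law X Y mu nu -> has_law X mu.
Proof.
move=> XY A mA; have := XY A setT mA measurableT.
by rewrite preimage_setT setIT probability_setT mule1.
Qed.

Lemma joint_law2 {X Y : {mfun T >-> R}} {mu nu : probability R R} :
  joint_law X Y mu nu -> has_law Y nu.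
Proof.
move=> XY A mA; have := XY setT A measurableT mA.
by rewrite preimage_setT setTI probability_setT mul1e.
Qed.

Context {M : R} {g g1 : R -> R} {k : R -> R -> R}.
Hypothesis gk : taylor2 M g g1 k.

Lemma integrableR_sum {X Y : {mfun T >-> R}} {mu nu : probability R R} x :
  joint_law X Y mu nu -> admissible mu -> admissible nu ->
  integrableR P (fun w => g (x + (X w + Y w))).
Proof.
move=> XY [m2 m3] [n2 n3].
have iX2 := integrableR_law _ (joint_law1 XY) m2.
have iX3 := integrableR_law _ (joint_law1 XY) m3.
have iY2 := integrableR_law _ (joint_law2 XY) n2.
have iY3 := integrableR_law _ (joint_law2 XY) n3.
have ic := integrableR_cst P (`|g x| + g1 x).
have g10 := t2_g1 _ _ _ _ gk x; have k0 := t2_k _ _ _ _ gk x 0.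
have M0 := t2_M _ _ _ _ gk.
apply: (le_integrableR P (fun w => (`|g x| + g1 x) +
  ((2 * (g1 x + k x 0)) * (X w ^+ 2) +
  ((2 * (g1 x + k x 0)) * (Y w ^+ 2) +
  ((4 * M) * (Num.max 0 (X w) ^+ 3) + (4 * M) * (Num.max 0 (Y w) ^+ 3))))));
    last first.
  apply: integrableRD => //.
  apply: integrableRD; first exact: integrableRZ.
  apply: integrableRD; first exact: integrableRZ.
  by apply: integrableRD; exact: integrableRZ.
- move=> w; apply: (le_trans (t2_growth gk x (X w + Y w))).
  set a := X w; set b := Y w.
  have gk0 : 0 <= g1 x + k x 0 by apply: addr_ge0.
  have h2 : (g1 x + k x 0) * (a + b) ^+ 2 <=
      (g1 x + k x 0) * (2 * a ^+ 2 + 2 * b ^+ 2).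
    by apply: ler_wpM2l => //; have := sqr_ge0 (a - b); nra.
  have := ler_wpM2l M0 (cube_pos_add a b).
  lra.
- apply: (measurableT_comp (t2_measurable gk)).
  by apply: measurable_funD => //; exact: measurable_funD.
Qed.

End laws.

Section sums.
Context {R : realType} {M : R} {g g1 : R -> R} {k : R -> R -> R}.
Hypothesis gk : taylor2 M g g1 k.

Definition fst_mfun : {mfun (R * R)%type >-> R} := mkmfun _ (@measurable_fst _ _ R R).
Definition snd_mfun : {mfun (R * R)%type >-> R} := mkmfun _ (@measurable_snd _ _ R R).

Lemma joint_law_prod (mu nu : probability R R) :
  joint_law (mu \x nu)%E fst_mfun snd_mfun mu nu.
Proof.
move=> A B mA mB; rewrite -product_measure1E//.
Qed.

Context {d : measure_display} {T : measurableType d} {P : probability T R}.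

(** The pair has the product law, so Fubini's theorem turns the expectation of
    a function of the sum into an iterated average. *)
Lemma avg_sum (X Y : {mfun T >-> R}) (mu nu : probability R R) x :
  joint_law P X Y mu nu -> admissible mu -> admissible nu ->
  \int[P]_w g (x + (X w + Y w)) = avg mu (avg nu g) x.
Proof.
move=> XY amu anu.
have mphi : measurable_fun [set: T] (fun w => (X w, Y w)).
  by apply/measurable_fun_pairP; split => /=.
pose phi := mkmfun _ mphi.
pose G (p : (R * R)%type) := g (x + (p.1 + p.2)).
have mG : measurable_fun [set: (R * R)%type] G.
  apply: (measurableT_comp (t2_measurable gk)).
  apply: measurable_funD => //; apply: measurable_funD.
    exact: measurable_fst.
  exact: measurable_snd.
have iG : integrableR (mu \x nu)%E G.
  exact: (integrableR_sum _ gk x (joint_law_prod mu nu)).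
have iP := integrableR_sum P gk x XY amu anu.
rewrite /avg /Rintegral.
transitivity (fine (\int[(mu \x nu)%E]_p (G p)%:E)).
  congr fine.
  rewrite (eq_measure_integral (distribution P phi)); last first.
    move=> A mA _; apply: product_measure_unique => // B C mB mC.
  by rewrite /distribution integral_pushforward//; exact/measurable_EFinP.
rewrite -integral12_prod_meas1//; congr fine; apply: eq_integral => z _.
rewrite /fubini_F /= fineK.
  by apply: eq_integral => w _; rewrite /G /= addrA.
apply: integrable_fin_num => //.
exact: (t2_integrable gk _ anu (x + z)).
Qed.

End sums.

(** The semigroup property of a family of laws, stated for measures, becomes
    one for averaging operators. *)
Lemma avg_conv {R : realType} {M : R} {g g1 : R -> R} {k : R -> R -> R}
    (gk : taylor2 M g g1 k) (mu nu lam : probability R R) x :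
  (forall A, measurable A ->
    (\int[mu]_z nu [set w : R | A ((z : R) + w)%R] = lam A)%E) ->
  admissible mu -> admissible nu ->
  avg mu (avg nu g) x = avg lam g x.
Proof.
move=> conv amu anu.
have mS : measurable_fun [set: (R * R)%type] (fun p : (R * R)%type => p.1 + p.2).
  by apply: measurable_funD; [exact: measurable_fst|exact: measurable_snd].
pose S := mkmfun _ mS.
have Slam : has_law (mu \x nu)%E S lam.
  move=> A mA; rewrite -conv//=; apply: eq_integral => z _; congr (nu _).
  by apply/seteqP; split => w; rewrite /xsection/= inE.
have jl := joint_law_prod mu nu.
have iG : integrableR (mu \x nu)%E (fun p => g (x + (p.1 + p.2))).
  exact: (integrableR_sum _ gk x jl).
have := Rint_law (mu \x nu)%E (fun z => g (x + z)) Slam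
  (measurable_shift x g (t2_measurable gk)) iG.
rewrite /= -/(avg lam g x) => <-.
by rewrite -(avg_sum gk fst_mfun snd_mfun _ _ _ jl).
Qed.

(** * Gaussian laws of variance at least 0 *)

Section gauss.
Context {R : realType}.
Implicit Types (v : R).

(** The normal law lives on the real line equipped with its Lebesgue Borel
    structure; the identity carries it to the default measurable structure. *)
Definition borel_id : {mfun measurableTypeR R >-> R} :=
  mkmfun (id : measurableTypeR R -> R) (@measurable_id _ R setT).

(** The normal law of variance v, with the point mass at 0 for v = 0, as the
    semigroup needs its identity. *)
Definition gauss v : probability R R :=
  if 0 < v
  then (distribution (normal_prob 0 (Num.sqrt v)) borel_id : probability R R)
  else (\d_(0 : R) : probability R R).

Lemma gaussE v A : 0 < v -> gauss v A = normal_prob 0 (Num.sqrt v) A.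
Proof. by rewrite /gauss => ->. Qed.

Lemma gauss0E A : gauss 0 A = \d_(0 : R) A.
Proof. by rewrite /gauss ltxx. Qed.

Lemma ge0_integral_gauss v (f : R -> \bar R) : 0 < v ->
  measurable_fun [set: R] f -> (forall x, (0 <= f x)%E) ->
  (\int[gauss v]_x f x = \int[normal_prob 0 (Num.sqrt v)]_x f x)%E.
Proof.
move=> v0 mf f0.
rewrite (eq_measure_integral
  (distribution (normal_prob 0 (Num.sqrt v)) borel_id)); last first.
  by move=> A mA _; rewrite /gauss v0.
by rewrite /distribution ge0_integral_pushforward.
Qed.

Lemma gauss_conv (a b : R) (A : set R) : 0 <= a -> 0 <= b -> measurable A ->
  (\int[gauss a]_z gauss b [set w : R | A ((z : R) + w)%R] = gauss (a + b) A)%E.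
Proof.
move=> a0 b0 mA.
have mF : measurable_fun [set: R]
    (fun z : R => gauss b [set w : R | A ((z : R) + w)%R]).
  have mS : measurable [set p : (R * R)%type | A (p.1 + p.2)].
    have mplus : measurable_fun [set: (R * R)%type]
        (fun p : (R * R)%type => p.1 + p.2).
      by apply: measurable_funD; [exact: measurable_fst|exact: measurable_snd].
    by rewrite -[X in measurable X]setTI; exact: mplus.
  have := @measurable_fun_xsection _ _ R R R (gauss b) _ mS.
  congr (measurable_fun _ _); apply/funext => z /=; congr (gauss b _).
  by apply/seteqP; split => w; rewrite /xsection/= inE.
move: a0; rewrite le_eqVlt => /predU1P[<-|a0].
  rewrite (eq_measure_integral \d_(0 : R)); last first.
    by move=> B mB _; exact: gauss0E.
  rewrite integral_dirac//= diracT mul1e add0r.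
  by congr (gauss b _); apply/seteqP; split => w /=; rewrite add0r.
move: b0; rewrite le_eqVlt => /predU1P[b0|b0].
  subst b; rewrite addr0.
  transitivity (\int[gauss a]_z (\1_A z)%:E)%E; last first.
    by rewrite integral_indic// setIT.
  apply: eq_integral => z _; rewrite gauss0E diracE indicE.
  by congr (_%:R%:E); apply: (congr1 nat_of_bool); apply/idP/idP;
    rewrite !inE/= addr0.
have ab0 : 0 < a + b by rewrite addr_gt0.
rewrite [RHS](gaussE _ _ ab0) -[RHS](normal_conv a b A a0 b0 mA).
rewrite (ge0_integral_gauss a _ a0 mF); last by move=> x; exact: measure_ge0.
by apply: eq_integral => z _; rewrite gaussE.
Qed.

Lemma gauss_exp v c : 0 < v -> 2 * c * v < 1 ->
  integrableR (gauss v) (fun z => expR (c * z ^+ 2)) /\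
  \int[gauss v]_z expR (c * z ^+ 2) = (Num.sqrt (1 - 2 * c * v))^-1.
Proof.
move=> v0 cv.
have mE : measurable_fun [set: R] (fun z : R => expR (c * z ^+ 2)).
  apply: measurableT_comp => //.
  by apply: measurable_funM => //; exact: measurable_funX.
have E : (\int[gauss v]_z (expR (c * z ^+ 2))%:E =
    ((Num.sqrt (1 - 2 * c * v))^-1)%:E)%E.
  rewrite ge0_integral_gauss ?normal_exp_square//; first exact/measurable_EFinP.
have intE : integrableR (gauss v) (fun z => expR (c * z ^+ 2)).
  apply/integrableP; split; first exact/measurable_EFinP.
  under eq_integral do rewrite /= ger0_norm ?expR_ge0//.
  by rewrite E ltry.
by split => //; rewrite /Rintegral E.
Qed.

Lemma expr4 (z : R) : z ^+ 4 = (z ^+ 2) ^+ 2.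
Proof. by rewrite -exprM. Qed.

(** Square the tangent bound 1 + p <= exp p with p = q / 2. *)
Lemma expR_quadratic (q : R) : 0 <= q -> q ^+ 2 <= 4 * expR q.
Proof.
move=> q0; have -> : q = q / 2 + q / 2 by field.
rewrite expRD; have := expR_ge1Dx (q / 2); have : 0 <= q / 2 by lra.
move: (q / 2) (expR (q / 2)) => p e p0 pe.
have : 0 <= (e - (1 + p)) * (e + (1 + p)) by apply: mulr_ge0; lra.
by lra.
Qed.

(** The exponent 1/(4v) is half the critical one, so these exponentials are
    integrable with an integral that does not depend on v. *)
Lemma gauss_power_bound v z : 0 < v ->
  z ^+ 2 <= 4 * v * expR ((4 * v)^-1 * z ^+ 2) /\
  z ^+ 4 <= 64 * v ^+ 2 * expR ((4 * v)^-1 * z ^+ 2).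
Proof.
move=> v0; set q := (4 * v)^-1 * z ^+ 2.
have q0 : 0 <= q by rewrite mulr_ge0 ?sqr_ge0// invr_ge0; lra.
have zq : z ^+ 2 = 4 * v * q by rewrite /q; field; lra.
split; first by rewrite zq ler_wpM2l//; [lra|have := expR_ge1Dx q; lra].
rewrite expr4 zq (_ : (4 * v * q) ^+ 2 = 16 * v ^+ 2 * q ^+ 2); last by ring.
rewrite (_ : 64 * v ^+ 2 * _ = 16 * v ^+ 2 * (4 * expR q)); last by ring.
by rewrite ler_wpM2l ?expR_quadratic// mulr_ge0// sqr_ge0.
Qed.

Let c14 v : 0 < v -> 2 * (4 * v)^-1 * v < 1.
Proof. by move=> v0; rewrite (_ : _ * _ = 2^-1); [lra|field; lra]. Qed.

Lemma gauss_integrable v (F : R -> R) : 0 < v -> measurable_fun [set: R] F ->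
  (exists a b, forall z, `|F z| <= a + b * z ^+ 4) -> integrableR (gauss v) F.
Proof.
move=> v0 mF [a [b Fab]]; have [ie _] := gauss_exp v _ v0 (c14 v v0).
apply: (le_integrableR (gauss v)
   (fun z => a + (`|b| * (64 * v ^+ 2)) * expR ((4 * v)^-1 * z ^+ 2))) => //.
  move=> z; apply: (le_trans (Fab z)); rewrite lerD2l.
  have [_ /(ler_wpM2l (normr_ge0 b)) h] := gauss_power_bound v z v0.
  rewrite -mulrA; apply: le_trans h.
  apply: ler_wpM2r; last exact: ler_norm.
  by rewrite expr4 sqr_ge0.
apply: integrableRD; first exact: integrableR_cst.
exact: integrableRZ.
Qed.

Lemma gauss_odd v (F : R -> R) : 0 < v -> integrableR (gauss v) F ->
  (forall z, F (- z) = - F z) -> \int[gauss v]_z F z = 0.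
Proof.
move=> v0 iF oF; have mF := integrableR_measurable _ _ iF.
have mN : measurable_fun [set: R] (fun x : R => - x) by exact: measurable_funN.
have law : has_law (gauss v) (mkmfun _ mN) (gauss v).
  move=> A mA /=.
  have mNA : measurable ((fun x : R => - x) @^-1` A).
    by rewrite -[X in measurable X]setTI; exact: mN.
  pose I z : \bar R := (\1_A z)%:E.
  have mI : measurable_fun [set: R] I by exact/measurable_EFinP/measurable_indic.
  have I0 x : (0 <= I x)%E by rewrite lee_fin indicE ler0n.
  transitivity (\int[gauss v]_z I (- z)%R)%E.
    by rewrite -[in LHS](setIT (_ @^-1` A)) -integral_indic.
  transitivity (\int[gauss v]_z I z)%E; last first.
    by rewrite integral_indic// setIT.
  rewrite (ge0_integral_gauss v _ v0 mI I0).
  rewrite (ge0_integral_gauss v (fun z => I (- z)) v0); last 2 first.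
  - exact: (measurableT_comp mI mN).
  - by move=> x; exact: I0.
  exact/esym/normal_symmetric.
have iFN : integrableR (gauss v) (fun z => F (- z)).
  exact: (integrableR_law (gauss v) F law iF).
have := Rint_law (gauss v) F law mF iFN => /= E.
have : \int[gauss v]_z F (- z) = - \int[gauss v]_z F z.
  rewrite -mulN1r -RintZ//; apply: eq_Rintegral => z _.
  by rewrite oF mulN1r.
by rewrite E; lra.
Qed.

(** The exponential moments determine the second moment m.  Since
    exp (c z^2) >= 1 + c z^2, the number 1 + c m is at most
    (1 - 2cv)^(-1/2) = 1 + c v + O(c^2) for c of either sign; letting c tend
    to 0 from both sides gives m = v.  This avoids differentiating under the
    integral. *)
Lemma gauss_variance_unique v m : 0 < v -> 0 <= m ->
  (forall c, 2 * c * v < 1 -> 1 + c * m <= (Num.sqrt (1 - 2 * c * v))^-1) ->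
  m = v.
Proof.
move=> v0 m0 H.
(* The hypothesis squared and cleared of the square root. *)
have key c : 2 * c * v < 1 -> 0 <= 1 + c * m ->
    c * (m - v) <= c * (2 * c * m * v).
  move=> cv cm; have d0 : 0 < 1 - 2 * c * v by lra.
  have sd0 : 0 < Num.sqrt (1 - 2 * c * v) by rewrite sqrtr_gt0.
  have := H c cv; rewrite -[X in _ <= X]mul1r ler_pdivlMr// => h.
  have : ((1 + c * m) * Num.sqrt (1 - 2 * c * v)) ^+ 2 <= 1.
    by rewrite expr_le1// mulr_ge0// ltW.
  rewrite exprMn sqr_sqrtr ?(ltW d0)// => {}h.
  have : 0 <= (c * m) ^+ 2 * (1 - 2 * c * v) by rewrite mulr_ge0 ?sqr_ge0// ltW.
  by lra.
apply/le_anti/andP; split; rewrite leNgt; apply/negP => mv.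
  have D0 : 0 < 4 * m * v + m ^+ 2 by nra.
  (* A positive c, small enough for the second-order term to lose against
     m - v. *)
  pose c := (m - v) / (4 * m * v + m ^+ 2).
  have c0 : 0 < c by rewrite divr_gt0// subr_gt0.
  have cD : c * (4 * m * v + m ^+ 2) = m - v by rewrite /c divfK// gt_eqF.
  have cv : 2 * c * v < 1.
    rewrite -(ltr_pM2r D0) mul1r mulrAC -(mulrA 2 c) cD; nra.
  clearbody c; have cm0 : 0 <= 1 + c * m.
    by apply: addr_ge0 => //; apply: mulr_ge0 => //; exact: ltW.
  have := key c cv cm0; rewrite (ler_pM2l c0) -cD.
  have : 0 < c * m * v by rewrite !mulr_gt0//; lra.
  have : 0 <= c * m ^+ 2 by rewrite mulr_ge0 ?sqr_ge0// ltW.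
  by lra.
(* The same with the roles of m and v exchanged, hence at - c. *)
pose c := (v - m) / (4 * v ^+ 2).
have c0 : 0 < c by rewrite divr_gt0 ?subr_gt0// mulr_gt0// exprn_gt0.
have cD : c * (4 * v ^+ 2) = v - m.
  by rewrite /c divfK// gt_eqF// mulr_gt0// exprn_gt0.
clearbody c; have cm : 0 <= 1 + - c * m.
  have : c * m <= c * v by rewrite ler_pM2l// ltW.
  have : c * v * (4 * v) = v - m by rewrite -cD; ring.
  have : 0 <= c * v by rewrite mulr_ge0// ltW.
  move: (c * v) => w w0; nra.
have cv : 2 * - c * v < 1.
  have : 0 < c * v by rewrite mulr_gt0.
  by lra.
have := key (- c) cv cm; rewrite !mulNr lerN2 mulrN mulNr mulNr mulrN.
have : c * (m * v) <= c * (v * v).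
  by rewrite ler_pM2l// ler_wpM2r// ltW.
have := mulr_gt0 c0 (mulr_gt0 v0 v0).
move=> a1 a2 a3.
have : c * (v - m) <= c * (2 * c * m * v) by lra.
by rewrite ler_pM2l// -cD; lra.
Qed.

(** The factors z - 0 and |z - 0| match the conditions of [avg_ge_tangent] and
    [avg_le_lipschitz] at a = 0.  The constant 65 is crude: all that matters is
    that the third absolute moment is of order v^(3/2), so that it is
    negligible against v for small steps. *)
Lemma gauss_moments v : 0 <= v ->
  [/\ admissible (gauss v), \int[gauss v]_z z = 0,
      \int[gauss v]_z z ^+ 2 = v &
      integrableR (gauss v) (fun z => z ^+ 2 * (z - 0)) /\
      \int[gauss v]_z (z ^+ 2 * (z - 0)) = 0] /\
  [/\ integrableR (gauss v) (fun z => z ^+ 2 * `|z - 0|),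
      \int[gauss v]_z (z ^+ 2 * `|z - 0|) <= 65 * (v * Num.sqrt v) &
      \int[gauss v]_z `|z| <= Num.sqrt v].
Proof.
rewrite le_eqVlt => /predU1P[<-|v0].
  have gi (F : R -> R) : measurable_fun [set: R] F ->
      integrableR (gauss 0) F /\ \int[gauss 0]_z F z = F 0.
    move=> mF; have mEF : measurable_fun [set: R] (EFin \o F) by exact/measurable_EFinP.
    split.
      apply/integrableP; split => //.
      rewrite (eq_measure_integral \d_(0 : R)); last first.
        by move=> B mB _; exact: gauss0E.
      rewrite integral_dirac//; last first.
        apply/measurable_EFinP.
        exact: (measurableT_comp (@normr_measurable R setT) mF).
      by rewrite diracT mul1e /= ltry.
    rewrite /Rintegral (eq_measure_integral \d_(0 : R)); last first.
      by move=> B mB _; exact: gauss0E.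
    by rewrite integral_dirac// diracT mul1e.
  have mX n : measurable_fun [set: R] (fun z : R => z ^+ n) by exact: measurable_funX.
  have mN : measurable_fun [set: R] (fun z : R => `|z|) := @normr_measurable R setT.
  have m1 : measurable_fun [set: R] (fun z : R => z) by exact: measurable_id.
  have mp : measurable_fun [set: R] (fun z : R => Num.max 0 z ^+ 3).
    exact: measurable_cube_pos.
  have mB : measurable_fun [set: R] (fun z : R => z ^+ 2 * (z - 0)).
    by apply: measurable_funM => //; exact: measurable_funB.
  have mA : measurable_fun [set: R] (fun z : R => z ^+ 2 * `|z - 0|).
    apply: measurable_funM => //; apply: (measurableT_comp mN).
    exact: measurable_funB.
  have [i1 e1] := gi _ m1; have [i2 e2] := gi _ (mX 2); have [i3 _] := gi _ mp.
  have [iB eB] := gi _ mB; have [iA eA] := gi _ mA; have [iN eN] := gi _ mN.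
  rewrite e1 e2 eB eA eN expr0n/= mul0r normr0 sqrtr0 !mul0r mulr0.
  by split; split.
pose s := Num.sqrt v; have s0 : 0 < s by rewrite sqrtr_gt0.
have sv : s ^+ 2 = v by rewrite sqr_sqrtr// ltW.
have [ie ee] := gauss_exp v _ v0 (c14 v v0).
have z4 (z : R) : 0 <= z ^+ 4 by rewrite expr4 sqr_ge0.
have mX n : measurable_fun [set: R] (fun z : R => z ^+ n) by exact: measurable_funX.
have mN : measurable_fun [set: R] (fun z : R => `|z|) := @normr_measurable R setT.
have i1 : integrableR (gauss v) (fun z => z).
  apply: gauss_integrable => //; exists 1, 1 => z.
  have := sqr_ge0 (z ^+ 2 - 1); have := sqr_ge0 (`|z| - 1).
  have := real_normK (num_real z); move: `|z| => w h.
  rewrite expr4 -h; nra.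
have i2 : integrableR (gauss v) (fun z => z ^+ 2).
  apply: gauss_integrable => //; exists 1, 1 => z.
  rewrite ger0_norm ?sqr_ge0//.
  have := sqr_ge0 (z ^+ 2 - 1); rewrite expr4; nra.
have a3 (z : R) : z ^+ 2 * `|z| <= 1 + z ^+ 4.
  have := sqr_ge0 (z ^+ 2 - 1); have := sqr_ge0 (`|z| - 1).
  have := real_normK (num_real z); have := normr_ge0 z; move: `|z| => w w0 h.
  rewrite expr4 -h; nra.
have mp : measurable_fun [set: R] (fun z : R => Num.max 0 z ^+ 3).
  exact: measurable_cube_pos.
have i3 : integrableR (gauss v) (fun z => Num.max 0 z ^+ 3).
  apply: gauss_integrable => //; exists 1, 1 => z; rewrite mul1r.
  have [z0|z0] := leP 0 z; last first.
    by rewrite expr0n normr0 addr_ge0.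
  have zn : 0 <= z ^+ 3 by rewrite exprn_ge0.
  by rewrite ger0_norm// exprSr -{2}(ger0_norm z0).
have mB : measurable_fun [set: R] (fun z : R => z ^+ 2 * (z - 0)).
  by apply: measurable_funM => //; exact: measurable_funB.
have mA : measurable_fun [set: R] (fun z : R => z ^+ 2 * `|z - 0|).
  apply: measurable_funM => //; apply: (measurableT_comp mN).
  exact: measurable_funB.
have iB : integrableR (gauss v) (fun z => z ^+ 2 * (z - 0)).
  apply: gauss_integrable => //; exists 1, 1 => z; rewrite mul1r.
  by rewrite subr0 normrM (ger0_norm (sqr_ge0 z)).
have iA : integrableR (gauss v) (fun z => z ^+ 2 * `|z - 0|).
  apply: gauss_integrable => //; exists 1, 1 => z; rewrite mul1r.
  by rewrite subr0 ger0_norm// mulr_ge0// sqr_ge0.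
have iN := integrableR_norm _ _ i1.
have m0 : 0 <= \int[gauss v]_z z ^+ 2 by apply: Rint_ge0 => z; exact: sqr_ge0.
have e2 : \int[gauss v]_z z ^+ 2 = v.
  apply: gauss_variance_unique => // c cv; have [ic <-] := gauss_exp v c v0 cv.
  have i1c := integrableR_cst (gauss v) (1 : R).
  have i2c := integrableRZ (gauss v) c _ i2.
  rewrite -[X in X + _](Rint_cst (gauss v)) -RintZ// -RintD//.
  apply: le_Rint => //; first exact: (integrableRD _ _ _ i1c i2c).
  by move=> z; exact: expR_ge1Dx.
split; split => //.
- by apply: gauss_odd.
- split => //; apply: gauss_odd => // z.
  by rewrite !subr0 sqrrN mulrN.
- have iE := integrableRZ (gauss v) (32 * (v * s)) _ ie.
  have iE2 := integrableRZ (gauss v) (s / 2) _ i2.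
  apply: (@le_trans _ _ (\int[gauss v]_z
      (32 * (v * s) * expR ((4 * v)^-1 * z ^+ 2) + s / 2 * z ^+ 2))).
    apply: le_Rint => //; first exact: integrableRD.
    move=> z; rewrite subr0.
    have [_ h4] := gauss_power_bound v z v0.
    (* |z|^3 <= (z^4 / s + s z^2) / 2 with s the standard deviation. *)
    have h3 : z ^+ 2 * `|z| * (2 * s) <= z ^+ 4 + v * z ^+ 2.
      have := sqr_ge0 (z ^+ 2 - s * `|z|); rewrite -sv.
      have := real_normK (num_real z); move: `|z| => w h.
      by rewrite expr4 -h; lra.
    have s2 : 0 < 2 * s by lra.
    rewrite -(ler_pM2r s2); apply: (le_trans h3).
    have -> : (32 * (v * s) * expR ((4 * v)^-1 * z ^+ 2) + s / 2 * z ^+ 2) * (2 * s)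
      = 64 * (v * s ^+ 2) * expR ((4 * v)^-1 * z ^+ 2) + s ^+ 2 * z ^+ 2 by field.
    by rewrite sv lerD2r -expr2.
  rewrite RintD// !RintZ// e2 ee.
  have -> : 1 - 2 * (4 * v)^-1 * v = 2^-1 by field; lra.
  have h2 : (Num.sqrt (2^-1 : R))^-1 <= 2.
    rewrite -[leRHS]invrK lef_pV2 ?posrE ?sqrtr_gt0 ?invr_gt0//.
    rewrite -[leLHS]ger0_norm ?invr_ge0// -sqrtr_sqr ler_sqrt ?invr_gt0//.
    by rewrite expr2 ler_piMl ?invr_ge0// invf_le1// ler1n.
  have vs : 0 < v * s by rewrite mulr_gt0.
  have := ler_wpM2l (ltW vs) h2; rewrite -/s; lra.
- have iE2 := integrableRZ (gauss v) ((2 * s)^-1) _ i2.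
  have ic := integrableR_cst (gauss v) (s / 2).
  apply: (@le_trans _ _ (\int[gauss v]_z ((2 * s)^-1 * z ^+ 2 + s / 2))).
    apply: le_Rint => //; first exact: integrableRD.
    move=> z; have s2 : 0 < 2 * s by lra.
    rewrite -(ler_pM2r s2).
    have -> : ((2 * s)^-1 * z ^+ 2 + s / 2) * (2 * s) = z ^+ 2 + s ^+ 2.
      by field; lra.
    have := sqr_ge0 (`|z| - s); have := real_normK (num_real z).
    move: `|z| => w h; rewrite -h; lra.
  rewrite RintD// RintZ// e2 Rint_cst -sv.
  have -> : (2 * s)^-1 * s ^+ 2 + s / 2 = s by field; lra.
  by rewrite sv.
Qed.

End gauss.

(** * Poisson laws as series *)

Section poisson_series.
Local Open Scope ereal_scope.
Context {R : realType}.
Implicit Types (theta : R).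

Lemma measurable_nat (d : measure_display) (T : measurableType d)
  (f : nat -> T) : measurable_fun [set: nat] f.
Proof. by []. Qed.

Lemma ge0_integral_poisson theta (f : nat -> \bar R) : (0 < theta)%R ->
  (forall k, 0 <= f k) ->
  \int[poisson_prob theta 0%N]_k f k =
  \sum_(k <oo) f k * (poisson_pmf theta k)%:E.
Proof.
move=> t0 f0; have p0 k : 0 <= (poisson_pmf theta k)%:E.
  by rewrite lee_fin poisson_pmf_ge0.
rewrite (ge0_integral_density counting _ (poisson_pmf theta)).
- by rewrite ge0_integral_count// => k; rewrite mule_ge0.
- exact: poisson_pmf_ge0.
- exact: measurable_nat.
- move=> A mA; rewrite /= /poisson_prob t0 esum_mkcond.
  rewrite integral_mkcond ge0_integral_count; last first.
    by move=> k; rewrite patchE; case: ifP.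
  by rewrite nneseries_esumT// => k; rewrite patchE; case: ifP.
- exact: measurable_nat.
- exact: f0.
Qed.

Lemma poisson_prob0E (A : set nat) : poisson_prob (0 : R) 0%N A = \d_0%N A.
Proof. by rewrite /poisson_prob ltxx. Qed.

Lemma integral_poisson0 (f : nat -> \bar R) :
  \int[poisson_prob (0 : R) 0%N]_k f k = f 0%N.
Proof.
rewrite (eq_measure_integral \d_0%N); last first.
  by move=> A mA _; exact: poisson_prob0E.
by rewrite integral_dirac// diracT mul1e.
Qed.

Lemma poisson_pmfS theta k : (0 < theta)%R ->
  (k.+1%:R * poisson_pmf theta k.+1 = theta * poisson_pmf theta k)%R.
Proof.
move=> t0; rewrite /poisson_pmf t0 factS natrM exprS.
have h1 : k.+1%:R != 0%R :> R by rewrite pnatr_eq0.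
have h2 : k`!%:R != 0%R :> R by rewrite pnatr_eq0 -lt0n fact_gt0.
move: h1 h2; move: (k.+1%:R) (k`!%:R) (expR _) => x y e h1 h2.
by field; rewrite h1 h2.
Qed.

(** The identity E[N f(N)] = theta E[f(N + 1)], from
    (k + 1) p(k + 1) = theta p(k); it computes all moments recursively. *)
Lemma poisson_stein theta (f : nat -> \bar R) : (0 <= theta)%R ->
  (forall k, 0 <= f k) ->
  \int[poisson_prob theta 0%N]_k (k%:R%:E * f k) =
  theta%:E * \int[poisson_prob theta 0%N]_k f k.+1.
Proof.
rewrite le_eqVlt => /predU1P[<-|t0] f0.
  by rewrite !integral_poisson0 !mul0e.
rewrite !ge0_integral_poisson//; last by move=> k; rewrite mule_ge0// lee_fin.
have g0 (k : nat) : 0 <= k%:R%:E * f k * (poisson_pmf theta k)%:E.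
  by rewrite !mule_ge0// lee_fin// poisson_pmf_ge0.
rewrite nneseries_recl// !mul0e add0e -(nneseries_addn 1)//.
rewrite -nneseriesZl; last first.
  by move=> k _; rewrite mule_ge0// lee_fin poisson_pmf_ge0.
apply: eq_eseriesr => k _; rewrite addn1 muleAC -EFinM poisson_pmfS// EFinM.
by rewrite -muleA [in RHS](muleC (f _)).
Qed.

Lemma poisson_pmf_conv (a b : R) n : (0 < a)%R -> (0 < b)%R ->
  (\sum_(i < n.+1) poisson_pmf a i * poisson_pmf b (n - i) =
   poisson_pmf (a + b) n)%R.
Proof.
move=> a0 b0; rewrite /poisson_pmf a0 b0 addr_gt0//.
rewrite [X in (X ^+ n)%R]addrC exprDn 2!mulr_suml.
apply: eq_bigr => i _; have /= le_in : (i <= n)%N by rewrite -ltnS.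
rewrite opprD expRD -mulr_natr.
have <- := bin_fact le_in; rewrite !natrM.
have ? : i`!%:R != 0%R :> R by rewrite pnatr_eq0 -lt0n fact_gt0.
have ? : (n - i)`!%:R != 0%R :> R by rewrite pnatr_eq0 -lt0n fact_gt0.
have ? : 'C(n, i)%:R != 0%R :> R by rewrite pnatr_eq0 -lt0n bin_gt0.
by field; do ?(apply/andP; split).
Qed.

(** Both sides are sums over n of the mass given to i + j = n, and the inner
    sum over i is the binomial identity of [poisson_pmf_conv]. *)
Lemma poisson_conv (a b : R) (B : set nat) : (0 <= a)%R -> (0 <= b)%R ->
  \int[poisson_prob a 0%N]_i poisson_prob b 0%N [set j | B (i + j)%N] =
  poisson_prob (a + b)%R 0%N B.
Proof.
have tail (F : nat -> \bar R) n : (forall i, 0 <= F i) ->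
    (forall i, (n <= i)%N -> F i = 0) ->
    \sum_(i <oo) F i = \sum_(i < n) F i.
  move=> F0 Fn; rewrite (nneseries_split 0 n)//= add0n big_mkord.
  rewrite -(nneseries_addn n)// eseries0 ?adde0// => i _ _.
  by rewrite Fn// leq_addl.
have head (F : nat -> \bar R) n : (forall i, 0 <= F i) ->
    (forall i, (i < n)%N -> F i = 0) ->
    \sum_(i <oo) F i = \sum_(j <oo) F (j + n)%N.
  move=> F0 Fn; rewrite (nneseries_split 0 n)//= add0n big_nat big1 ?add0e.
    by rewrite (nneseries_addn n).
  by move=> i /andP[_ /Fn].
have indE (c : R) (C : set nat) : poisson_prob c 0%N C =
    \int[poisson_prob c 0%N]_k (\1_C k)%:E by rewrite integral_indic// setIT.
move=> + b0; rewrite le_eqVlt => /predU1P[<-|a0].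
  by rewrite integral_poisson0 add0r; congr (poisson_prob _ _).
move: b0; rewrite le_eqVlt => /predU1P[<-|b0].
  rewrite addr0 [RHS]indE; apply: eq_integral => i _.
  rewrite poisson_prob0E diracE indicE; congr (_%:R%:E).
  by apply: (congr1 nat_of_bool); apply/idP/idP; rewrite !inE/= addn0.
have I0 (C : set nat) k : 0 <= (\1_C k : R)%:E by rewrite lee_fin indicE.
have p0 (c : R) k : 0 <= (poisson_pmf c k)%:E by rewrite lee_fin poisson_pmf_ge0.
pose F i n : \bar R := if (i <= n)%N then
  (\1_B n)%:E * (poisson_pmf a i * poisson_pmf b (n - i))%:E else 0.
have F0 i n : 0 <= F i n.
  by rewrite /F; case: ifP => // _; rewrite mule_ge0// EFinM mule_ge0.
transitivity (\sum_(i <oo) \sum_(n <oo) F i n).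
  rewrite ge0_integral_poisson//.
  apply: eq_eseriesr => i _.
  rewrite indE ge0_integral_poisson// muleC -nneseriesZl; last first.
    by move=> k _; rewrite mule_ge0.
  rewrite (head (F i) i)//; last by move=> n ni; rewrite /F leqNgt ni.
  apply: eq_eseriesr => j _; rewrite /F leq_addl addnK EFinM muleCA.
  congr (_ * _); congr (_%:E); rewrite !indicE; congr (_%:R).
  by apply: (congr1 nat_of_bool); apply/idP/idP; rewrite !inE/= addnC.
rewrite nneseries_interchange// [RHS]indE ge0_integral_poisson ?addr_gt0//.
apply: eq_eseriesr => n _.
rewrite (tail (F ^~ n) n.+1)//; last by move=> i ni; rewrite /F leqNgt ni.
rewrite -poisson_pmf_conv// -sumEFin ge0_sume_distrr; last first.
  by move=> i _; rewrite EFinM mule_ge0.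
by apply: eq_bigr => i _; rewrite /F -ltnS ltn_ord.
Qed.

End poisson_series.

(** * Centred Poisson laws with jump y *)

Section transport.
Context {d d' : measure_display} {T : measurableType d}
  {T' : measurableType d'} {R : realType} (P : probability T R).
Variables (X : {mfun T >-> T'}) (f : T' -> R).
Hypotheses (mf : measurable_fun [set: T'] f).
Hypothesis (fi : integrableR P (fun w => f (X w))).

Lemma integrableR_distribution : integrableR (distribution P X) f.
Proof.
by apply: integrable_pushforward => //; exact/measurable_EFinP.
Qed.

Lemma Rint_distribution :
  \int[distribution P X]_z f z = \int[P]_w f (X w).
Proof.
rewrite [LHS]/Rintegral /distribution integral_pushforward//.
exact/measurable_EFinP.
Qed.

End transport.

Section poisson_moments.
Context {R : realType}.
Implicit Types (theta y : R).
Notation pois theta := (poisson_prob theta 0%N).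

Lemma poisson_steinR theta (g : nat -> R) : 0 <= theta ->
  (forall k, 0 <= g k) -> integrableR (pois theta) (fun k => g k.+1) ->
  integrableR (pois theta) (fun k => k%:R * g k) /\
  \int[pois theta]_k (k%:R * g k) = theta * \int[pois theta]_k g k.+1.
Proof.
move=> t0 g0 gi.
have E : (\int[pois theta]_k (k%:R * g k)%:E =
    (theta * \int[pois theta]_k g k.+1)%:E)%E.
  under eq_integral do rewrite EFinM.
  rewrite (poisson_stein theta (fun k => (g k)%:E))//.
  by rewrite [in RHS]EFinM EFin_Rint.
have i1 : integrableR (pois theta) (fun k => k%:R * g k).
  apply/integrableP; split; first exact: measurable_nat.
  under eq_integral do rewrite /= ger0_norm ?mulr_ge0//.
  by rewrite E ltry.
by split => //; rewrite /Rintegral E.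
Qed.

(** Integrals of cubic polynomials, from three applications of the Stein
    identity. *)
Lemma poisson_cubic theta (c0 c1 c2 c3 : R) : 0 <= theta ->
  integrableR (pois theta)
    (fun k => c0 + c1 * k%:R + c2 * k%:R ^+ 2 + c3 * k%:R ^+ 3) /\
  \int[pois theta]_k (c0 + c1 * k%:R + c2 * k%:R ^+ 2 + c3 * k%:R ^+ 3) =
  c0 + c1 * theta + c2 * (theta ^+ 2 + theta) +
  c3 * (theta ^+ 3 + 3 * theta ^+ 2 + theta).
Proof.
move=> t0; have ic c := integrableR_cst (pois theta) (c : R).
have [i1' e1'] := poisson_steinR theta (fun=> 1) t0 (fun=> ler01) (ic 1).
have i1 : integrableR (pois theta) (fun k => k%:R).
  by move: i1'; congr (integrableR _ _); apply/funext => k; rewrite mulr1.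
have e1 : \int[pois theta]_k k%:R = theta :> R.
  rewrite Rint_cst mulr1 in e1'; rewrite -[RHS]e1'.
  by apply: eq_Rintegral => k _; rewrite mulr1.
have n0 (k : nat) : 0 <= k%:R :> R by [].
have is1 : integrableR (pois theta) (fun k => k.+1%:R).
  have := integrableRD _ _ _ i1 (ic 1); congr (integrableR _ _).
  by apply/funext => k; rewrite -natr1.
have [i2' e2'] := poisson_steinR theta (fun k => k%:R) t0 n0 is1.
have es1 : \int[pois theta]_k k.+1%:R = theta + 1 :> R.
  rewrite -[X in X + _]e1 -[X in _ + X](Rint_cst (pois theta)) -RintD//.
  by apply: eq_Rintegral => k _; rewrite -natr1.
have i2 : integrableR (pois theta) (fun k => k%:R ^+ 2) by exact: i2'.
have e2 : \int[pois theta]_k k%:R ^+ 2 = theta ^+ 2 + theta :> R.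
  transitivity (theta * (theta + 1)); last by ring.
  by rewrite -es1 -e2'.
have n02 (k : nat) : 0 <= k%:R ^+ 2 :> R by exact: sqr_ge0.
have sE : (fun k : nat => k.+1%:R ^+ 2 : R) =
    (fun k => k%:R ^+ 2 + 2 * k%:R + 1).
  by apply/funext => k; rewrite -natr1; ring.
have i2k := integrableRZ _ 2 _ i1.
have is2 : integrableR (pois theta) (fun k => k.+1%:R ^+ 2).
  by rewrite sE; apply: integrableRD => //; exact: integrableRD.
have es2 : \int[pois theta]_k k.+1%:R ^+ 2 = theta ^+ 2 + 3 * theta + 1 :> R.
  transitivity (\int[pois theta]_k (k%:R ^+ 2 + 2 * k%:R + 1) : R).
    by apply: eq_Rintegral => k _; rewrite -natr1; ring.
  rewrite (RintD _ _ _ (integrableRD _ _ _ i2 i2k) (ic 1)) (RintD _ _ _ i2 i2k).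
  by rewrite RintZ// Rint_cst e1 e2; ring.
have [i3' e3'] := poisson_steinR theta (fun k => k%:R ^+ 2) t0 n02 is2.
have i3 : integrableR (pois theta) (fun k => k%:R ^+ 3).
  by move: i3'; congr (integrableR _ _); apply/funext => k; rewrite exprS.
have e3 : \int[pois theta]_k k%:R ^+ 3 = theta ^+ 3 + 3 * theta ^+ 2 + theta :> R.
  transitivity (theta * (theta ^+ 2 + 3 * theta + 1)); last by ring.
  by rewrite -es2 -e3'; apply: eq_Rintegral => k _; rewrite exprS.
have j1 := integrableRZ _ c1 _ i1; have j2 := integrableRZ _ c2 _ i2.
have j3 := integrableRZ _ c3 _ i3.
have j01 := integrableRD _ _ _ (ic c0) j1.
have j012 := integrableRD _ _ _ j01 j2.
split; first exact: (integrableRD _ _ _ j012 j3).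
rewrite (RintD _ _ _ j012 j3) (RintD _ _ _ j01 j2) (RintD _ _ _ (ic c0) j1).
by rewrite !RintZ// Rint_cst e1 e2 e3.
Qed.

Definition jump y theta : {mfun nat >-> R} :=
  mkmfun _ (measurable_nat _ _ (fun k => y * (k%:R - theta) : R)).

(** The law of y (N - theta) for N Poisson of parameter theta. *)
Definition cpoisson y theta : probability R R :=
  distribution (pois theta) (jump y theta).

Lemma cpoisson_conv y (a b : R) (A : set R) : 0 <= a -> 0 <= b -> measurable A ->
  (\int[cpoisson y a]_z cpoisson y b [set w : R | A ((z : R) + w)%R] =
   cpoisson y (a + b) A)%E.
Proof.
move=> a0 b0 mA.
have mF : measurable_fun [set: R]
    (fun z : R => cpoisson y b [set w : R | A ((z : R) + w)%R]).
  have mS : measurable [set p : (R * R)%type | A (p.1 + p.2)].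
    have mplus : measurable_fun [set: (R * R)%type]
        (fun p : (R * R)%type => p.1 + p.2).
      by apply: measurable_funD; [exact: measurable_fst|exact: measurable_snd].
    by rewrite -[X in measurable X]setTI; exact: mplus.
  have := @measurable_fun_xsection _ _ R R R (cpoisson y b) _ mS.
  congr (measurable_fun _ _); apply/funext => z /=; congr (cpoisson y b _).
  by apply/seteqP; split => w; rewrite /xsection/= inE.
rewrite /cpoisson /distribution ge0_integral_pushforward//.
rewrite /= /pushforward -[RHS](poisson_conv a b)//.
apply: eq_integral => i _; congr (poisson_prob _ _ _).
apply/seteqP; split => j /=; congr (A _); rewrite natrD; ring.
Qed.

(** E Z^3 = y E Z^2 is the statement that the third and second cumulants are
    theta y^3 and theta y^2.  For small theta, Z is mostly within y theta of 0
    or of y, the latter with probability of order theta; so z^2 |z - y| is of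
    order theta^2 in mean. *)
Lemma cpoisson_moments y theta : 0 < y -> 0 <= theta ->
  [/\ admissible (cpoisson y theta), \int[cpoisson y theta]_z z = 0,
      \int[cpoisson y theta]_z z ^+ 2 = theta * y ^+ 2 &
      integrableR (cpoisson y theta) (fun z => z ^+ 2 * (z - y)) /\
      \int[cpoisson y theta]_z (z ^+ 2 * (z - y)) = 0] /\
  (theta <= 1 ->
   integrableR (cpoisson y theta) (fun z => z ^+ 2 * `|z - y|) /\
   \int[cpoisson y theta]_z (z ^+ 2 * `|z - y|) <= 6 * y ^+ 3 * theta ^+ 2).
Proof.
move=> y0 t0.
have mX n : measurable_fun [set: R] (fun z : R => z ^+ n) by exact: measurable_funX.
have m1 : measurable_fun [set: R] (fun z : R => z) by exact: measurable_id.
have mN : measurable_fun [set: R] (fun z : R => `|z|) := @normr_measurable R setT.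
have mB : measurable_fun [set: R] (fun z : R => z ^+ 2 * (z - y)).
  by apply: measurable_funM => //; exact: measurable_funB.
have mA : measurable_fun [set: R] (fun z : R => z ^+ 2 * `|z - y|).
  apply: measurable_funM => //; apply: (measurableT_comp mN).
  exact: measurable_funB.
have poly (F : R -> R) c0 c1 c2 c3 : measurable_fun [set: R] F ->
    (forall k : nat, F (y * (k%:R - theta)) =
      c0 + c1 * k%:R + c2 * k%:R ^+ 2 + c3 * k%:R ^+ 3) ->
    integrableR (cpoisson y theta) F /\
    \int[cpoisson y theta]_z F z = c0 + c1 * theta + c2 * (theta ^+ 2 + theta) +
      c3 * (theta ^+ 3 + 3 * theta ^+ 2 + theta).
  move=> mF FE; have [ip ep] := poisson_cubic theta c0 c1 c2 c3 t0.
  have iF : integrableR (pois theta) (fun k => F (jump y theta k)).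
    by move: ip; congr (integrableR _ _); apply/funext => k /=; rewrite FE.
  split; first exact: integrableR_distribution.
  rewrite Rint_distribution// -ep.
  by apply: eq_Rintegral => k _ /=; rewrite FE.
have [i1 e1] : integrableR (cpoisson y theta) (fun z => z) /\
    \int[cpoisson y theta]_z z = 0.
  have [|i ->] := poly _ (- (y * theta)) y 0 0 m1; first by move=> k; ring.
  by split => //; ring.
have [i2 e2] : integrableR (cpoisson y theta) (fun z => z ^+ 2) /\
    \int[cpoisson y theta]_z z ^+ 2 = theta * y ^+ 2.
  have [|i ->] := poly _ (y ^+ 2 * theta ^+ 2) (- 2 * y ^+ 2 * theta) (y ^+ 2) 0 (mX 2).
    by move=> k; ring.
  by split => //; ring.
have [iB eB] : integrableR (cpoisson y theta) (fun z => z ^+ 2 * (z - y)) /\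
    \int[cpoisson y theta]_z (z ^+ 2 * (z - y)) = 0.
  have [|i ->] := poly _ (- y ^+ 3 * theta ^+ 2 * (theta + 1))
    (y ^+ 3 * (theta ^+ 2 + 2 * theta * (theta + 1)))
    (- y ^+ 3 * (3 * theta + 1)) (y ^+ 3) mB.
    by move=> k; ring.
  by split => //; ring.
have i3 : integrableR (cpoisson y theta) (fun z => Num.max 0 z ^+ 3).
  apply: integrableR_distribution; first exact: measurable_cube_pos.
  have [ip _] := poisson_cubic theta 0 0 0 (y ^+ 3) t0.
  apply: (le_integrableR _ _ (measurable_nat _ _ _) _ ip) => k /=.
  have k0 : 0 <= k%:R :> R by [].
  have yk : 0 <= y * k%:R by rewrite mulr_ge0// ltW.
  rewrite ger0_norm ?exprn_ge0 ?le_max ?lexx//.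
  rewrite (_ : 0 + _ + _ + _ = (y * k%:R) ^+ 3); last by ring.
  rewrite lerXn2r// ?nnegrE ?le_max ?lexx//.
  by rewrite ge_max yk/= ler_wpM2l ?(ltW y0)// gerBl.
split; first by split.
move=> t1.
have [ip ep] := poisson_cubic theta (2 * y ^+ 3 * (theta ^+ 2 * (1 + theta)))
  (2 * y ^+ 3 * theta) 0 0 t0.
have iBn : integrableR (pois theta)
    (fun k => (y * (k%:R - theta)) ^+ 2 * (y * (k%:R - theta) - y)).
  have [i _] := poisson_cubic theta (- y ^+ 3 * theta ^+ 2 * (theta + 1))
    (y ^+ 3 * (theta ^+ 2 + 2 * theta * (theta + 1)))
    (- y ^+ 3 * (3 * theta + 1)) (y ^+ 3) t0.
  by move: i; congr (integrableR _ _); apply/funext => k; ring.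
have isum := integrableRD _ _ _ iBn ip.
have y3 : 0 < y ^+ 3 by rewrite exprn_gt0.
(* For k >= 2 the absolute value may be dropped; the added affine term makes
   up for the sign change at k = 0 and k = 1, and its mean is of order
   theta^2. *)
have bound (k : nat) :
   (y * (k%:R - theta)) ^+ 2 * `|y * (k%:R - theta) - y| <=
   (y * (k%:R - theta)) ^+ 2 * (y * (k%:R - theta) - y) +
   (2 * y ^+ 3 * (theta ^+ 2 * (1 + theta)) + 2 * y ^+ 3 * theta * k%:R +
    0 * k%:R ^+ 2 + 0 * k%:R ^+ 3).
  have -> : y * (k%:R - theta) - y = y * (k%:R - theta - 1) by ring.
  rewrite normrM (gtr0_norm y0).
  have -> : (y * (k%:R - theta)) ^+ 2 * (y * `|k%:R - theta - 1|) =
    y ^+ 3 * ((k%:R - theta) ^+ 2 * `|k%:R - theta - 1|) by ring.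
  have -> : (y * (k%:R - theta)) ^+ 2 * (y * (k%:R - theta - 1)) +
   (2 * y ^+ 3 * (theta ^+ 2 * (1 + theta)) + 2 * y ^+ 3 * theta * k%:R +
    0 * k%:R ^+ 2 + 0 * k%:R ^+ 3) =
    y ^+ 3 * ((k%:R - theta) ^+ 2 * (k%:R - theta - 1) +
      2 * (theta ^+ 2 * (1 + theta)) + 2 * theta * k%:R) by ring.
  rewrite ler_pM2l//; case: k => [|[|k]].
  - by rewrite ler0_norm; [nra|lra].
  - rewrite ler0_norm; last by lra.
    have : theta ^+ 2 <= theta by rewrite expr2 ler_piMr.
    have : 0 <= theta ^+ 2 by exact: sqr_ge0.
    have : 0 <= theta ^+ 3 by rewrite exprn_ge0.
    lra.
  - have k2 : 2 <= k.+2%:R :> R by rewrite ler_nat.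
    rewrite ger0_norm; last by lra.
    have : 0 <= theta ^+ 2 * (1 + theta) by rewrite mulr_ge0 ?sqr_ge0// addr_ge0.
    have : 0 <= theta * k.+2%:R by rewrite mulr_ge0.
    set u := _ ^+ 2 * (_ - 1); lra.
have iA : integrableR (pois theta)
    (fun k => (y * (k%:R - theta)) ^+ 2 * `|y * (k%:R - theta) - y|).
  apply: (le_integrableR _ _ (measurable_nat _ _ _) _ isum) => k.
  by rewrite ger0_norm ?bound// mulr_ge0// sqr_ge0.
split; first exact: (integrableR_distribution _ (jump y theta)).
rewrite (Rint_distribution _ (jump y theta))//.
apply: (le_trans (le_Rint _ _ _ iA isum bound)).
rewrite (RintD _ _ _ iBn ip) ep.
have -> : \int[pois theta]_k
    ((y * (k%:R - theta)) ^+ 2 * (y * (k%:R - theta) - y)) = 0.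
  rewrite -eB; apply/esym.
  exact: (Rint_distribution (pois theta) (jump y theta) _ mB iBn).
have : theta ^+ 3 <= theta ^+ 2 by rewrite exprS ler_piMl// sqr_ge0.
move=> t3; have := ler_wpM2l (ltW y3) t3; lra.
Qed.

End poisson_moments.

(** * The Gauss-Poisson operators *)

Section cubic.
Context {R : realType}.
Implicit Types (M : R) (g : R -> R) (mu nu : probability R R).

Definition cubic M g : Prop := exists g1 k, taylor2 M g g1 k.

Lemma cubic_integrable {M g mu} x : cubic M g -> admissible mu ->
  integrableR mu (fun z => g (x + z)).
Proof. by move=> [g1 [k gk]] amu; exact: (t2_integrable gk _ amu). Qed.

Lemma cubic_avg {M g mu} : cubic M g -> admissible mu -> cubic M (avg mu g).
Proof.
move=> [g1 [k gk]] amu; exists (avg mu g1), (fun x z => avg mu (k^~ z) x).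
exact: t2_avg.
Qed.

Lemma cubic_measurable {M g} : cubic M g -> measurable_fun [set: R] g.
Proof. by move=> [g1 [k gk]]; exact: (t2_measurable gk). Qed.

Lemma le_avg {M g h mu} e x : cubic M g -> cubic M h -> admissible mu ->
  (forall z, g z <= h z + e) -> avg mu g x <= avg mu h x + e.
Proof.
move=> cg ch amu gh; rewrite -[in leRHS](Rint_cst mu e) /avg -RintD; last 2 first.
- exact: cubic_integrable ch amu.
- exact: integrableR_cst.
apply: le_Rint => //; first exact: cubic_integrable cg amu.
by apply: integrableRD; [exact: cubic_integrable ch amu|exact: integrableR_cst].
Qed.

Lemma avgC {M g mu nu} : cubic M g -> admissible mu -> admissible nu ->
  avg mu (avg nu g) = avg nu (avg mu g).
Proof.
move=> [g1 [k gk]] amu anu; apply/funext => x.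
have J1 := joint_law_prod mu nu.
have J2 : joint_law (mu \x nu)%E snd_mfun fst_mfun nu mu.
  by move=> A B mA mB; rewrite setIC muleC; exact: J1.
rewrite -(avg_sum gk _ _ _ _ _ J1 amu anu) -(avg_sum gk _ _ _ _ _ J2 anu amu).
by apply: eq_Rintegral => p _; rewrite [fst_mfun p + _]addrC.
Qed.

Variable y : R.
Hypothesis y0 : 0 < y.

(** E g(x + G + y (N - theta)) for independent normal G of variance v and
    Poisson N of parameter theta: the convolution operator of the infinitely
    divisible law with Gaussian variance v and jumps y at rate theta. *)
Definition levy (v theta : R) g : R -> R :=
  avg (gauss v) (avg (cpoisson y theta) g).

Let admN (v : R) : 0 <= v -> admissible (gauss v).
Proof. by move=> /gauss_moments[[]]. Qed.

Let admQ (theta : R) : 0 <= theta -> admissible (cpoisson y theta).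
Proof. by move=> /(cpoisson_moments _ _ y0)[[]]. Qed.

Lemma cubic_levy {M g} (v theta : R) : 0 <= v -> 0 <= theta -> cubic M g ->
  cubic M (levy v theta g).
Proof.
move=> v0 t0 cg; apply: cubic_avg; last exact: admN.
by apply: cubic_avg => //; exact: admQ.
Qed.

(** Normal and Poisson laws are convolution semigroups and averaging operators
    commute. *)
Lemma levyD {M g} (v theta v' theta' : R) : 0 <= v -> 0 <= theta -> 0 <= v' ->
  0 <= theta' -> cubic M g ->
  levy (v + v') (theta + theta') g = levy v theta (levy v' theta' g).
Proof.
move=> v0 t0 v'0 t'0 cg.
have aN := admN _ v0; have aN' := admN _ v'0.
have aQ := admQ _ t0; have aQ' := admQ _ t'0.
have eN h : cubic M h -> avg (gauss (v + v')) h = avg (gauss v) (avg (gauss v') h).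
  move=> [h1 [k hk]]; apply/funext => x; apply/esym.
  apply: (avg_conv hk) => // A mA; exact: gauss_conv.
have eQ h : cubic M h -> avg (cpoisson y (theta + theta')) h =
    avg (cpoisson y theta) (avg (cpoisson y theta') h).
  move=> [h1 [k hk]]; apply/funext => x; apply/esym.
  apply: (avg_conv hk) => // A mA; exact: cpoisson_conv.
have cg' := cubic_avg cg aQ'.
apply: (etrans (congr1 (avg (gauss (v + v'))) (eQ g cg))).
apply: (etrans (eN _ (cubic_avg cg' aQ))).
exact: (congr1 (avg (gauss v)) (avgC cg' aN' aQ)).
Qed.

Context {M : R} {g g1 : R -> R} {k : R -> R -> R}.
Hypothesis gk : taylor2 M g g1 k.

Let cg : cubic M g.
Proof. by exists g1, k. Qed.

Let avg_shift mu x v c : admissible mu ->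
  avg mu (fun z => g z + c * k z v) x = avg mu g x + c * avg mu (k^~ v) x.
Proof.
move=> amu; rewrite /avg -RintZ; last exact: t2_k_integrable gk _ amu _ _.
rewrite RintD//; first exact: t2_integrable gk _ amu _.
by apply: integrableRZ; exact: t2_k_integrable gk _ amu _ _.
Qed.

(** The tangent inequality at y for the Poisson part, then at 0 for the normal
    part; the term k(., y) left by the former is handled by Jensen's
    inequality, as k is convex in its first variable too. *)
Lemma levy_ge v theta x : 0 <= v -> 0 <= theta ->
  g x + v * k x 0 + theta * y ^+ 2 * k x y <= levy v theta g x.
Proof.
move=> v0 t0; have [[aN N1 N2 [N3 N3']] _] := gauss_moments v v0.
have [[aQ Q1 Q2 [Q3 Q3']] _] := cpoisson_moments y theta y0 t0.
have M0 := t2_M _ _ _ _ gk.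
apply: (@le_trans _ _
    (avg (gauss v) (fun z => g z + theta * y ^+ 2 * k z y) x)).
  rewrite avg_shift// lerD//.
    exact: (avg_ge_tangent gk _ aN 0 v x N1 N2 N3 N3').
  apply: ler_wpM2l; first by rewrite mulr_ge0// sqr_ge0.
  apply: (avg_ge_jensen M (k^~ y)) => //.
  - exact: t2_cvxl gk _.
  - exact: t2_slopel gk _.
  - exact: admissible_integrable.
have iN := t2_integrable gk _ aN x.
have ik := integrableRZ _ (theta * y ^+ 2) _ (t2_k_integrable gk _ aN x y).
apply: le_Rint.
- exact: (integrableRD _ _ _ iN ik).
- exact: (cubic_integrable _ (cubic_avg cg aQ) aN).
- by move=> z; exact: (avg_ge_tangent gk _ aQ y _ _ Q1 Q2 Q3 Q3').
Qed.

(** The same expansion from above: each use of convexity costs a Lipschitz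
    error, and all three errors are of higher order than v + theta. *)
Lemma levy_le v theta x : 0 <= v -> 0 <= theta -> theta <= 1 ->
  levy v theta g x <= g x + v * k x 0 + theta * y ^+ 2 * k x y +
    M * (65 * (v * Num.sqrt v) + theta * y ^+ 2 * Num.sqrt v +
         6 * y ^+ 3 * theta ^+ 2).
Proof.
move=> v0 t0 t1; have [[aN N1 N2 _] [N4 N4' N5]] := gauss_moments v v0.
have [[aQ Q1 Q2 _] /(_ t1)[Q4 Q4']] := cpoisson_moments y theta y0 t0.
have M0 := t2_M _ _ _ _ gk.
have iN := t2_integrable gk _ aN x.
have ik := integrableRZ _ (theta * y ^+ 2) _ (t2_k_integrable gk _ aN x y).
have ic := integrableR_cst (gauss v) (M * (6 * y ^+ 3 * theta ^+ 2)).
have ikc := integrableRD _ _ _ (integrableRD _ _ _ iN ik) ic.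
apply: (@le_trans _ _ (\int[gauss v]_z (g (x + z) + theta * y ^+ 2 * k (x + z) y +
    M * (6 * y ^+ 3 * theta ^+ 2)))).
  apply: le_Rint => //.
    exact: (cubic_integrable _ (cubic_avg cg aQ) aN).
  by move=> z; exact: (avg_le_lipschitz gk _ aQ y _ _ _ Q1 Q2 Q4 Q4').
rewrite (RintD _ _ _ (integrableRD _ _ _ iN ik) ic) (RintD _ _ _ iN ik) Rint_cst.
rewrite RintZ; last exact: t2_k_integrable gk _ aN _ _.
have h1 := avg_le_lipschitz gk _ aN 0 _ x _ N1 N2 N4 N4'.
have h2 := avg_le_norm M (k^~ y) (gauss v) M0 (t2_slopel _ _ _ _ gk y)
  (admissible_integrable _ aN) x _ N5.
have ty : 0 <= theta * y ^+ 2 by rewrite mulr_ge0// sqr_ge0.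
have := ler_wpM2l ty h2; move: h1; rewrite /avg; lra.
Qed.

Lemma levy00 x : levy 0 0 g x = g x.
Proof.
have := levy_ge 0 0 x (lexx 0) (lexx 0).
have := levy_le 0 0 x (lexx 0) (lexx 0) ler01.
rewrite expr0n/= !mul0r !mulr0 !addr0 !mulr0 addr0 => h1 h2.
by apply/le_anti; rewrite h1 h2.
Qed.

End cubic.

(** * Independent families *)

Section partial_sums.
Context {d : measure_display} {T : measurableType d} {R : realType}.
Variable P : probability T R.

Lemma measurable_rsum {n : nat} (X : 'I_n -> {mfun T >-> R}) :
  measurable_fun [set: T] (fun w => \sum_(i < n) X i w).
Proof. by apply: measurable_sum => i. Qed.

Definition rsum {n : nat} (X : 'I_n -> {mfun T >-> R}) : {mfun T >-> R} :=
  mkmfun _ (measurable_rsum X).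

Definition butlast {n : nat} (X : 'I_n.+1 -> {mfun T >-> R}) :
  'I_n -> {mfun T >-> R} := fun i => X (widen_ord (leqnSn n) i).

Lemma rsumS {n : nat} (X : 'I_n.+1 -> {mfun T >-> R}) w :
  rsum X w = rsum (butlast X) w + X ord_max w.
Proof. by rewrite /rsum /= big_ord_recr. Qed.

Definition extend_last {U : Type} {n : nat} (B : 'I_n -> U) (C : U)
  (i : 'I_n.+1) : U := if unlift ord_max i is Some j then B j else C.

Lemma extend_last_widen {U : Type} {n : nat} (B : 'I_n -> U) C (i : 'I_n) :
  extend_last B C (widen_ord (leqnSn n) i) = B i.
Proof.
rewrite /extend_last; have -> : widen_ord (leqnSn n) i = lift ord_max i.
  by apply: val_inj; rewrite /= /bump leqNgt ltn_ord.
by rewrite liftK.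
Qed.

Lemma extend_last_max {U : Type} {n : nat} (B : 'I_n -> U) C :
  extend_last B C ord_max = C.
Proof. by rewrite /extend_last unlift_none. Qed.

Lemma bigcap_ord_recr {n : nat} (F : 'I_n.+1 -> set T) :
  \bigcap_(i in [set: 'I_n.+1]) F i =
  \bigcap_(i in [set: 'I_n]) F (widen_ord (leqnSn n) i) `&` F ord_max.
Proof.
apply/seteqP; split => [w Fw|w [Fw Fm] i _].
  by split; [move=> i _; exact: Fw|exact: Fw].
have [j ->|->] := unliftP ord_max i; last by [].
have -> : lift ord_max j = widen_ord (leqnSn n) j; last exact: Fw.
by apply: val_inj; rewrite /= /bump leqNgt ltn_ord.
Qed.

Lemma mutually_independent_butlast {n : nat} (X : 'I_n.+1 -> {RV P >-> R}) :
  mutually_independent X -> mutually_independent (butlast X : 'I_n -> {RV P >-> R}).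
Proof.
move=> XI B mB.
have mB' i : measurable (extend_last B setT i).
  by rewrite /extend_last; case: unlift.
have := XI _ mB'; rewrite bigcap_ord_recr big_ord_recr/=.
rewrite extend_last_max preimage_setT setIT probability_setT mule1.
under eq_bigr do rewrite extend_last_widen.
move=> <-; congr (P _); apply: eq_bigcapr => i _.
by rewrite extend_last_widen.
Qed.

(** If X, Y and E are independent, so are X + Y and E.  Conditioning on E
    leaves the law of the pair equal to the product law, because the latter is
    determined by its values on rectangles. *)
Let joint_event (E : set T) (mE : measurable E) (X Y : {mfun T >-> R}) :
  (forall A B, measurable A -> measurable B ->
    P (X @^-1` A `&` Y @^-1` B) = (P (X @^-1` A) * P (Y @^-1` B))%E) ->
  (forall A B, measurable A -> measurable B ->
    P ((X @^-1` A `&` Y @^-1` B) `&` E) =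
      (P (X @^-1` A) * P (Y @^-1` B) * P E)%E) ->
  forall B, measurable B ->
    P ((fun w => X w + Y w)%R @^-1` B `&` E) =
    (P ((fun w => X w + Y w)%R @^-1` B) * P E)%E.
Proof.
move=> XY XYE B mB.
have mphi : measurable_fun [set: T] (fun w => (X w, Y w)).
  by apply/measurable_fun_pairP; split => /=.
pose phi := mkmfun _ mphi.
have mplus : measurable_fun [set: (R * R)%type]
    (fun p : (R * R)%type => p.1 + p.2).
  by apply: measurable_funD; [exact: measurable_fst|exact: measurable_snd].
pose D := [set p : (R * R)%type | B (p.1 + p.2)].
have mD : measurable D by rewrite -[X in measurable X]setTI; exact: mplus.
have fE : P E \is a fin_num by exact: fin_num_measure.
have [E0|E0] := eqVneq (P E) 0%E.
  rewrite E0 mule0; apply/eqP; rewrite -measure_le0 -E0.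
  have mXY : measurable ((fun w => X w + Y w)%R @^-1` B).
    have mXY : measurable_fun [set: T] (fun w => X w + Y w)%R.
      exact: measurable_funD.
    by rewrite -[X in measurable X]setTI; exact: mXY.
  by apply: le_measure; rewrite ?inE//; exact: measurableI.
pose c := fine (P E).
have c0 : 0 < c.
  by rewrite fine_gt0// lt0e E0 measure_ge0 ltey_eq fE.
have cE : P E = c%:E by rewrite /c fineK.
have ci0 : 0 <= c^-1 by rewrite invr_ge0 ltW.
have [m' m'E] : exists m' : {measure set (R * R)%type -> \bar R},
    forall A, m' A = (c^-1%:E * P (phi @^-1` A `&` E))%E.
  pose m' : {measure set (R * R)%type -> \bar R} :=
    mscale (NngNum ci0) (pushforward (mrestr P mE) phi).
  by exists (m' mphi).
have eD : (distribution P X \x distribution P Y)%E D = P (phi @^-1` D).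
  transitivity (distribution P phi D) => //.
  by apply: product_measure_unique => // A C mA mC; exact: XY.
have eD' : (distribution P X \x distribution P Y)%E D =
    (c^-1%:E * P (phi @^-1` D `&` E))%E.
  rewrite -m'E; apply: product_measure_unique => // A C mA mC; rewrite m'E.
  transitivity ((c^-1)%:E * (P (X @^-1` A) * P (Y @^-1` C) * P E))%E.
    by rewrite -XYE.
  by rewrite muleC -muleA cE -EFinM divff ?mule1 ?gt_eqF.
have : (c%:E * P (phi @^-1` D) = P (phi @^-1` D `&` E))%E.
  by rewrite -eD eD' muleA -EFinM divff ?mul1e ?gt_eqF.
by rewrite cE muleC => <-.
Qed.

(** The event E is what makes the induction go through: the last summand is
    moved into E, the induction hypothesis applies to the first n, and
    [joint_event] puts the two parts together. *)
Lemma rsum_event {n : nat} (X : 'I_n -> {RV P >-> R}) (E : set T) :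
  mutually_independent X -> measurable E ->
  (forall B : 'I_n -> set R, (forall i, measurable (B i)) ->
    P (\bigcap_(i in [set: 'I_n]) (X i @^-1` B i) `&` E) =
    ((\prod_(i < n) P (X i @^-1` B i)) * P E)%E) ->
  forall B, measurable B ->
    P (rsum X @^-1` B `&` E) = (P (rsum X @^-1` B) * P E)%E.
Proof.
elim: n X E => [|n IH] X E XI mE XE B mB.
  have -> : rsum X @^-1` B = if 0 \in B then setT else set0.
    apply/seteqP; split => w; rewrite /rsum /= big_ord0.
      by move=> B0; rewrite mem_set.
    by case: ifPn => // /set_mem.
  case: ifP => _; first by rewrite setTI probability_setT mul1e.
  by rewrite set0I measure0 mul0e.
have XI' := mutually_independent_butlast _ XI.
set S := rsum (butlast X); set Y := X ord_max.
have mY C : measurable C -> measurable (Y @^-1` C).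
  by move=> mC; rewrite -[X in measurable X]setTI; exact: measurable_funPT.
have mB' (F : 'I_n -> set R) C i : (forall i, measurable (F i)) ->
    measurable C -> measurable (extend_last F C i).
  by move=> mF mC; rewrite /extend_last; case: unlift.
have capE (F : 'I_n -> set R) C :
    \bigcap_(i in [set: 'I_n.+1]) (X i @^-1` extend_last F C i) =
    \bigcap_(i in [set: 'I_n]) (butlast X i @^-1` F i) `&` Y @^-1` C.
  rewrite bigcap_ord_recr extend_last_max; congr (_ `&` _).
  by apply: eq_bigcapr => i _; rewrite extend_last_widen.
have prodE (F : 'I_n -> set R) C :
    (\prod_(i < n.+1) P (X i @^-1` extend_last F C i) =
    (\prod_(i < n) P (butlast X i @^-1` F i)) * P (Y @^-1` C))%E.
  rewrite big_ord_recr /= extend_last_max; congr (_ * _)%E.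
  by apply: eq_bigr => i _; rewrite extend_last_widen.
have YE C : measurable C -> P (Y @^-1` C `&` E) = (P (Y @^-1` C) * P E)%E.
  move=> mC; have := XE _ (fun i => mB' (fun=> setT) C i (fun=> measurableT) mC).
  rewrite capE prodE.
  have -> : \bigcap_(i in [set: 'I_n]) (butlast X i @^-1` setT) = setT.
    by apply/seteqP; split => w.
  rewrite setTI => ->; congr (_ * _)%E; rewrite big1 ?mul1e// => i _.
  by rewrite preimage_setT probability_setT.
have SY A C : measurable A -> measurable C ->
    P (S @^-1` A `&` Y @^-1` C) = (P (S @^-1` A) * P (Y @^-1` C))%E.
  move=> mA mC; apply: IH => //; first exact: mY.
  move=> F mF; have := XI _ (fun i => mB' F C i mF mC).
  by rewrite capE prodE.
have SYE A C : measurable A -> measurable C ->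
    P ((S @^-1` A `&` Y @^-1` C) `&` E) =
      (P (S @^-1` A) * P (Y @^-1` C) * P E)%E.
  move=> mA mC; rewrite -setIA -muleA -YE//; apply: IH => //.
    by apply: measurableI => //; exact: mY.
  move=> F mF; have := XE _ (fun i => mB' F C i mF mC).
  by rewrite capE prodE -setIA -muleA -YE.
have := joint_event _ mE S Y SY SYE _ mB.
have -> // : (fun w => S w + Y w)%R @^-1` B = rsum X @^-1` B.
by apply/seteqP; split => w; rewrite /preimage/= big_ord_recr.
Qed.

Lemma rsum_joint_law {n : nat} (X : 'I_n.+1 -> {RV P >-> R}) :
  mutually_independent X ->
  joint_law P (rsum (butlast X)) (X ord_max)
    (distribution P (rsum (butlast X))) (distribution P (X ord_max)).
Proof.
move=> XI A C mA mC.
have mY : measurable (X ord_max @^-1` C).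
  by rewrite -[X in measurable X]setTI; exact: measurable_funPT.
apply: (rsum_event (butlast X)) => //; first exact: mutually_independent_butlast.
move=> F mF.
have mB' i : measurable (extend_last F C i).
  by rewrite /extend_last; case: unlift.
have := XI _ mB'; rewrite bigcap_ord_recr big_ord_recr/= !extend_last_max.
under eq_bigr do rewrite extend_last_widen.
by under eq_bigcapr do rewrite extend_last_widen.
Qed.

End partial_sums.

Section iid.
Context {R : realType}.

Definition lift_fst {d : measure_display} {T : measurableType d}
    (X : {mfun T >-> R}) : {mfun (T * R)%type >-> R} :=
  mkmfun (fun p : (T * R)%type => X p.1)
    (measurableT_comp (measurable_funPT X) measurable_fst).

Definition lift_snd {d : measure_display} {T : measurableType d} :
    {mfun (T * R)%type >-> R} :=
  mkmfun (fun p : (T * R)%type => p.2) measurable_snd.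

(** The probability space is an iterated product of copies of the line with
    the law mu. *)
Lemma iid_exists (mu : probability R R) (n : nat) :
  exists (d : measure_display) (T : measurableType d) (P : probability T R)
    (X : 'I_n -> {RV P >-> R}),
    mutually_independent X /\ forall i, has_law P (X i) mu.
Proof.
elim: n => [|n [d [T [P [X [XI Xmu]]]]]].
  exists _, R, mu, (fun i : 'I_0 => False_rect _ (notF (ltn_ord i))).
  split; last by case.
  move=> B _; rewrite big_ord0; have <- := probability_setT mu.
  by congr (mu _); apply/seteqP; split => // w _ [].
pose Z : 'I_n.+1 -> {RV (P \x mu)%E >-> R} :=
  extend_last (fun i => lift_fst (X i)) lift_snd.
have Pfst A : measurable A -> (P \x mu)%E (A `*` setT) = P A.
  move=> mA; rewrite product_measure1E// -[RHS]mule1; congr (_ * _)%E.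
  exact: probability_setT.
have Psnd C : measurable C -> (P \x mu)%E (setT `*` C) = mu C.
  move=> mC; rewrite product_measure1E// -[RHS]mul1e; congr (_ * _)%E.
  exact: probability_setT.
have mX i B : measurable B -> measurable (X i @^-1` B).
  by move=> mB; rewrite -[X in measurable X]setTI; exact: measurable_funPT.
have Zw (i : 'I_n) B : measurable B ->
    (P \x mu)%E (Z (widen_ord (leqnSn n) i) @^-1` B) = P (X i @^-1` B).
  move=> mB; rewrite /Z extend_last_widen -Pfst; last exact: mX.
  by congr (product_measure1 _ _ _); apply/seteqP; split => -[p q] //= [].
have Zm B : measurable B -> (P \x mu)%E (Z ord_max @^-1` B) = mu B.
  move=> mB; rewrite /Z extend_last_max -Psnd//.
  by congr (product_measure1 _ _ _); apply/seteqP; split => -[p q] //= [].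
exists _, (T * R)%type, (P \x mu)%E, Z; split; last first.
  move=> i B mB; have [j ->|->] := unliftP ord_max i; last exact: Zm.
  have -> : lift ord_max j = widen_ord (leqnSn n) j.
    by apply: val_inj; rewrite /= /bump leqNgt ltn_ord.
  by apply: etrans (Xmu j B mB); exact: Zw.
move=> B mB; rewrite bigcap_ord_recr big_ord_recr.
transitivity ((\prod_(i < n) P (X i @^-1` B (widen_ord (leqnSn n) i))) *
    mu (B ord_max))%E; last first.
  apply/esym; congr (_ * _)%E; last exact: Zm.
  by apply: eq_bigr => i _; exact: Zw.
rewrite -(XI (fun i => B (widen_ord (leqnSn n) i)))// -product_measure1E//.
  congr (product_measure1 _ _ _); apply/seteqP; split => -[p q] /= [].
    move=> F1 F2; split; last by move: F2; rewrite /Z extend_last_max.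
    by move=> i _; have := F1 i I; rewrite /Z extend_last_widen.
  move=> F1 F2; split; last by rewrite /Z extend_last_max.
  by move=> i _; rewrite /Z extend_last_widen; exact: F1.
by apply: fin_bigcap_measurable => // i _; exact: mX.
Qed.

End iid.

(** * Sums against Gauss-Poisson operators *)

Section le_integral_general.
Context {d : measure_display} {T : measurableType d} {R : realType}.
Variable P : {measure set T -> \bar R}.

(** Monotonicity of the integral in the extended sense, the positive and
    negative parts being compared separately; either side may be infinite. *)
Lemma le_integral_measurable (f g : T -> \bar R) :
  measurable_fun [set: T] f -> measurable_fun [set: T] g ->
  (forall x, f x <= g x)%E -> (\int[P]_x f x <= \int[P]_x g x)%E.
Proof.
move=> mf mg fg; rewrite [leLHS]integralE [leRHS]integralE; apply: leeB.
- apply: ge0_le_integral => //; try exact: measurable_funepos.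
  by move=> x _; rewrite !funeposE; apply: le_max2 => //; exact: fg.
- apply: ge0_le_integral => //; try exact: measurable_funeneg.
  by move=> x _; rewrite !funenegE; apply: le_max2; rewrite ?leeN2.
Qed.

End le_integral_general.

Section sums_vs_levy.
Context {d : measure_display} {T : measurableType d} {R : realType}.
Variable P : probability T R.
Implicit Types (M : R) (g : R -> R).

Lemma admissible_distributionP (X : {mfun T >-> R}) :
  integrableR P (fun w => X w ^+ 2) ->
  integrableR P (fun w => Num.max 0 (X w) ^+ 3) ->
  admissible (distribution P X).
Proof.
move=> i2 i3; split; apply: integrableR_distribution => //.
exact: measurable_cube_pos.
Qed.

Lemma admissible_rsum {n : nat} (X : 'I_n -> {mfun T >-> R}) :
  (forall i, admissible (distribution P (X i))) ->
  admissible (distribution P (rsum X)).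
Proof.
have lawd (Y : {mfun T >-> R}) : has_law P Y (distribution P Y) by [].
elim: n X => [|n IH] X aX.
  apply: admissible_distributionP; rewrite /rsum /=.
    by under eq_fun do rewrite big_ord0 expr0n; exact: integrableR_cst.
  by under eq_fun do rewrite big_ord0 maxxx expr0n; exact: integrableR_cst.
have [S2 S3] := IH (butlast X) (fun i => aX _).
have [Y2 Y3] := aX ord_max.
have {}S2 := integrableR_law P _ (lawd _) S2.
have {}S3 := integrableR_law P _ (lawd _) S3.
have {}Y2 := integrableR_law P _ (lawd _) Y2.
have {}Y3 := integrableR_law P _ (lawd _) Y3.
have mS : measurable_fun [set: T] (rsum X) by exact: measurable_funPT.
apply: admissible_distributionP.
  apply: (le_integrableR P (fun w => 2 * rsum (butlast X) w ^+ 2 + 2 * X ord_max w ^+ 2)).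
  - exact: measurable_funX.
  - move=> w; rewrite rsumS ger0_norm ?sqr_ge0//.
    by have := sqr_ge0 (rsum (butlast X) w - X ord_max w); lra.
  - by apply: integrableRD; exact: integrableRZ.
apply: (le_integrableR P (fun w => 4 * Num.max 0 (rsum (butlast X) w) ^+ 3 +
  4 * Num.max 0 (X ord_max w) ^+ 3)).
- exact: (measurableT_comp measurable_cube_pos).
- by move=> w; rewrite rsumS ger0_norm ?cube_pos_ge0// cube_pos_add.
- by apply: integrableRD; exact: integrableRZ.
Qed.

Lemma Rint_rsumS {n : nat} (X : 'I_n.+1 -> {RV P >-> R}) {M g} :
  mutually_independent X -> (forall i, admissible (distribution P (X i))) ->
  cubic M g ->
  \int[P]_w g (rsum X w) =
  \int[P]_w avg (distribution P (X ord_max)) g (rsum (butlast X) w).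
Proof.
move=> XI aX cg; have [g1 [k gk]] := cg.
have aS : admissible (distribution P (rsum (butlast X))).
  by apply: admissible_rsum => i; exact: aX.
have J := rsum_joint_law P X XI.
have := avg_sum gk _ _ _ _ 0 J aS (aX ord_max).
have -> : \int[P]_w g (0 + (rsum (butlast X) w + X ord_max w)) =
    \int[P]_w g (rsum X w).
  by apply: eq_Rintegral => w _; rewrite add0r rsumS.
move=> ->; have ca := cubic_avg cg (aX ord_max).
rewrite /avg -/(avg _ g) Rint_distribution.
- by apply: eq_Rintegral => w _; rewrite add0r.
- exact: (measurable_shift 0 _ (cubic_measurable ca)).
- have := cubic_integrable 0 ca aS.
  exact: (integrableR_law P (fun z => avg (distribution P (X ord_max)) g (0 + z))).
Qed.

Variable y : R.
Hypothesis y0 : 0 < y.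

Lemma le_levy {M g h} v theta e x : 0 <= v -> 0 <= theta ->
  cubic M g -> cubic M h -> (forall z, g z <= h z + e) ->
  levy y v theta g x <= levy y v theta h x + e.
Proof.
move=> v0 t0 cg ch gh.
have [[aN _ _ _] _] := gauss_moments v v0.
have [[aQ _ _ _] _] := cpoisson_moments y theta y0 t0.
apply: (le_avg e x _ _ aN (M := M)); try exact: cubic_avg.
by move=> z; exact: (le_avg e z cg ch aQ).
Qed.

(** Replace the last summand by its Gauss-Poisson operator and absorb that
    operator into the test function, which stays in the class. *)
Lemma levy_upper {n : nat} (X : 'I_n -> {RV P >-> R}) (v theta : 'I_n -> R) :
  mutually_independent X -> (forall i, admissible (distribution P (X i))) ->
  (forall i, 0 <= v i) -> (forall i, 0 <= theta i) ->
  (forall i M g x, cubic M g ->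
     avg (distribution P (X i)) g x <= levy y (v i) (theta i) g x) ->
  forall M g, cubic M g ->
  \int[P]_w g (rsum X w) <=
    levy y (\sum_(i < n) v i) (\sum_(i < n) theta i) g 0.
Proof.
elim: n X v theta => [|n IH] X v theta XI aX v0 t0 H M g cg.
  have [g1 [k gk]] := cg; rewrite !big_ord0 (levy00 y y0 gk).
  have -> : (fun w => g (rsum X w)) = (fun=> g 0).
    by apply/funext => w; rewrite /rsum /= big_ord0.
  by rewrite Rint_cst.
rewrite (Rint_rsumS X XI aX cg) !big_ord_recr/=.
have ca := cubic_avg cg (aX ord_max).
apply: le_trans.
  apply: (IH (butlast X) (fun i => v (widen_ord (leqnSn n) i))
      (fun i => theta (widen_ord (leqnSn n) i)) _ _ _ _ _ M) => //.
  - exact: mutually_independent_butlast.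
  - by move=> i; exact: aX.
  - by move=> i; exact: H.
set V := \sum_(i < n) _; set Th := \sum_(i < n) _.
have V0 : 0 <= V by apply: sumr_ge0.
have Th0 : 0 <= Th by apply: sumr_ge0.
have L := levyD y y0 V Th (v ord_max) (theta ord_max) V0 Th0 (v0 _) (t0 _) cg.
rewrite L -[leRHS]addr0.
have cl := cubic_levy y y0 _ _ (v0 ord_max) (t0 ord_max) cg.
apply: (le_levy V Th 0 0 V0 Th0 ca cl) => z.
by rewrite addr0; exact: (H _ M).
Qed.

(** The same replacement in the other direction.  The constant M of the class
    is preserved along the way, which is why one error e serves all steps. *)
Lemma levy_lower {n : nat} (X : 'I_n -> {RV P >-> R}) (v theta : 'I_n -> R)
    (M e : R) :
  mutually_independent X -> (forall i, admissible (distribution P (X i))) ->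
  (forall i, 0 <= v i) -> (forall i, 0 <= theta i) ->
  (forall i g x, cubic M g ->
     levy y (v i) (theta i) g x <= avg (distribution P (X i)) g x + e) ->
  forall g, cubic M g ->
  levy y (\sum_(i < n) v i) (\sum_(i < n) theta i) g 0 <=
    \int[P]_w g (rsum X w) + n%:R * e.
Proof.
elim: n X v theta => [|n IH] X v theta XI aX v0 t0 H g cg.
  have [g1 [k gk]] := cg; rewrite !big_ord0 (levy00 y y0 gk).
  have -> : (fun w => g (rsum X w)) = (fun=> g 0).
    by apply/funext => w; rewrite /rsum /= big_ord0.
  by rewrite Rint_cst mul0r addr0.
rewrite (Rint_rsumS X XI aX cg) !big_ord_recr/=.
have ca := cubic_avg cg (aX ord_max).
have := IH (butlast X) (fun i => v (widen_ord (leqnSn n) i))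
      (fun i => theta (widen_ord (leqnSn n) i))
      (mutually_independent_butlast _ _ XI) (fun i => aX _) (fun i => v0 _)
      (fun i => t0 _) (fun i => H _) _ ca.
set V := \sum_(i < n) _; set Th := \sum_(i < n) _.
have V0 : 0 <= V by apply: sumr_ge0.
have Th0 : 0 <= Th by apply: sumr_ge0.
have L := levyD y y0 V Th (v ord_max) (theta ord_max) V0 Th0 (v0 _) (t0 _) cg.
have cl := cubic_levy y y0 _ _ (v0 ord_max) (t0 ord_max) cg.
rewrite L => h.
apply: (le_trans (le_levy V Th e 0 V0 Th0 cl ca (fun z => H ord_max g z cg))).
by rewrite -natr1 mulrDl mul1r addrA lerD2r.
Qed.

End sums_vs_levy.

(** * Nearly extremal laws *)

(** The point masses are indexed by natural numbers so that the law is a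
    finite sum of a sequence of measures. *)
Lemma discrete_law {R : realType} (n : nat) (p a : nat -> R) :
  (forall i, 0 <= p i) -> \sum_(i < n) p i = 1 ->
  exists mu : probability R R, forall F : R -> R, measurable_fun [set: R] F ->
    integrableR mu F /\ \int[mu]_z F z = \sum_(i < n) p i * F (a i).
Proof.
move=> p0 p1.
pose m_ (i : nat) : {measure set R -> \bar R} := mscale (NngNum (p0 i)) \d_(a i).
have ms1 : msum m_ n setT = 1%E.
  rewrite /msum /= -[RHS]/(1%R%:E) -p1 -sumEFin; apply: eq_bigr => i _.
  by rewrite /mscale /= diracT mule1.
pose mu : probability R R := HB.pack (msum m_ n)
  (Measure_isProbability.Build _ _ _ (msum m_ n) ms1).
exists mu => F mF.
have E (G : R -> R) : measurable_fun [set: R] G -> (forall z, 0 <= G z) ->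
    (\int[mu]_z (G z)%:E = (\sum_(i < n) p i * G (a i))%R%:E)%E.
  move=> mG G0; rewrite ge0_integral_measure_sum//; last 2 first.
  - by move=> z _; rewrite lee_fin.
  - exact/measurable_EFinP.
  rewrite -sumEFin; apply: eq_bigr => i _.
  rewrite ge0_integral_mscale//; last 2 first.
  - exact/measurable_EFinP.
  - by move=> z _; rewrite lee_fin.
  by rewrite integral_dirac ?diracT ?mul1e//; exact/measurable_EFinP.
have I (G : R -> R) : measurable_fun [set: R] G -> (forall z, 0 <= G z) ->
    integrableR mu G.
  move=> mG G0; apply/integrableP; split; first exact/measurable_EFinP.
  under eq_integral => z _ do rewrite /= ger0_norm//.
  by rewrite E// ltry.
have mN : measurable_fun [set: R] (fun z => `|F z|).
  exact: (measurableT_comp (@normr_measurable R setT)).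
have mD : measurable_fun [set: R] (fun z => F z + `|F z|) by exact: measurable_funD.
have D0 z : 0 <= F z + `|F z| by rewrite -lerBlDl sub0r ler_normr lexx orbT.
have iD := I _ mD D0; have iN := I _ mN (fun z => normr_ge0 _).
have FE : F = (fun z => F z + `|F z| - `|F z|).
  by apply/funext => z; rewrite addrK.
split; first by rewrite FE; exact: integrableRB.
rewrite [in LHS]FE RintB// /Rintegral !E//= -sumrB.
by apply: eq_bigr => i _; rewrite -mulrBr addrK.
Qed.

(** The weights of the points s, y and - s, solving the linear system given by
    mean 0, second moment S and third positive moment b.  The last bound says
    that all but a fraction of order s of the third moment sits at y. *)
Lemma three_point_weights {R : realType} (S b y s : R) :
  0 < y -> 0 < b -> b < S * y -> 0 < s -> 2 * s <= y -> S * s <= 2 * b ->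
  b * s <= (S * y - b) * y ->
  exists p1 q p2 : R, [/\ 0 <= p1, 0 <= q & 0 <= p2] /\
    [/\ p1 * s + q * y = p2 * s, (p1 + p2) * s ^+ 2 + q * y ^+ 2 = S,
        p1 * s ^+ 3 + q * y ^+ 3 = b & 0 <= b - q * y ^+ 3 <= S * s].
Proof.
move=> y0 b0 bS s0 sy sb sS.
have ys0 : 0 < y - s by lra.
have ys1 : 0 < 2 * y + s by lra.
have D0 : 0 < (2 * y + s) * (y - s) by exact: mulr_gt0.
have s2 : 0 < s ^+ 2 by rewrite exprn_gt0.
pose N := (S * y - b) * y - b * s.
have N0 : 0 <= N by rewrite /N subr_ge0.
pose p1 := N / (s ^+ 2 * ((2 * y + s) * (y - s))).
pose q := (2 * b - S * s) / (y * ((2 * y + s) * (y - s))).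
have p10 : 0 <= p1 by rewrite divr_ge0// mulr_ge0 ?ltW.
have q0 : 0 <= q by rewrite divr_ge0 ?subr_ge0// mulr_ge0 ?ltW.
have [yn sn] : y != 0 /\ s != 0 by rewrite !gt_eqF.
have [ysn yss] : y - s != 0 /\ 2 * y + s != 0 by rewrite !gt_eqF.
have bq : b - q * y ^+ 3 = s * (N / ((2 * y + s) * (y - s))).
  by rewrite /q /N; field; rewrite yn ysn yss.
exists p1, q, (p1 + q * y / s); split.
  split=> //; apply: addr_ge0 => //; apply: divr_ge0; last exact: ltW.
  by apply: mulr_ge0 => //; exact: ltW.
split.
- by field.
- by rewrite /p1 /q /N; field; rewrite yn sn ysn yss.
- by rewrite /p1 /q /N; field; rewrite yn sn ysn yss.
rewrite bq mulr_ge0 ?(ltW s0)//=; last by rewrite divr_ge0// ltW.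
rewrite [leRHS]mulrC ler_wpM2l ?(ltW s0)// ler_pdivrMr//.
have S0 : 0 < S by move: (lt_trans b0 bS); rewrite pmulr_lgt0.
have : N <= S * y ^+ 2.
  have := mulr_gt0 b0 y0; have := mulr_gt0 b0 s0; rewrite /N; clear; lra.
move=> /le_trans; apply; apply: ler_wpM2l; first exact: ltW.
move: y0 s0 sy; clear; nra.
Qed.

Section approximation.
Context {R : realType} (y : R).
Hypothesis y0 : 0 < y.

(** The weights may have a total below 1; the remaining mass is at 0.  The
    extra error comes from the mass that sits at s and - s, where k differs
    little from k x 0, and from the shortfall theta - q of the mass at y. *)
Lemma levy_le_three_point {M : R} {g g1 k} (p1 q p2 s v theta x : R) :
  taylor2 M g g1 k -> 0 <= p1 -> 0 <= q -> 0 <= p2 -> 0 < s ->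
  0 <= v -> 0 <= theta -> theta <= 1 ->
  p1 * s + q * y = p2 * s ->
  (p1 + p2) * s ^+ 2 + q * y ^+ 2 = v + theta * y ^+ 2 ->
  q <= theta ->
  levy y v theta g x <=
    p1 * g (x + s) + q * g (x + y) + p2 * g (x - s) + (1 - p1 - q - p2) * g x +
    M * (65 * (v * Num.sqrt v) + theta * y ^+ 2 * Num.sqrt v +
         6 * y ^+ 3 * theta ^+ 2 + (theta - q) * y ^+ 3 + p2 * s ^+ 3).
Proof.
move=> gk p10 q0 p20 s0 v0 t0 t1 m1 m2 qt.
have M0 := t2_M _ _ _ _ gk.
apply: (le_trans (levy_le y y0 gk v theta x v0 t0 t1)).
have sl := t2_sloper _ _ _ _ gk x.
have /andP[ks _] := sl 0 s (ltW s0).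
have /andP[_ kms] := sl (- s) 0 ltac:(by rewrite oppr_le0 ltW).
have /andP[_ ky] := sl 0 y (ltW y0).
rewrite sub0r opprK in kms; rewrite subr0 in ky.
have h1 : p1 * s ^+ 2 * k x 0 <= p1 * s ^+ 2 * k x s.
  by apply: ler_wpM2l => //; rewrite mulr_ge0 ?sqr_ge0.
have h2 : p2 * s ^+ 2 * k x 0 <= p2 * s ^+ 2 * (k x (- s) + M * s).
  by apply: ler_wpM2l => //; rewrite mulr_ge0 ?sqr_ge0.
have h3 : (theta - q) * y ^+ 2 * k x y <= (theta - q) * y ^+ 2 * (k x 0 + M * y).
  by apply: ler_wpM2l => //; rewrite mulr_ge0 ?sqr_ge0// subr_ge0.
rewrite !(t2E _ _ _ _ gk).
have h4 : v * k x 0 = ((p1 + p2) * s ^+ 2 + q * y ^+ 2 - theta * y ^+ 2) * k x 0.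
  by rewrite m2 addrK.
have h5 : p1 * s * g1 x + q * y * g1 x = p2 * s * g1 x by rewrite -mulrDl m1.
rewrite h4; move: h1 h2 h3 h5.
move: (k x 0) (k x s) (k x (- s)) (k x y) (Num.sqrt v) (g x) (g1 x) => *.
lra.
Qed.

(** The second and the positive third moments are exactly S/n and b/n, and the error of one
    step is at most delta/n, uniformly over the functions with constant M. *)
Lemma approximating_law (S b M delta : R) :
  0 < b -> b < S * y -> 0 <= M -> 0 < delta ->
  exists (n : nat) (mu : probability R R),
    [/\ (0 < n)%N, admissible mu & mu [set z | y < z] = 0%E] /\
    [/\ \int[mu]_z z = 0, \int[mu]_z z ^+ 2 = S / n%:R,
        \int[mu]_z Num.max 0 z ^+ 3 = b / n%:R &
        forall g x, cubic M g ->
          levy y ((S - b / y) / n%:R) (b / y ^+ 3 / n%:R) g x <=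
            avg mu g x + delta / n%:R].
Proof.
move=> b0 bS M0 d0.
have S0 : 0 < S by move: (lt_trans b0 bS); rewrite pmulr_lgt0.
pose v := S - b / y; pose theta := b / y ^+ 3.
have v0 : 0 < v by rewrite subr_gt0 ltr_pdivrMr.
have t0 : 0 < theta by rewrite divr_gt0 ?exprn_gt0.
have vS : v + theta * y ^+ 2 = S.
  by rewrite /v /theta; field; rewrite gt_eqF.
(* M C t bounds n times the error of one step as soon as s, 1/n and the
   standard deviation of the Gaussian part are at most t. *)
pose C := 2 * S + 65 * v + theta * y ^+ 2 + 6 * y ^+ 3 * theta ^+ 2.
have C0 : 0 < C.
  have := mulr_gt0 t0 (exprn_gt0 2 y0).
  have := mulr_gt0 (exprn_gt0 3 y0) (exprn_gt0 2 t0).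
  by rewrite /C; move: S0 v0; clear; lra.
have MC0 : 0 < M * C + 1.
  by rewrite ltr_pwDr// mulr_ge0// ltW.
pose t := delta / (M * C + 1).
have tt0 : 0 < t by exact: divr_gt0.
have tC : M * C * t <= delta.
  rewrite /t mulrA ler_pdivrMr// mulrC ler_wpM2l ?(ltW d0)//.
  by rewrite lerDl ler01.
pose s := Num.min (Num.min t (y / 2)) (Num.min (2 * b / S) ((S * y - b) * y / b)).
have s0 : 0 < s.
  by rewrite !lt_min tt0 !divr_gt0 ?mulr_gt0// subr_gt0.
have /and4P[st sy sb sSy] : [&& s <= t, 2 * s <= y, S * s <= 2 * b &
    b * s <= (S * y - b) * y].
  have : s <= s by [].
  rewrite {2}/s !le_min => /andP[/andP[-> s1] /andP[s2 s3]] /=.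
  rewrite ler_pdivlMr// in s2; rewrite ler_pdivlMr// in s3.
  by rewrite [S * _]mulrC s2 [b * s]mulrC s3; move: s1; clear; lra.
have [p1 [q [p2 [[p10 q0 p20] [m1 m2 m3 /andP[bq0 bq]]]]]] :=
  three_point_weights S b y s y0 b0 bS s0 sy sb sSy.
(* Lower bounds for n: 1/n <= t, sqrt (v/n) <= t, theta/n <= 1, and total
   weight of the three points at most 1. *)
pose B := Num.max (Num.max (t^-1) (v / t ^+ 2)) (Num.max theta (S / s ^+ 2)).
have [n] : exists n : nat, B < n%:R.
  by exists (Num.truncn B).+1; exact: truncnS_gt.
rewrite !gt_max => /andP[/andP[n1 n2] /andP[n3 n4]].
have n0 : 0 < n%:R :> R by exact: lt_trans n3.
pose w : R := n%:R^-1.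
have w0 : 0 < w by rewrite invr_gt0.
have wt : w <= t by rewrite /w -[t]invrK lef_pV2 ?posrE ?invr_gt0// ltW.
have vt : Num.sqrt (v * w) <= t.
  rewrite -[t]ger0_norm ?(ltW tt0)// -sqrtr_sqr ler_wsqrtr//.
  rewrite ler_pdivrMr// mulrC -ler_pdivrMr ?exprn_gt0//; exact: ltW.
have tw1 : theta * w <= 1 by rewrite ler_pdivrMr// mul1r ltW.
have tot : (p1 + q + p2) * w <= 1.
  rewrite ler_pdivrMr// mul1r (le_trans _ (ltW n4))// ler_pdivlMr ?exprn_gt0//.
  rewrite -m2 !mulrDl addrAC lerD2l ler_wpM2l// lerXn2r ?nnegrE ?ltW//.
  by move: sy s0; clear; lra.
pose ps := [:: p1 * w; q * w; p2 * w; 1 - p1 * w - q * w - p2 * w].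
have ps0 i : 0 <= ps`_i.
  case: i => [|[|[|[|i]]]] /=; rewrite ?mulr_ge0 ?(ltW w0)//.
    by move: tot; clear; lra.
  by rewrite nth_nil.
have ps1 : \sum_(i < 4) ps`_i = 1.
  by rewrite !big_ord_recl big_ord0 /= addr0; ring.
have [mu Hmu] := discrete_law 4 (nth 0 ps) (nth 0 [:: s; y; - s; 0]) ps0 ps1.
have E F : measurable_fun [set: R] F -> \int[mu]_z F z =
    (p1 * F s + q * F y + p2 * F (- s)) * w + (1 - (p1 + q + p2) * w) * F 0.
  move=> /Hmu[_ ->]; rewrite !big_ord_recl big_ord0 /= addr0; ring.
have mX k : measurable_fun [set: R] (fun z : R => z ^+ k) by exact: measurable_funX.
have sN : Num.max 0 (- s) = 0 by apply/max_idPl; rewrite oppr_le0 ltW.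
exists n, mu; split; split.
- by rewrite -(ltr_nat R).
- by split; [exact: (Hmu _ (mX 2%N)).1|exact: (Hmu _ measurable_cube_pos).1].
- have mA : measurable [set z : R | y < z].
    by rewrite -set_itvoy; exact: measurable_itv.
  have := E \1_[set z | y < z] (measurable_indic mA).
  rewrite /Rintegral integral_indic// setIT !indicE !memNset/= ?ltxx//.
  + rewrite !mulr0 !addr0 mul0r => /eqP; rewrite fine_eq0 ?fin_num_measure//.
    by move=> /eqP.
  + by apply/negP; rewrite -leNgt ltW.
  + by apply/negP; rewrite -leNgt; move: s0 y0; clear; lra.
  + by apply/negP; rewrite -leNgt; move: sy s0; clear; lra.
- rewrite E; last exact: measurable_id.
  by rewrite m1 mulrN mulr0 addr0 subrr mul0r.
- rewrite E; last exact: mX.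
  rewrite sqrrN expr0n mulr0 addr0 /= -[in RHS]m2 -/w; ring.
- rewrite E; last exact: measurable_cube_pos.
  rewrite sN maxxx expr0n /= !mulr0 !addr0 -/w -[in RHS]m3.
  by have /max_idPr -> := ltW s0; have /max_idPr -> := ltW y0.
move=> g x cg; have [g1 [k gk]] := cg.
have mg : measurable_fun [set: R] (fun z => g (x + z)).
  exact: (measurable_shift x _ (cubic_measurable cg)).
rewrite /avg (E _ mg) addr0 -/w -/v -/theta.
have tq : q * w <= theta * w.
  apply: ler_wpM2r; first exact: ltW.
  by rewrite ler_pdivlMr ?exprn_gt0// -subr_ge0.
have m1w : p1 * w * s + q * w * y = p2 * w * s.
  by rewrite ![_ * w * _]mulrAC -mulrDl m1.
have m2w : (p1 * w + p2 * w) * s ^+ 2 + q * w * y ^+ 2 =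
    v * w + theta * w * y ^+ 2.
  by rewrite [theta * w * _]mulrAC -[RHS]mulrDl vS -m2; ring.
have wp (a : R) : 0 <= a -> 0 <= a * w by move=> a0; rewrite mulr_ge0// ltW.
apply: (le_trans (levy_le_three_point (p1 * w) (q * w) (p2 * w) s (v * w)
  (theta * w) x gk (wp _ p10) (wp _ q0) (wp _ p20) s0 (wp _ (ltW v0))
  (wp _ (ltW t0)) tw1 m1w m2w tq)).
apply: lerD.
  by rewrite le_eqVlt; apply/orP; left; apply/eqP; ring.
apply: (@le_trans _ _ (M * C * t * w)); last by rewrite ler_wpM2r// ltW.
have -> : M * C * t * w = M * (C * (t * w)) by rewrite !mulrA.
apply: ler_wpM2l => //.
have p2s : p2 * s ^+ 2 <= S.
  rewrite -m2 mulrDl -addrA [leRHS]addrCA lerDl.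
  by rewrite addr_ge0// mulr_ge0// exprn_ge0// ltW.
have e1 : v * w * Num.sqrt (v * w) <= v * w * t.
  by apply: ler_wpM2l vt; exact: (wp _ (ltW v0)).
have e2 : theta * w * y ^+ 2 * Num.sqrt (v * w) <= theta * w * y ^+ 2 * t.
  by apply: ler_wpM2l vt; exact: (mulr_ge0 (wp _ (ltW t0)) (sqr_ge0 y)).
have c6 : 0 <= 6 * y ^+ 3 * theta ^+ 2.
  by rewrite mulr_ge0 ?sqr_ge0// mulr_ge0// exprn_ge0// ltW.
have e3 : 6 * y ^+ 3 * theta ^+ 2 * w * w <= 6 * y ^+ 3 * theta ^+ 2 * w * t.
  by apply: ler_wpM2l wt; exact: wp.
have e4 : (theta - q) * y ^+ 3 * w <= S * t * w.
  apply: ler_wpM2r; first exact: ltW.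
  rewrite mulrBl /theta divfK ?gt_eqF ?exprn_gt0//.
  by apply: (le_trans bq); rewrite ler_wpM2l// ltW.
have e5 : p2 * s ^+ 2 * s * w <= S * t * w.
  apply: ler_wpM2r; first exact: ltW.
  by apply: ler_pM => //; rewrite ?mulr_ge0 ?sqr_ge0// ltW.
rewrite /C -/v -/theta; move: e1 e2 e3 e4 e5; move: (Num.sqrt (v * w)); clearbody v theta.
by clear => r; lra.
Qed.

End approximation.

(** * The expectation of f at the Gauss-Poisson variable *)

Section expectations.
Context {d : measure_display} {T : measurableType d} {R : realType}.
Variable P : probability T R.

Lemma expectationE (X : T -> R) : ('E_P[X] = \int[P]_w (X w)%:E)%E.
Proof. by rewrite unlock. Qed.

(** Fatou's lemma for the nonnegative functions F n - L. *)
Lemma integral_le_of_approx (F : nat -> T -> R) (f L : T -> R) (c : R) :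
  (forall n, integrableR P (F n)) -> integrableR P L ->
  (forall n w, L w <= F n w) -> measurable_fun [set: T] f ->
  (forall w, exists N, forall n, (N <= n)%N -> F n w = f w) ->
  (forall n, \int[P]_w F n w <= c) ->
  (\int[P]_w (f w)%:E <= c%:E)%E.
Proof.
move=> iF iL LF mf Ff Fc.
have iFL n := integrableRB P _ _ (iF n) iL.
have mL := integrableR_measurable _ _ iL.
have Lf w : L w <= f w by have [N /(_ N (leqnn N)) <-] := Ff w.
have Fcvg w : (fun n => (F n w - L w)%:E) @ \oo --> (f w - L w)%:E.
  have [N NF] := Ff w; apply: cvg_near_cst; exists N => // n /= Nn.
  by rewrite NF.
have bound : (\int[P]_w (f w - L w)%:E <= (c - \int[P]_w L w)%:E)%E.
  under eq_integral => w _ do rewrite -(cvg_limn_einf_sup (Fcvg w)).1.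
  apply: (@le_trans _ _ (limn_einf (fun n => \int[P]_w (F n w - L w)%:E)%E)).
    apply: (fatou P measurableT (f := fun n w => (F n w - L w)%:E)).
    - by move=> n; exact/measurable_EFinP/(integrableR_measurable _ _ (iFL n)).
    - by move=> n w _; rewrite lee_fin subr_ge0.
  rewrite limn_einf_lim; apply: lime_le; first exact: is_cvg_einfs.
  apply: nearW => n; apply: (@le_trans _ _ (\int[P]_w (F n w - L w)%:E)%E).
    by apply: ereal_inf_lbound; exists n => /=.
  rewrite -(EFin_Rint _ _ (iFL n)) lee_fin (RintB _ _ _ (iF n) iL).
  by rewrite lerD2r.
have mfL : measurable_fun [set: T] (fun w => f w - L w).
  exact: measurable_funB.
have ifL : integrableR P (fun w => f w - L w).
  apply/integrableP; split; first exact/measurable_EFinP.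
  under eq_integral => w _ do rewrite /= ger0_norm ?subr_ge0//.
  exact: le_lt_trans bound (ltry _).
have fE : f = (fun w => (f w - L w) + L w) by apply/funext => w; rewrite subrK.
have jf : integrableR P f by rewrite fE; exact: integrableRD.
rewrite -(EFin_Rint _ _ jf) lee_fin fE (RintD _ _ _ ifL iL) -lerBrDr.
by rewrite -lee_fin (EFin_Rint _ _ ifL).
Qed.

Context {y v theta : R} {G : {RV P >-> R}} {N : {RV P >-> nat}}.
Hypotheses (y0 : 0 < y) (v0 : 0 < v) (t0 : 0 <= theta).
Hypotheses (GN : independent_pair G N) (Gv : normal_rv v G)
  (Nt : poisson_rv theta N).

(** The hypotheses of the theorem on G and N, in the form of a joint law of the
    two real summands. *)
Lemma levy_rv : exists Z : {mfun T >-> R},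
  (forall w, Z w = y * ((N w)%:R - theta)) /\
  joint_law P G Z (gauss v) (cpoisson y theta).
Proof.
have mZ : measurable_fun [set: T] (jump y theta \o N).
  exact: measurableT_comp.
exists (mkmfun _ mZ); split=> // A B mA mB.
have mjB : measurable (jump y theta @^-1` B).
  by rewrite -[X in measurable X]setTI; exact: measurable_funPT.
rewrite (gaussE _ _ v0) -(Gv _ mA).
rewrite -[mkmfun _ mZ @^-1` B]/(N @^-1` (jump y theta @^-1` B)) GN//.
congr (_ * _)%E; exact: (Nt _ mjB).
Qed.

End expectations.

Section limit_expectations.
Context {d : measure_display} {T : measurableType d} {R : realType}.
Variable P : probability T R.
Context {y v theta : R} {G : {RV P >-> R}} {N : {RV P >-> nat}}.
Hypotheses (y0 : 0 < y) (v0 : 0 < v) (t0 : 0 <= theta).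
Hypotheses (GN : independent_pair G N) (Gv : normal_rv v G)
  (Nt : poisson_rv theta N).

Lemma F3plus_measurable {f : R -> R} : F3plus f -> measurable_fun [set: R] f.
Proof. by move=> [_ [nf _ _ _]]; exact: nondecreasing_measurable. Qed.

Lemma levy_le_expectation {M} {f g : R -> R} : F3plus f -> cubic M g ->
  (forall x, g x <= f x) ->
  ((levy y v theta g 0)%:E <=
    'E_P[fun w => (f (G w + y * ((N w)%:R - theta)))%R])%E.
Proof.
move=> Ff [g1 [k gk]] gf; have [Z [ZE J]] := levy_rv P v0 GN Gv Nt (y := y).
have aN : admissible (gauss v) by have [[]] := gauss_moments v (ltW v0).
have aQ : admissible (cpoisson y theta).
  by have [[]] := cpoisson_moments y theta y0 t0.
have iS := integrableR_sum P gk 0 J aN aQ.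
rewrite expectationE /levy -(avg_sum gk _ _ _ _ 0 J aN aQ) (EFin_Rint _ _ iS).
have mY : measurable_fun [set: T] (fun w => G w + Z w).
  exact: measurable_funD.
apply: le_integral_measurable.
- exact/measurable_EFinP/(integrableR_measurable _ _ iS).
- apply/measurable_EFinP; under eq_fun => w do rewrite -ZE.
  exact: (measurableT_comp (F3plus_measurable Ff) mY).
- by move=> w; rewrite lee_fin add0r -ZE.
Qed.

(** Upper bounds for the Gauss-Poisson operators on all minorants of f in the
    class pass to f itself: the truncations of f at n + 1 converge to it
    pointwise. *)
Lemma expectation_le_of_levy {f : R -> R} (c : R) : F3plus f ->
  (forall M g, cubic M g -> (forall x, g x <= f x) -> levy y v theta g 0 <= c) ->
  ('E_P[fun w => (f (G w + y * ((N w)%:R - theta)))%R] <= c%:E)%E.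
Proof.
move=> Ff Hc; have [Z [ZE J]] := levy_rv P v0 GN Gv Nt (y := y).
have aN : admissible (gauss v) by have [[]] := gauss_moments v (ltW v0).
have aQ : admissible (cpoisson y theta).
  by have [[]] := cpoisson_moments y theta y0 t0.
have /choice[F HF] : forall n : nat, exists g : R -> R,
    [/\ exists M g1 k, taylor2 M g g1 k,
        forall x, x <= n.+1%:R -> g x = f x & forall x, g x <= f x].
  move=> n; have [M [g1 [k [g [gk gE gf]]]]] := truncation f n.+1%:R Ff.
  by exists g; split=> //; exists M, g1, k.
have mY : measurable_fun [set: T] (fun w => G w + Z w).
  exact: measurable_funD.
rewrite expectationE; under eq_integral => w _ do rewrite -ZE.
apply: (integral_le_of_approx P (fun n w => F n (0 + (G w + Z w)))
  _ (fun w => f 0 - (f 1 - f 0) * `|G w + Z w|)).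
(* A common minorant: every truncation agrees with f at 0 and 1, so its
   tangent at 0 has a slope between 0 and f 1 - f 0. *)
- move=> n; have [[M [g1 [k gk]]] _ _] := HF n.
  exact: (integrableR_sum P gk 0 J aN aQ).
- apply: integrableRB; first exact: integrableR_cst.
  apply: integrableRZ; apply: integrableR_norm; apply: integrableRD.
    apply: (integrableR_law P id (joint_law1 P J)).
    exact: admissible_integrable.
  apply: (integrableR_law P id (joint_law2 P J)).
  exact: admissible_integrable.
- move=> n w; have [[M [g1 [k gk]]] FE Ff'] := HF n.
  have F0 : F n 0 = f 0 by apply: FE.
  have F1 : F n 1 = f 1 by apply: FE; rewrite ler1n.
  have := t2_lower gk 0 1; have := t2_lower gk 0 (G w + Z w).
  have g10 := t2_g1 _ _ _ _ gk 0.
  rewrite !add0r F0 F1 mulr1; move: (G w + Z w) => z hz h1.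
  apply: le_trans hz; rewrite lerD2l.
  have : 0 <= (f 1 - f 0 - g1 0) * `|z| by rewrite mulr_ge0//; lra.
  have : 0 <= g1 0 * (z + `|z|).
    by rewrite mulr_ge0// -lerBlDl sub0r ler_normr lexx orbT.
  by lra.
- exact: (measurableT_comp (F3plus_measurable Ff) mY).
- move=> w; exists (Num.truncn (G w + Z w)) => n Nn.
  have [_ FE _] := HF n; rewrite add0r FE//.
  apply: (le_trans (ltW (truncnS_gt _))).
  by rewrite ler_nat ltnS.
- move=> n; have [[M [g1 [k gk]]] _ Ff'] := HF n.
  rewrite (avg_sum gk _ _ _ _ 0 J aN aQ).
  by apply: (Hc M) => //; exists g1, k.
Qed.

End limit_expectations.

(** The slack in the second moments is shared equally; then every b i moves
    towards its ceiling y s' i by the same fraction l, chosen to exhaust the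
    slack in the third moments. *)
Lemma spread_moments {R : realType} (n : nat) (s b : 'I_n -> R) (y S B : R) :
  (0 < n)%N -> (forall i, 0 <= b i <= y * s i) -> 0 <= y ->
  \sum_i s i <= S -> \sum_i b i <= B -> B < y * S ->
  exists s' b' : 'I_n -> R,
    (forall i, [/\ s i <= s' i, b i <= b' i & b' i <= y * s' i]) /\
    \sum_i s' i = S /\ \sum_i b' i = B.
Proof.
move=> n0 bs y0 sS bB BS.
pose s' i := s i + (S - \sum_i s i) / n%:R.
pose l := (B - \sum_i b i) / (y * S - \sum_i b i).
have D0 : 0 < y * S - \sum_i b i by rewrite subr_gt0 (le_lt_trans bB).
have l0 : 0 <= l by apply: divr_ge0; [rewrite subr_ge0|exact: ltW].
have l1 : l <= 1 by rewrite ler_pdivrMr// mul1r lerD2r ltW.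
have ss i : s i <= s' i by rewrite lerDl divr_ge0// subr_ge0.
have bs' i : b i <= y * s' i.
  by have /andP[_ h] := bs i; rewrite (le_trans h)// ler_wpM2l.
have Ss : \sum_i s' i = S.
  have -> : \sum_i s' i = \sum_i s i + \sum_(i < n) (S - \sum_i s i) / n%:R.
    by rewrite -big_split.
  have nn : n%:R != 0 :> R by rewrite pnatr_eq0 -lt0n.
  rewrite sumr_const card_ord -mulr_natr; move: (\sum_i s i) => t.
  by field.
exists s', (fun i => b i + l * (y * s' i - b i)); split.
  move=> i; split=> //.
    by rewrite lerDl mulr_ge0// subr_ge0.
  rewrite addrC -lerBrDr -[leRHS]mul1r ler_wpM2r// subr_ge0; exact: bs'.
split=> //.
have -> : \sum_i (b i + l * (y * s' i - b i)) =
    \sum_i b i + l * (y * (\sum_i s' i) - \sum_i b i).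
  by rewrite mulr_sumr -sumrB mulr_sumr -big_split.
by rewrite Ss /l divfK ?gt_eqF// addrC subrK.
Qed.

(** * Upper bound *)

Section upper_bound.
Context {d : measure_display} {T : measurableType d} {R : realType}.
Variable P : probability T R.

Lemma finite_moment (F : T -> R) (m : R) : measurable_fun [set: T] F ->
  (forall w, 0 <= F w) -> ('E_P[F] <= m%:E)%E -> integrableR P F.
Proof.
move=> mF F0 Fm; apply/integrableP; split; first exact/measurable_EFinP.
rewrite expectationE in Fm; apply: le_lt_trans (ltry m).
by under eq_integral => w _ do rewrite /= ger0_norm//.
Qed.

Lemma ae_le_distribution (X : {mfun T >-> R}) (y : R) :
  (\forall w \ae P, X w <= y) -> \forall z \ae distribution P X, z <= y.
Proof.
move=> [A [mA PA XA]]; exists [set z | y < z]; split.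
- by rewrite -set_itvoy; exact: measurable_itv.
- have mB : measurable [set z | y < z].
    by rewrite -set_itvoy; exact: measurable_itv.
  apply: (subset_measure0 _ mA _ PA).
  + by rewrite -[X in measurable X]setTI; exact: measurable_funPT.
  + by move=> w /= yX; apply: XA => /=; apply/negP; rewrite -ltNge.
- by move=> z /= /negP; rewrite -ltNge.
Qed.

Context {sigma y beta : R} {n : nat} {X : 'I_n -> {RV P >-> R}}.
Hypotheses (y0 : 0 < y) (n0 : (0 < n)%N) (beta_y : beta < y * sigma ^+ 2).
Hypotheses (XI : mutually_independent X) (XB : moment_bounds sigma y beta X).

(** A bound on the sum of the moments makes each of them finite, since they are
    nonnegative.  The relation b i <= y s i comes from the bound X i <= y. *)
Lemma moment_bounds_real : exists s b : 'I_n -> R,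
  (forall i, [/\ admissible (distribution P (X i)),
     \int[distribution P (X i)]_z z <= 0,
     \int[distribution P (X i)]_z z ^+ 2 = s i &
     \int[distribution P (X i)]_z Num.max 0 z ^+ 3 = b i]) /\
  [/\ forall i, 0 <= b i <= y * s i, \sum_i s i <= sigma ^+ 2 &
      \sum_i b i <= beta].
Proof.
case: XB => B2 B3 B1 Xy.
have mX k : measurable_fun [set: R] (fun z : R => z ^+ k).
  exact: measurable_funX.
have m2 i : measurable_fun [set: T] (fun w => X i w ^+ 2).
  exact: (measurableT_comp (mX 2%N)).
have m3 i : measurable_fun [set: T] (fun w => Num.max 0 (X i w) ^+ 3).
  exact: (measurableT_comp measurable_cube_pos).
have p2 i w : 0 <= X i w ^+ 2 by exact: sqr_ge0.
have p3 i w : 0 <= Num.max 0 (X i w) ^+ 3 by exact: cube_pos_ge0.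
have i2 i : integrableR P (fun w => X i w ^+ 2).
  apply: (finite_moment _ (sigma ^+ 2)) => //; apply: le_trans B2.
  rewrite (bigD1 i)//= leeDl// sume_ge0// => j _.
  by apply: expectation_ge0 => w; exact: p2.
have i3 i : integrableR P (fun w => Num.max 0 (X i w) ^+ 3).
  apply: (finite_moment _ beta) => //; apply: le_trans B3.
  rewrite (bigD1 i)//= leeDl// sume_ge0// => j _.
  by apply: expectation_ge0 => w; exact: p3.
have aX i : admissible (distribution P (X i)) by exact: admissible_distributionP.
have i1 i : integrableR P (X i).
  apply: (integrableR_law P id (mu := distribution P (X i))) => //.
  exact: admissible_integrable.
exists (fun i => \int[P]_w X i w ^+ 2), (fun i => \int[P]_w Num.max 0 (X i w) ^+ 3).
split; last split.
- move=> i; split=> //.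
  + rewrite (Rint_distribution P (X i) id)//.
    by rewrite -lee_fin (EFin_Rint _ _ (i1 i)) -expectationE; exact: B1.
  + by rewrite (Rint_distribution P (X i) (fun z => z ^+ 2)).
  + rewrite (Rint_distribution P (X i) (fun z => Num.max 0 z ^+ 3))//.
    exact: measurable_cube_pos.
- move=> i; rewrite Rint_ge0//= -(RintZ _ _ _ (i2 i)) -lee_fin.
  rewrite (EFin_Rint _ _ (i3 i)) (EFin_Rint _ _ (integrableRZ _ y _ (i2 i))).
  apply: ae_ge0_le_integral => //.
  + by move=> w _; rewrite lee_fin.
  + exact/measurable_EFinP.
  + by move=> w _; rewrite lee_fin mulr_ge0// ltW.
  + exact/measurable_EFinP/measurable_funM.
  + apply: filterS (Xy i) => w Xw _; rewrite lee_fin.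
    have [X0|X0] := leP 0 (X i w).
      by rewrite [leLHS]exprS ler_wpM2r// ?sqr_ge0.
    by rewrite expr0n/= mulr_ge0// ltW.
- rewrite -lee_fin -sumEFin; apply: le_trans B2; apply: lee_sum => i _.
  by rewrite expectationE (EFin_Rint _ _ (i2 i)).
- rewrite -lee_fin -sumEFin; apply: le_trans B3; apply: lee_sum => i _.
  by rewrite expectationE (EFin_Rint _ _ (i3 i)).
Qed.

(** S <= n y almost surely, so E f(S) does not change when f is truncated at
    n y. *)
Lemma expectation_sum_le {f : R -> R} : F3plus f ->
  exists M g, [/\ cubic M g, forall x, g x <= f x &
    ('E_P[fun w => (f (\sum_(i < n) X i w))%R] <=
      (levy y (sigma ^+ 2 - beta / y) (beta / y ^+ 3) g 0)%:E)%E].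
Proof.
move=> Ff.
have [s [b [Xsb [bs sS bB]]]] := moment_bounds_real.
have [s' [b' [sb' [Ss' Sb']]]] :=
  spread_moments n s b y _ _ n0 bs (ltW y0) sS bB beta_y.
have [M [g1 [k [g [gk gE gf]]]]] := truncation f (n%:R * y) Ff.
have cg : cubic M g by exists g1, k.
exists M, g; split=> //.
have aX i : admissible (distribution P (X i)) by have [] := Xsb i.
have aS := admissible_rsum P X aX.
have igS : integrableR P (fun w => g (0 + rsum X w)).
  have := integrableR_law P (X := rsum X) (mu := distribution P (rsum X))
    (fun z => g (0 + z)).
  by apply=> //; exact: cubic_integrable cg aS.
have Xy : \forall w \ae P, f (rsum X w) = g (0 + rsum X w).
  have [_ _ _ Xy] := XB.
  have : \forall w \ae P, forall i, X i w <= y by exact: filter_forall.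
  apply: filterS => w Xw; rewrite add0r gE// /rsum /=.
  rewrite -[n in leRHS]card_ord -sum1_card natr_sum mulr_suml.
  by apply: ler_sum => i _; rewrite mul1r.
have mfS : measurable_fun [set: T] (fun w => f (rsum X w)).
  exact: (measurableT_comp (F3plus_measurable Ff)).
rewrite expectationE (_ : (\int[P]_w _)%E = (\int[P]_w (g (rsum X w))%:E)%E).
  have := EFin_Rint _ _ igS; under eq_integral do rewrite add0r.
  move=> <-; rewrite lee_fin; under eq_Rintegral do rewrite add0r.
  have yb : sigma ^+ 2 - beta / y = \sum_i (s' i - b' i / y).
    by rewrite sumrB Ss' -mulr_suml Sb'.
  have yb3 : beta / y ^+ 3 = \sum_i b' i / y ^+ 3 by rewrite -mulr_suml Sb'.
  rewrite yb yb3; apply: (levy_upper P y y0 X _ _ XI aX _ _ _ M) => //.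
  - move=> i; have [_ _ h] := sb' i.
    by rewrite subr_ge0 ler_pdivrMr// mulrC.
  - move=> i; have [_ h _] := sb' i; have /andP[b0 _] := bs i.
    by rewrite divr_ge0 ?exprn_ge0 ?(ltW y0)// (le_trans b0).
  - move=> i M' g' x [g1' [k' gk']].
    have [ai mi si bi] := Xsb i; have [ssi bbi bsi] := sb' i.
    have /andP[b0 _] := bs i; have [_ _ _ Xyi] := XB.
    apply: (le_trans (avg_bounded_above gk' _ ai y (s' i) (b' i) x y0 _ mi _ _)).
    + exact: ae_le_distribution.
    + by rewrite si.
    + by rewrite bi.
    have v0 : 0 <= s' i - b' i / y by rewrite subr_ge0 ler_pdivrMr// mulrC.
    have th0 : 0 <= b' i / y ^+ 3.
      by rewrite divr_ge0 ?exprn_ge0 ?(ltW y0)// (le_trans b0).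
    apply: le_trans (levy_ge y y0 gk' _ _ x v0 th0).
    rewrite (_ : b' i / y ^+ 3 * y ^+ 2 = b' i / y); last first.
      by field; rewrite gt_eqF.
    by rewrite le_eqVlt; apply/orP; left; apply/eqP; ring.
apply: ae_eq_integral => //.
- exact/measurable_EFinP.
- apply/measurable_EFinP; have := integrableR_measurable _ _ igS.
  by under eq_fun do rewrite add0r.
- by apply: filterS Xy => w; rewrite add0r /rsum /= => -> _.
Qed.

End upper_bound.

(** * Lower bound and conclusion *)

(** Independent copies of the approximating law satisfy the constraints with
    equality and reach the Gauss-Poisson operator up to delta. *)
Lemma near_optimal_sum {R : realType} {sigma y beta M delta : R} {f g : R -> R} :
  0 < y -> 0 < beta -> beta < sigma ^+ 2 * y -> 0 < delta ->
  F3plus f -> cubic M g -> (forall x, g x <= f x) ->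
  exists (d : measure_display) (T : measurableType d) (P : probability T R)
      (n : nat) (X : 'I_n -> {RV P >-> R}),
    [/\ (0 < n)%N, mutually_independent X, moment_equalities sigma y beta X &
      ((levy y (sigma ^+ 2 - beta / y) (beta / y ^+ 3) g 0 - delta)%R%:E <=
        'E_P[fun w => (f (\sum_(i < n) X i w))%R])%E].
Proof.
move=> y0 b0 bS d0 Ff cg gf.
have M0 : 0 <= M by have [g1 [k gk]] := cg; exact: t2_M gk.
have [n [mu [[n0 amu mu_y] [mu1 mu2 mu3 step]]]] :=
  approximating_law y y0 (sigma ^+ 2) beta M delta b0 bS M0 d0.
have [d [T [P [X [XI Xmu]]]]] := iid_exists mu n.
exists d, T, P, n, X.
have nE (a : R) : (a / n%:R) *+ n = a.
  by rewrite -(mulr_natr (a / n%:R)) divfK// pnatr_eq0 -lt0n.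
have EX (F : R -> R) (i : 'I_n) : integrableR mu F ->
    ('E_P[fun w => F (X i w)] = (\int[mu]_z F z)%R%:E)%E.
  move=> iF; have iFX := integrableR_law P F (Xmu i) iF.
  rewrite expectationE -(EFin_Rint _ _ iFX) (Rint_law P F (Xmu i) _ iFX)//.
  exact: integrableR_measurable iF.
have sumE (a : R) : (\sum_(i < n) (a / n%:R)%:E = a%:E)%E.
  by rewrite sumEFin sumr_const card_ord nE.
have eqm : moment_equalities sigma y beta X.
  have [a2 a3] := amu; split.
  - under eq_bigr => i _ do rewrite (EX (fun z => z ^+ 2) i a2) mu2.
    exact: sumE.
  - under eq_bigr => i _ do rewrite (EX (fun z => Num.max 0 z ^+ 3) i a3) mu3.
    exact: sumE.
  - by move=> i; rewrite (EX id i (admissible_integrable _ amu)) mu1.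
  - move=> i; have my : measurable [set z : R | y < z].
      by rewrite -set_itvoy; exact: measurable_itv.
    exists (X i @^-1` [set z | y < z]); split.
    + by rewrite -[X in measurable X]setTI; exact: measurable_funPT.
    + by rewrite (Xmu i _ my).
    + by move=> w /= /negP; rewrite -ltNge.
split=> //.
have aX i : admissible (distribution P (X i)).
  have [a2 a3] := amu; apply: admissible_distributionP.
  - exact: (integrableR_law P (fun z => z ^+ 2) (Xmu i)).
  - exact: (integrableR_law P (fun z => Num.max 0 z ^+ 3) (Xmu i)).
have v0 : 0 <= (sigma ^+ 2 - beta / y) / n%:R.
  by rewrite divr_ge0// subr_ge0 ler_pdivrMr// ltW.
have t0 : 0 <= beta / y ^+ 3 / n%:R.
  by rewrite divr_ge0// divr_ge0 ?exprn_ge0// ltW.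
have stepX (i : 'I_n) (h : R -> R) x : cubic M h ->
    levy y ((sigma ^+ 2 - beta / y) / n%:R) (beta / y ^+ 3 / n%:R) h x <=
    avg (distribution P (X i)) h x + delta / n%:R.
  move=> ch; apply: (le_trans (step h x ch)); rewrite lerD2r.
  have ih := cubic_integrable x ch amu.
  have mh := integrableR_measurable _ _ ih.
  rewrite /avg (Rint_distribution P (X i) (fun z => h (x + z)) mh); last first.
    exact: (integrableR_law P (fun z => h (x + z)) (Xmu i)).
  rewrite (Rint_law P (fun z => h (x + z)) (Xmu i) mh)//.
  exact: (integrableR_law P (fun z => h (x + z)) (Xmu i)).
have := levy_lower P y y0 X _ _ M _ XI aX (fun=> v0) (fun=> t0) stepX g cg.
rewrite !sumr_const card_ord (mulr_natl _ n) !nE => low.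
have aS := admissible_rsum P X aX.
have igS : integrableR P (fun w => g (0 + rsum X w)).
  have := integrableR_law P (X := rsum X) (mu := distribution P (rsum X))
    (fun z => g (0 + z)).
  by apply=> //; exact: cubic_integrable cg aS.
have igS' : integrableR P (fun w => g (rsum X w)).
  by move: igS; under eq_fun do rewrite add0r.
apply: (@le_trans _ _ (\int[P]_w g (rsum X w))%R%:E).
  by rewrite lee_fin lerBlDr.
rewrite (EFin_Rint _ _ igS') expectationE; apply: le_integral_measurable.
- exact/measurable_EFinP/(integrableR_measurable _ _ igS').
- apply/measurable_EFinP.
  exact: (measurableT_comp (F3plus_measurable Ff) (measurable_funPT (rsum X))).
- by move=> w; rewrite lee_fin.
Qed.

Lemma moment_equalities_bounds {d : measure_display} {T : measurableType d}
    {R : realType} {P : probability T R} {sigma y beta : R} {n : nat}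
    {X : 'I_n -> {RV P >-> R}} :
  moment_equalities sigma y beta X -> moment_bounds sigma y beta X.
Proof.
by move=> [E2 E3 E1 Xy]; split=> //; [rewrite E2|rewrite E3|move=> i; rewrite E1].
Qed.

Theorem proposition2p3 (R : realType) (sigma y beta eps : R)
    (sigma_gt0 : 0 < sigma) (y_gt0 : 0 < y) (beta_gt0 : 0 < beta)
    (eps_def : eps = beta / (sigma ^+ 2 * y)) (eps01 : 0 < eps < 1)
    (f : R -> R) (Ff : F3plus f)
    (theta : R) (theta_def : theta = eps * sigma ^+ 2 / y ^+ 2)
    (d0 : measure_display) (T0 : measurableType d0) (P0 : probability T0 R)
    (G : {RV P0 >-> R}) (N : {RV P0 >-> nat})
    (GN : independent_pair G N)
    (G_normal : normal_rv ((1 - eps) * sigma ^+ 2) G)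
    (N_poisson : poisson_rv theta N) :
  ereal_sup [set x : \bar R |
      exists (d : measure_display) (T : measurableType d)
             (P : probability T R) (n : nat) (X : 'I_n -> {RV P >-> R}),
        [/\ (0 < n)%N, mutually_independent X, moment_bounds sigma y beta X &
            x = ('E_P[fun w => f (\sum_(i < n) X i w)%R])%E]]
  = ('E_P0[fun w => f (G w + y * ((N w)%:R - theta))%R])%E
  /\
  ereal_sup [set x : \bar R |
      exists (d : measure_display) (T : measurableType d)
             (P : probability T R) (n : nat) (X : 'I_n -> {RV P >-> R}),
        [/\ (0 < n)%N, mutually_independent X,
            moment_equalities sigma y beta X &
            x = ('E_P[fun w => f (\sum_(i < n) X i w)%R])%E]]
  = ('E_P0[fun w => f (G w + y * ((N w)%:R - theta))%R])%E.
Proof.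
have s2 : 0 < sigma ^+ 2 by rewrite exprn_gt0.
have betaE : eps * sigma ^+ 2 = beta / y.
  by rewrite eps_def; field; rewrite !gt_eqF.
have bS : beta < sigma ^+ 2 * y.
  by case/andP: eps01 => _; rewrite eps_def ltr_pdivrMr ?mul1r// mulr_gt0.
have vE : (1 - eps) * sigma ^+ 2 = sigma ^+ 2 - beta / y.
  by rewrite mulrBl mul1r betaE.
have tE : theta = beta / y ^+ 3.
  by rewrite theta_def betaE; field; rewrite gt_eqF.
have v0 : 0 < sigma ^+ 2 - beta / y by rewrite subr_gt0 ltr_pdivrMr.
have t0 : 0 <= beta / y ^+ 3 by rewrite divr_ge0 ?exprn_ge0// ltW.
rewrite vE in G_normal; clear theta_def betaE vE; subst theta.
set sup1 := ereal_sup _; set sup2 := ereal_sup _; set EY := ('E_P0[_])%E.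
have up : (sup1 <= EY)%E.
  apply: ge_ereal_sup => _ [d [T [P [n [X [n0 XI XB ->]]]]]].
  have bS' : beta < y * sigma ^+ 2 by rewrite mulrC.
  have [M [g [cg gf le_levy]]] := expectation_sum_le P y_gt0 n0 bS' XI XB Ff.
  apply: (le_trans le_levy).
  exact: (levy_le_expectation P0 y_gt0 v0 t0 GN G_normal N_poisson Ff cg gf).
have sub : (sup2 <= sup1)%E.
  apply: le_ereal_sup => x [d [T [P [n [X [n0 XI XE xE]]]]]].
  exists d, T, P, n, X; split=> //; exact: moment_equalities_bounds.
have low : (EY <= sup2)%E.
  have below M g delta : cubic M g -> (forall x, g x <= f x) -> 0 < delta ->
      ((levy y (sigma ^+ 2 - beta / y) (beta / y ^+ 3) g 0 - delta)%R%:E <= sup2)%E.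
    move=> cg gf dl0.
    have [d [T [P [n [X [n0 XI XE le_E]]]]]] :=
      near_optimal_sum y_gt0 beta_gt0 bS dl0 Ff cg gf.
    apply: (le_trans le_E); apply: ereal_sup_ubound.
    by exists d, T, P, n, X.
  case E : sup2 => [c| |].
  - apply: (expectation_le_of_levy P0 y_gt0 v0 t0 GN G_normal N_poisson c Ff).
    move=> M g cg gf; apply/ler_addgt0Pr => e e0.
    by have := below M g e cg gf e0; rewrite E lee_fin lerBlDr.
  - exact: leey.
  (* The value minus infinity is excluded by any one minorant of the class. *)
  - have [M [g1 [k [g [gk _ gf]]]]] := truncation f 0 Ff.
    have cg : cubic M g by exists g1, k.
    by have := below M g 1 cg gf ltr01; rewrite E leeNy_eq.
by split; apply/le_anti; rewrite ?up ?(le_trans sub up) ?low ?(le_trans low sub).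
Qed.
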